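(* For every $\delta\in(0,1)$ there is a constant $C(\delta)>0$, depending only on $\delta$, such that for all $n\in\mathbb N$ $$M_{n,\delta} > C(\delta)\sqrt n .$$
   Context: $\mathbb T$ is the unit circle, identified with $(-\pi,\pi]$ via $\theta\mapsto e^{i\theta}$. For $\delta\in(0,1)$ the Steklov class $S_\delta$ is the set of probability measures $\sigma$ on $\mathbb T$ such that $\sigma'(\theta)\ge \delta/(2\pi)$ at every Lebesgue point of $\sigma$ (equivalently a.e.), where $\sigma'$ is the density of the absolutely continuous part of $\sigma$ with respect to $d\theta$. For $\sigma\in S_\delta$, $\{\phi_n(z,\sigma)\}_{n\ge0}$ are the orthonormal polynomials: $\phi_n(z,\sigma)=\lambda_n z^n+\ldots$ has degree $n$, $\lambda_n>0$, and $\int_{\mathbb T}\phi_n\overline{\phi_m}\,d\sigma=\delta_{n,m}$ (Kronecker delta). Define $M_{n,\delta}=\sup_{\sigma\in S_\delta}\|\phi_n(z,\sigma)\|_{L^\infty(\mathbb T)}$. *)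

(* Defs.v *)
From HB Require Import structures.
From mathcomp Require Import all_boot all_order all_algebra.
From mathcomp Require Import all_classical all_reals all_analysis.
From mathcomp Require Import complex.

Set Implicit Arguments.
Unset Strict Implicit.
Unset Printing Implicit Defensive.

Import Order.TTheory GRing.Theory Num.Theory.
Import numFieldNormedType.Exports.

Local Open Scope classical_set_scope.
Local Open Scope ring_scope.

(* The unit circle is represented by angles: a measure on it is a Borel measure
   on R carried by ]-pi, pi], and a function f on it is read as the function
   t |-> f (expi t). *)
Definition circle (R : realType) : set (measurableTypeR R) :=
  `]- pi, pi]%classic.
Arguments circle R : clear implicits.

Lemma measurable_circle (R : realType) : measurable (circle R).
Proof. exact: measurable_itv. Qed.
Arguments measurable_circle R : clear implicits.

Definition expi (R : realType) (t : R) : R[i] := Complex (cos t) (sin t).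

Definition mutually_singular d (T : measurableType d) (R : realType)
    (mu nu : {measure set T -> \bar R}) : Prop :=
  exists N, [/\ measurable N, mu N = 0%E & nu (~` N) = 0%E].

(* f is a version of the density of the absolutely continuous part of sigma in
   its Lebesgue decomposition sigma = f dt + nu; it is unique up to a Lebesgue
   null set. *)
Definition is_ac_density (R : realType)
    (sigma : {measure set (measurableTypeR R) -> \bar R})
    (f : measurableTypeR R -> R) : Prop :=
  [/\ measurable_fun setT f, (forall t, 0 <= f t) &
   exists2 nu : {measure set (measurableTypeR R) -> \bar R},
     mutually_singular nu lebesgue_measure &
     forall A, measurable A ->
       sigma A = (\int[lebesgue_measure]_(t in A) (f t)%:E + nu A)%E].

Definition steklov (R : realType) (delta : R)
    (sigma : probability (measurableTypeR R) R) : Prop :=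
  sigma (circle R) = 1%E /\
  exists2 f, is_ac_density sigma f &
    {ae lebesgue_measure,
      forall t, circle R t -> delta / (2 * pi) <= f t}.

(* Rintegral is 0 on non-integrable functions; here it is only applied to
   bounded continuous functions and finite measures. *)
Definition circle_integral (R : realType)
    (sigma : {measure set (measurableTypeR R) -> \bar R})
    (g : R[i] -> R[i]) : R[i] :=
  Complex (Rintegral sigma (circle R) (fun t => complex.Re (g (expi t))))
          (Rintegral sigma (circle R) (fun t => complex.Im (g (expi t)))).

Definition orthonormal_polys (R : realType)
    (sigma : {measure set (measurableTypeR R) -> \bar R})
    (phi : nat -> {poly R[i]}) : Prop :=
  (* in the partial order of R[i], 0 < z means that z is real and positive *)
  (forall n, size (phi n) = n.+1 /\ 0 < lead_coef (phi n)) /\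
  (forall n m, circle_integral sigma
     (fun z => (phi n).[z] * conjc (phi m).[z]) = (n == m)%:R).

Definition circle_Linfty (R : realType) (p : {poly R[i]}) : \bar R :=
  Lnorm (mrestr lebesgue_measure (measurable_circle R)) +oo%E
    (fun t => (Normc.normc p.[expi t])%:E).

(* phi is determined by sigma (uniqueness of orthonormal polynomials), so the
   supremum is over sigma alone. *)
Definition steklov_sup (R : realType) (n : nat) (delta : R) : \bar R :=
  ereal_sup [set x | exists sigma phi,
    [/\ steklov delta sigma, orthonormal_polys sigma phi &
        x = circle_Linfty (phi n)]].

(* Main.v *)
From HB Require Import structures.
Require Import Defs.
From mathcomp Require Import all_boot all_order all_algebra.
From mathcomp Require Import all_classical all_reals all_analysis.
From mathcomp Require Import measurable_realfun charge ess_sup_inf complex ring lra.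

Import Order.TTheory GRing.Theory Num.Theory.
Import numFieldNormedType.Exports.

Set Implicit Arguments.
Unset Strict Implicit.
Unset Printing Implicit Defensive.

(** A point of the circle carries a large orthonormal polynomial as soon as the weight
    can be written down together with that polynomial. Let [f] and [g] be polynomials
    with [re f > 0] on the circle, [g] zero-free on the closed disc and [f(0) > 0] real,
    let [N] exceed the degrees of [g] and [f g], and write [g#] for the polynomial equal
    to [z^N conj g] on the circle. Put
<<
      S = 2 f g + g# (f - conj f),     w = re f / |S|^2,     c = 1 / f(0),
      p = z^N conj (g (1 + c f)) + g (1 - c f).
>>
    Then [2 w p = z^N (1 + c f) / S + (1 - c conj f) / conj S] on the circle
    ([opoly_weight]). The polynomial [S] is [2 f g] times a factor at distance
    [|im f| / |f| < 1] from 1, so [1 / S] is a uniform limit of polynomials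
    ([polylim_denomV]), and integrating the identity shows that [p] is orthogonal to
    [1, ..., z^(N-1)] for the weight [w] ([opoly_moment]) and that the integral of
    [|p|^2 w] is [2 pi / f(0)] ([rint_opoly2]). When [f(1)] is real, [re p(1) = 2 re g(1)].
    Hence, up to constants, [phi_N(1)] is at least [re g(1)], and everything is reduced
    to a choice of [f] and [g] for which [w] is nowhere much smaller than its mean.

    On the circle [|S|] lies between [2 |g| (|f| - |im f|)] and [2 |g| (|f| + |im f|)].
    So [w] is bounded below when [|g|^2 |f|^2 <= C re f], and it is at most
    [|f|^2 / (|g|^2 (re f)^3)]. Let [x] be the distance to 1. The lower bound allows
    [g(1)] to reach the order of [sqrt N] if [f(1)] is of order [1 / N]; a good profile is
<<
      |f| ~ x,    re f ~ x^(6/5),    |g| ~ x^(-2/5)      (cut off at 1/N),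
>>
    where [g] also has a peak of height [sqrt N] and width [1 / N] at 1. Then
    [|g|^2 |f|^2] and [re f] are of the same order, and [w] is at most of order
    [x^(-4/5)], which is integrable. The exponent of [re f] must lie strictly between 1
    and 5/4 for this. Fractional powers are produced by lacunary sums of Fejer kernels
    of orders [m 2^(10 k)], with weights [2^(-12 k)] for [f] and [2^(4 k)] for [g]
    ([lac_lower], [lac_upper]).

    To reach every [delta < 1] the weight must moreover be almost constant off a small
    arc. If [m] is large, [f] and [g] are nearly constant off an arc of length about
    [1 / m], and there [w] is nearly [1 / (4 P)] with [P] the limiting value of [f]. On
    that arc the lower bound holds only up to a constant, which is repaired by
    multiplying [g] by a polynomial [h] that is small near 1, close to 1 away from it, and
    nowhere much larger than 1 in modulus ([exists_dip]); this costs a constant factor in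
    [g(1)]. The contribution of the arc to the integral of [w] tends to 0. It is estimated
    by comparing indicator functions of arcs with squared Dirichlet kernels, whose
    integrals are known exactly, so that no arc has to be measured. *)

Local Open Scope ring_scope.
Local Open Scope complex_scope.

Local Notation "z ^*" := (conjc z) : ring_scope.
Local Notation nc := Normc.normc.
Local Notation re := complex.Re.
Local Notation im := complex.Im.

(** * Modulus, real and imaginary parts *)

Section ComplexNumbers.
Context {R : realType}.
Implicit Types (x y z : R[i]) (a b : R).

Lemma reD x y : re (x + y) = re x + re y. Proof. by case: x; case: y. Qed.
Lemma imD x y : im (x + y) = im x + im y. Proof. by case: x; case: y. Qed.
Lemma reN x : re (- x) = - re x. Proof. by case: x. Qed.
Lemma imN x : im (- x) = - im x. Proof. by case: x. Qed.
Lemma reB x y : re (x - y) = re x - re y. Proof. by rewrite reD reN. Qed.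
Lemma imB x y : im (x - y) = im x - im y. Proof. by rewrite imD imN. Qed.
Lemma reM x y : re (x * y) = re x * re y - im x * im y.
Proof. by case: x; case: y. Qed.
Lemma imM x y : im (x * y) = re x * im y + im x * re y.
Proof. by case: x; case: y. Qed.
Lemma reJ x : re x^* = re x. Proof. by case: x. Qed.
Lemma imJ x : im x^* = - im x. Proof. by case: x. Qed.
Lemma reMr a x : re (a%:C * x) = a * re x.
Proof. by rewrite reM /= mul0r subr0. Qed.
Lemma imMr a x : im (a%:C * x) = a * im x.
Proof. by rewrite imM /= mul0r addr0. Qed.

Lemma complex_eq x y : re x = re y -> im x = im y -> x = y.
Proof. by case: x; case: y => ? ? ? ? /= -> ->. Qed.

Definition reimE := (reD, imD, reN, imN, reM, imM, reJ, imJ).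

Lemma re_sum (I : Type) (r : seq I) (P : pred I) (F : I -> R[i]) :
  re (\sum_(i <- r | P i) F i) = \sum_(i <- r | P i) re (F i).
Proof. by elim/big_rec2: _ => [//|i y1 y2 _ <-]; rewrite reD. Qed.

Lemma conjcD x y : (x + y)^* = x^* + y^*. Proof. exact: rmorphD. Qed.
Lemma conjcB x y : (x - y)^* = x^* - y^*. Proof. exact: rmorphB. Qed.
Lemma conjcM x y : (x * y)^* = x^* * y^*. Proof. exact: rmorphM. Qed.
Lemma conjcX x n : (x ^+ n)^* = x^* ^+ n. Proof. exact: rmorphXn. Qed.

Lemma nc_ge0 x : 0 <= nc x.
Proof. by case: x => a b; exact: sqrtr_ge0. Qed.

Lemma sqr_nc x : nc x ^+ 2 = re x ^+ 2 + im x ^+ 2.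
Proof. by case: x => a b /=; rewrite sqr_sqrtr// addr_ge0// sqr_ge0. Qed.

Lemma ncE x : nc x = Num.sqrt (re x ^+ 2 + im x ^+ 2).
Proof. by case: x. Qed.

Lemma ncM x y : nc (x * y) = nc x * nc y. Proof. exact: Normc.normcM. Qed.
Lemma ncD x y : nc (x + y) <= nc x + nc y. Proof. exact: le_normcD. Qed.
Lemma ncN x : nc (- x) = nc x. Proof. exact: normcN. Qed.
Lemma nc0 : nc (0 : R[i]) = 0. Proof. exact: Normc.normc0. Qed.
Lemma nc1 : nc (1 : R[i]) = 1. Proof. exact: Normc.normc1. Qed.
Lemma ncB x y : nc (x - y) <= nc x + nc y.
Proof. by rewrite -(ncN y) ncD. Qed.
Lemma ncBC x y : nc (x - y) = nc (y - x). Proof. by rewrite -ncN opprB. Qed.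
Lemma ncX x n : nc (x ^+ n) = nc x ^+ n.
Proof. by elim: n => [|n IH]; rewrite ?expr0 ?nc1// !exprS ncM IH. Qed.
Lemma ncV x : nc x^-1 = (nc x)^-1. Proof. exact: Normc.normcV. Qed.
Lemma ncJ x : nc x^* = nc x. Proof. by rewrite !ncE reJ imJ sqrrN. Qed.
Lemma ncr a : nc a%:C = `|a|.
Proof. by rewrite ncE /= expr0n addr0 sqrtr_sqr. Qed.
Lemma ncMr a x : 0 <= a -> nc (a%:C * x) = a * nc x.
Proof. by move=> a0; rewrite ncM ncr ger0_norm. Qed.

Lemma nc_natr n : nc (n%:R : R[i]) = n%:R.
Proof. by rewrite -(rmorph_nat (real_complex R)) ncr ger0_norm. Qed.

Lemma nc_eq0 x : (nc x == 0) = (x == 0).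
Proof.
by apply/eqP/eqP => [/Normc.eq0_normc//|->]; rewrite nc0.
Qed.

Lemma nc_gt0 x : (0 < nc x) = (x != 0).
Proof. by rewrite lt_neqAle nc_ge0 andbT eq_sym nc_eq0. Qed.

Lemma ncDl x y : nc x - nc y <= nc (x + y).
Proof.
rewrite lerBlDr -{1}(addrK y x) (le_trans (ncB _ _))//.
Qed.

Lemma norm_re_le x : `|re x| <= nc x.
Proof. by rewrite ncE -sqrtr_sqr ler_sqrt ?lerDl ?sqr_ge0 ?addr_ge0 ?sqr_ge0. Qed.
Lemma norm_im_le x : `|im x| <= nc x.
Proof. by rewrite ncE -sqrtr_sqr ler_sqrt ?lerDr ?sqr_ge0 ?addr_ge0 ?sqr_ge0. Qed.
Lemma re_le x : re x <= nc x.
Proof. exact: le_trans (ler_norm _) (norm_re_le x). Qed.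

Lemma nc_le x : nc x <= `|re x| + `|im x|.
Proof.
rewrite ncE -[leRHS]ger0_norm ?addr_ge0// -sqrtr_sqr ler_sqrt ?sqr_ge0//.
rewrite sqrrD !real_normK ?num_real//.
have: 0 <= `|re x| * `|im x| *+ 2 by rewrite mulrn_wge0// mulr_ge0.
lra.
Qed.

Lemma nc_sum (I : Type) (r : seq I) (P : pred I) (F : I -> R[i]) :
  nc (\sum_(i <- r | P i) F i) <= \sum_(i <- r | P i) nc (F i).
Proof.
elim/big_rec2: _ => [|i y1 y2 _ h]; first by rewrite nc0.
by rewrite (le_trans (ncD _ _))// lerD2l.
Qed.

Lemma mulcJ x : x * x^* = (nc x ^+ 2)%:C.
Proof.
by apply: complex_eq; rewrite ?reM ?imM reJ imJ ?sqr_nc /=; ring.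
Qed.

(** This is why [conj] acts on the circle as [z |-> z^-1]. *)
Lemma circle_mulJ z : nc z = 1 -> z * z^* = 1.
Proof. by move=> z1; rewrite mulcJ z1 expr1n. Qed.

Lemma nc_expi (t : R) : nc (expi t) = 1.
Proof. by rewrite ncE /= cos2Dsin2 sqrtr1. Qed.

Lemma expiX (t : R) n : expi t ^+ n = expi (t *+ n).
Proof.
elim: n => [|n IH]; first by rewrite expr0 mulr0n /expi cos0 sin0.
rewrite exprS IH mulrS; apply: complex_eq.
  by rewrite reM /= cosD.
by rewrite imM /= sinD addrC mulrC [X in _ + X]mulrC addrC; ring.
Qed.

Lemma expi0 : expi (0 : R) = 1.
Proof. by rewrite /expi cos0 sin0. Qed.

End ComplexNumbers.

(** * Integration over the circle *)

Section CircleIntegral.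
Context {R : realType}.
Notation leb := (@lebesgue_measure R).
Implicit Types (u v : R -> R) (U V : R -> R[i]).

(** Unnormalized: the circle has mass [2 pi]. *)
Definition rint u : R := Rintegral leb (circle R) u.

Definition cint U : R[i] := Complex (rint (fun t => re (U t))) (rint (fun t => im (U t))).

(** Continuity through the two coordinates, which is all that the integrals see. *)
Definition ccont U : Prop :=
  continuous (fun t => re (U t)) /\ continuous (fun t => im (U t)).

Lemma circle_integrable u : continuous u ->
  integrable leb (circle R) (EFin \o (u : measurableTypeR R -> R)).
Proof.
move=> cu; apply: (@integrableS _ _ _ leb `[- pi, pi]%classic).
- exact: measurable_itv.
- exact: measurable_circle.
- by apply: subset_itvr; rewrite bnd_simp.
- apply: continuous_compact_integrable; first exact: segment_compact.
  exact: continuous_subspaceT.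
Qed.

Lemma rintD u v : continuous u -> continuous v ->
  rint (fun t => u t + v t) = rint u + rint v.
Proof.
move=> cu cv; apply: RintegralD; [exact: measurable_circle|exact: circle_integrable..].
Qed.

Lemma rintZ a u : continuous u -> rint (fun t => a * u t) = a * rint u.
Proof.
by move=> cu; apply: RintegralZl; [exact: measurable_circle|exact: circle_integrable].
Qed.

Lemma ler_rint u v : continuous u -> continuous v ->
  (forall t, u t <= v t) -> rint u <= rint v.
Proof.
move=> cu cv uv; apply: le_Rintegral; [exact: measurable_circle|exact: circle_integrable..|].
by move=> x _; exact: uv.
Qed.

Lemma lebesgue_circle : leb (circle R) = (2 * pi)%:E.
Proof.
rewrite /circle lebesgue_measure_itv /= lte_fin.
have p0 := @pi_gt0 R.
rewrite ifT; last by lra.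
by rewrite -EFinD; congr EFin; ring.
Qed.

Lemma rint_cst a : rint (fun=> a) = a * (2 * pi).
Proof.
rewrite /rint Rintegral_cst; last exact: measurable_circle.
by congr (_ * _); exact: (congr1 fine lebesgue_circle).
Qed.

Lemma continuous_cstr a : continuous (fun _ : R => a : R).
Proof. by move=> t; exact: cvg_cst. Qed.

Lemma continuousDr u v : continuous u -> continuous v ->
  continuous (fun t => u t + v t).
Proof. by move=> cu cv t; apply: cvgD; [exact: cu|exact: cv]. Qed.

Lemma continuousNr u : continuous u -> continuous (fun t => - u t).
Proof. by move=> cu t; apply: cvgN; exact: cu. Qed.

Lemma continuousBr u v : continuous u -> continuous v ->
  continuous (fun t => u t - v t).
Proof. by move=> cu cv; apply: continuousDr => //; exact: continuousNr. Qed.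

Lemma continuousMr u v : continuous u -> continuous v ->
  continuous (fun t => u t * v t).
Proof. by move=> cu cv t; apply: cvgM; [exact: cu|exact: cv]. Qed.

Lemma continuousMcr a u : continuous u -> continuous (fun t => a * u t).
Proof. by move=> cu; exact: (continuousMr (@continuous_cstr a) cu). Qed.

Lemma continuousVr u : continuous u -> (forall t, u t != 0) ->
  continuous (fun t => (u t)^-1).
Proof. by move=> cu u0 t; apply: cvgV => //; exact: cu. Qed.

Lemma continuous_sumr (I : Type) (r : seq I) (F : I -> R -> R) :
  (forall i, continuous (F i)) -> continuous (fun t => \sum_(i <- r) F i t).
Proof.
move=> cF; elim: r => [|i r IH].
  by under [X in continuous X]eq_fun do rewrite big_nil; exact: continuous_cstr.
by under [X in continuous X]eq_fun do rewrite big_cons; exact: continuousDr.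
Qed.

Lemma rint_sum (I : Type) (r : seq I) (F : I -> R -> R) :
  (forall i, continuous (F i)) ->
  rint (fun t => \sum_(i <- r) F i t) = \sum_(i <- r) rint (F i).
Proof.
move=> cF; elim: r => [|i r IH].
  by under [X in rint X]eq_fun do rewrite big_nil; rewrite big_nil rint_cst mul0r.
under [X in rint X]eq_fun do rewrite big_cons.
by rewrite rintD ?big_cons ?IH//; exact: continuous_sumr.
Qed.

Lemma ccont_cst (c : R[i]) : ccont (fun=> c).
Proof. by split; exact: continuous_cstr. Qed.

Lemma ccontD U V : ccont U -> ccont V -> ccont (fun t => U t + V t).
Proof.
move=> [u1 u2] [v1 v2]; split.
  by under [X in continuous X]eq_fun do rewrite reD; exact: continuousDr.
by under [X in continuous X]eq_fun do rewrite imD; exact: continuousDr.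
Qed.

Lemma ccontM U V : ccont U -> ccont V -> ccont (fun t => U t * V t).
Proof.
move=> [u1 u2] [v1 v2]; split.
  under [X in continuous X]eq_fun do rewrite reM.
  by apply: continuousBr; exact: continuousMr.
under [X in continuous X]eq_fun do rewrite imM.
by apply: continuousDr; exact: continuousMr.
Qed.

Lemma ccontJ U : ccont U -> ccont (fun t => (U t)^*).
Proof.
move=> [u1 u2]; split.
  by under [X in continuous X]eq_fun do rewrite reJ.
by under [X in continuous X]eq_fun do rewrite imJ; exact: continuousNr.
Qed.

Lemma ccontN U : ccont U -> ccont (fun t => - U t).
Proof.
move=> [u1 u2]; split.
  by under [X in continuous X]eq_fun do rewrite reN; exact: continuousNr.
by under [X in continuous X]eq_fun do rewrite imN; exact: continuousNr.
Qed.

Lemma ccontB U V : ccont U -> ccont V -> ccont (fun t => U t - V t).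
Proof. by move=> cU cV; apply: ccontD => //; exact: ccontN. Qed.

Lemma ccont_r u : continuous u -> ccont (fun t => (u t)%:C).
Proof. by move=> cu; split => //=; exact: continuous_cstr. Qed.

Lemma continuous_nc2 U : ccont U -> continuous (fun t => nc (U t) ^+ 2).
Proof.
move=> [u1 u2]; under [X in continuous X]eq_fun do rewrite sqr_nc !expr2.
by apply: continuousDr; exact: continuousMr.
Qed.

(** The inverse is [conj U] divided by the real function [|U|^2]. *)
Lemma ccontV U : ccont U -> (forall t, U t != 0) -> ccont (fun t => (U t)^-1).
Proof.
move=> cU U0.
have -> : (fun t => (U t)^-1) = (fun t => (U t)^* * ((nc (U t) ^+ 2)^-1)%:C).
  apply/funext => t; apply: (mulfI (U0 t)).
  rewrite mulfV// mulrA mulcJ -rmorphM/= mulfV//.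
  by rewrite expf_neq0// nc_eq0.
apply: ccontM; first exact: ccontJ.
apply: ccont_r; apply: continuousVr; first exact: continuous_nc2.
by move=> t; rewrite expf_neq0// nc_eq0.
Qed.

Lemma ccont_expi : ccont (@expi R).
Proof. by split => /=; [exact: continuous_cos|exact: continuous_sin]. Qed.

Lemma ccontX U n : ccont U -> ccont (fun t => U t ^+ n).
Proof.
move=> cU; elim: n => [|n IH]; first exact: ccont_cst.
by under [X in ccont X]eq_fun do rewrite exprS; exact: ccontM.
Qed.

Lemma ccont_horner (p : {poly R[i]}) : ccont (fun t => p.[expi t]).
Proof.
elim/poly_ind: p => [|p c IH].
  by under [X in ccont X]eq_fun do rewrite horner0; exact: ccont_cst.
under [X in ccont X]eq_fun do rewrite hornerD hornerMX hornerC.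
apply: ccontD; last exact: ccont_cst.
by apply: ccontM => //; exact: ccont_expi.
Qed.

Lemma cintD U V : ccont U -> ccont V ->
  cint (fun t => U t + V t) = cint U + cint V.
Proof.
move=> [u1 u2] [v1 v2]; rewrite /cint; apply: complex_eq; rewrite ?reD ?imD /=.
  by rewrite -rintD//; congr rint; apply/funext => t; rewrite reD.
by rewrite -rintD//; congr rint; apply/funext => t; rewrite imD.
Qed.

Lemma rint_lin a b u v : continuous u -> continuous v ->
  rint (fun t => a * u t + b * v t) = a * rint u + b * rint v.
Proof.
by move=> cu cv; rewrite rintD ?rintZ//; exact: continuousMcr.
Qed.

Lemma cintZ c U : ccont U -> cint (fun t => c * U t) = c * cint U.
Proof.
move=> [u1 u2]; rewrite /cint; apply: complex_eq; rewrite ?reM ?imM /=.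
  rewrite -mulNr -rint_lin//; congr rint; apply/funext => t.
  by rewrite reM mulNr.
by rewrite -rint_lin//; congr rint; apply/funext => t; rewrite imM.
Qed.

Lemma cintJ U : ccont U -> cint (fun t => (U t)^*) = (cint U)^*.
Proof.
move=> [u1 u2]; rewrite /cint; apply: complex_eq; rewrite ?reJ ?imJ /=.
  by congr rint; apply/funext => t; rewrite reJ.
rewrite -mulN1r -rintZ//; congr rint; apply/funext => t; rewrite imJ; ring.
Qed.

Lemma cint_sum (I : Type) (r : seq I) (F : I -> R -> R[i]) :
  (forall i, ccont (F i)) ->
  cint (fun t => \sum_(i <- r) F i t) = \sum_(i <- r) cint (F i).
Proof.
move=> cF.
suff [] : ccont (fun t => \sum_(i <- r) F i t) /\
  cint (fun t => \sum_(i <- r) F i t) = \sum_(i <- r) cint (F i) by [].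
elim: r => [|i r [IH1 IH2]].
  under [X in ccont X]eq_fun do rewrite big_nil.
  under [X in cint X]eq_fun do rewrite big_nil.
  rewrite big_nil; split; first exact: ccont_cst.
  by apply: complex_eq => /=; rewrite rint_cst mul0r.
under [X in ccont X]eq_fun do rewrite big_cons.
under [X in cint X]eq_fun do rewrite big_cons.
by rewrite cintD ?big_cons ?IH2//; split => //; exact: ccontD.
Qed.

Lemma cint_r u : cint (fun t => (u t)%:C) = (rint u)%:C.
Proof. by rewrite /cint /= rint_cst mul0r. Qed.

(** The two coordinates are bounded separately, hence the constant [4 pi] instead of
    the optimal [2 pi]. *)
Lemma nc_cint_le U M : ccont U -> (forall t, nc (U t) <= M) ->
  nc (cint U) <= 4 * pi * M.
Proof.
move=> [u1 u2] UM.
have h u : continuous u -> (forall t, `|u t| <= M) -> `|rint u| <= 2 * pi * M.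
  move=> cu uM; rewrite ler_norml; apply/andP; split.
    have -> : - (2 * pi * M) = (- M) * (2 * pi) :> R by ring.
    rewrite -rint_cst; apply: ler_rint => //; first exact: continuous_cstr.
    by move=> t; have := uM t; rewrite ler_norml => /andP[].
  rewrite mulrC -rint_cst; apply: ler_rint => //; first exact: continuous_cstr.
  by move=> t; have := uM t; rewrite ler_norml => /andP[].
rewrite (le_trans (nc_le _))//=.
have := h _ u1 (fun t => le_trans (norm_re_le _) (UM t)).
have := h _ u2 (fun t => le_trans (norm_im_le _) (UM t)).
lra.
Qed.

(** The orthogonality of the powers of [z], from the primitives of [cos] and [sin]. *)
Lemma cint_expiX n : (0 < n)%N -> cint (fun t => expi t ^+ n) = 0.
Proof.
move=> n0; have nr0 : (n%:R : R) != 0 by rewrite pnatr_eq0 -lt0n.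
have p0 := @pi_gt0 R.
have ftc (u v : R -> R) : continuous u -> (forall t : R, is_derive t (1 : R) v (u t)) ->
    v (- pi) = v pi -> rint u = 0.
  move=> cu dv vpi; rewrite /rint /circle Rintegral_itv_obnd_cbnd; last first.
    exact: circle_integrable.
  rewrite /Rintegral (@continuous_FTC2 _ u v) ?vpi ?subee//; first by lra.
  - exact: continuous_subspaceT.
  - have cv : continuous v.
      by move=> t; apply/differentiable_continuous/derivable1_diffP; have [] := dv t.
    split.
    + by move=> t _; have [] := dv t.
    + by apply: cvg_at_right_filter; exact: cv.
    + by apply: cvg_at_left_filter; exact: cv.
  - by move=> t _; rewrite derive1E; have [_] := dv t.
apply: complex_eq => /=.
  under eq_fun do rewrite expiX /= -mulr_natl.
  apply: (ftc _ (fun t => n%:R^-1 * sin (n%:R * t))).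
  - move=> t; apply: continuous_comp; last exact: continuous_cos.
    by apply: mulrl_continuous.
  - move=> t; apply: is_derive_eq.
    by rewrite /GRing.scale /= mulr1 mulrCA mulVf// mulr1.
  - rewrite mulrN sinN; have -> : sin (n%:R * pi) = 0 :> R.
      elim: n {n0 nr0} => [|n IH]; first by rewrite mul0r sin0.
      by rewrite -natr1 mulrDl mul1r sinDpi IH oppr0.
    by rewrite oppr0.
under eq_fun do rewrite expiX /= -mulr_natl.
apply: (ftc _ (fun t => - (n%:R^-1 * cos (n%:R * t)))).
- move=> t; apply: continuous_comp; last exact: continuous_sin.
  by apply: mulrl_continuous.
- move=> t; apply: is_derive_eq.
  by rewrite /GRing.scale /= mulr1 mulNr mulrN opprK mulrCA mulVf// mulr1.
- by rewrite mulrN cosN.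
Qed.

End CircleIntegral.

(** * Uniform limits of polynomials on the circle *)

Lemma exists_expr_le {R : realType} (x e : R) : 0 <= x -> x < 1 -> 0 < e ->
  exists n, x ^+ n <= e.
Proof.
move=> x0 x1 e0.
have : (x ^+ n @[n --> \oo] --> (0 : R))%classic by apply: cvg_expr; rewrite ger0_norm.
move=> /cvgrPdist_le /(_ e e0)[n _ /(_ n (leqnn _))]; rewrite sub0r normrN => h.
by exists n; apply: le_trans h; exact: ler_norm.
Qed.

Section Approximation.
Context {R : realType}.
Implicit Types (U V : R -> R[i]) (P Q : {poly R[i]}).

(** These functions are the boundary values of functions holomorphic in the disc and
    continuous up to the boundary; approximation by polynomials replaces the use of
    Cauchy's theorem. *)
Definition polylim U : Prop := forall e : R, 0 < e ->
  exists P : {poly R[i]}, forall t, nc (U t - P.[expi t]) <= e.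

Lemma poly_circle_bounded P : exists2 M : R, 0 < M & forall t, nc P.[expi t] <= M.
Proof.
elim/poly_ind: P => [|P c [M M0 PM]].
  by exists 1 => // t; rewrite horner0 nc0.
exists (M + nc c + 1) => [|t].
  by have := nc_ge0 c; lra.
rewrite hornerD hornerMX hornerC (le_trans (ncD _ _))//.
by rewrite ncM nc_expi mulr1; have := PM t; lra.
Qed.

Lemma polylim_bounded U : polylim U -> exists2 M : R, 0 < M & forall t, nc (U t) <= M.
Proof.
move=> /(_ 1 ltr01)[P UP]; have [M M0 PM] := poly_circle_bounded P.
exists (M + 1) => [|t]; first by lra.
have := ncD (U t - P.[expi t]) P.[expi t]; rewrite subrK.
by have := UP t; have := PM t; lra.
Qed.

Lemma polylim_poly P : polylim (fun t => P.[expi t]).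
Proof. by move=> e e0; exists P => t; rewrite subrr nc0 ltW. Qed.

Lemma polylimM U V : polylim U -> polylim V -> polylim (fun t => U t * V t).
Proof.
move=> aU aV; have [M M0 UM] := polylim_bounded aU.
have [M' M'0 VM] := polylim_bounded aV.
move=> e e0; pose d := Num.min 1 (e / (M + M' + 1)).
have d0 : 0 < d by rewrite lt_min ltr01 divr_gt0//; lra.
have d1 : d <= 1 by rewrite ge_min lexx.
have dM : d * (M + M' + 1) <= e.
  by rewrite -ler_pdivlMr ?ge_min ?lexx ?orbT//; lra.
have [P UP] := aU _ d0; have [Q VQ] := aV _ d0.
exists (P * Q) => t; rewrite hornerM.
have -> : U t * V t - P.[expi t] * Q.[expi t] =
  (U t - P.[expi t]) * V t + U t * (V t - Q.[expi t])
  - (U t - P.[expi t]) * (V t - Q.[expi t]) by ring.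
rewrite (le_trans (ncB _ _))// (le_trans (lerD (ncD _ _) (lexx _)))//.
rewrite !ncM.
have := UP t; have := VQ t; have := UM t; have := VM t.
have := nc_ge0 (U t); have := nc_ge0 (V t).
have := nc_ge0 (U t - P.[expi t]); have := nc_ge0 (V t - Q.[expi t]).
move: (nc (U t)) (nc (V t)) (nc (U t - _)) (nc (V t - _)) => a b x y x0 y0 a0 b0 bM aM yd xd.
have h1 : x * b <= d * M' by apply: ler_pM.
have h2 : a * y <= M * d by apply: ler_pM.
have h3 : x * y <= d * 1 by apply: ler_pM => //; lra.
rewrite (le_trans _ dM)//; lra.
Qed.

(** The Neumann series [sum (1 - P)^k], for [P] a polynomial close to [U], approximates
    the inverse. *)
Lemma polylimV_near1 U r : r < 1 -> (forall t, nc (1 - U t) <= r) ->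
  polylim U -> polylim (fun t => (U t)^-1).
Proof.
move=> r1 Ur aU e e0.
have r0 : 0 <= r by apply: le_trans (Ur 0); exact: nc_ge0.
pose s := (1 + r) / 2.
have s1 : s < 1 by rewrite /s; lra.
have s0 : 0 <= s by rewrite /s; lra.
pose d := Num.min ((1 - r) / 2) (e * (1 - r) * (1 - s) / 2).
have d0 : 0 < d.
  rewrite lt_min; apply/andP; split; first by lra.
  by rewrite divr_gt0// !mulr_gt0//; lra.
have [P UP] := aU _ d0.
have Ps t : nc (1 - P.[expi t]) <= s.
  have -> : 1 - P.[expi t] = (1 - U t) + (U t - P.[expi t]) by ring.
  rewrite (le_trans (ncD _ _))//; have := Ur t; have := UP t.
  have : d <= (1 - r) / 2 by rewrite ge_min lexx.
  rewrite /s; lra.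
have [K sK] : exists K, s ^+ K <= e * (1 - r) / 2.
  by apply: exists_expr_le => //; rewrite divr_gt0// mulr_gt0//; lra.
pose Q := \sum_(k < K) (1 - P) ^+ k.
have PQ : P * Q = 1 - (1 - P) ^+ K.
  have := subrX1 (1 - P) K; rewrite addrAC subrr add0r mulNr => h.
  by rewrite -[LHS]opprK -h opprB.
have QM t : nc Q.[expi t] <= (1 - s)^-1.
  rewrite horner_sum (le_trans (nc_sum _ _ _))//.
  apply: (@le_trans _ _ (\sum_(k < K) s ^+ k)).
    apply: ler_sum => k _; rewrite horner_exp ncX lerXn2r ?nnegrE ?nc_ge0//.
    by rewrite !hornerE.
  rewrite -[leRHS]mul1r ler_pdivlMr; last by lra.
  have := subrX1 s K; rewrite mulrC => h.
  have -> : (\sum_(k < K) s ^+ k) * (1 - s) = 1 - s ^+ K by rewrite -opprB mulrN -h opprB.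
  by rewrite gerBl exprn_ge0.
exists Q => t.
have U0 : 1 - r <= nc (U t).
  by have := ncD (1 - U t) (U t); rewrite subrK nc1; have := Ur t; lra.
have Un0 : U t != 0 by rewrite -nc_gt0; lra.
have -> : (U t)^-1 - Q.[expi t] = (U t)^-1 * ((1 - P.[expi t]) ^+ K - (U t - P.[expi t]) * Q.[expi t]).
  apply: (mulfI Un0); rewrite mulrA mulfV// mul1r mulrBr mulfV//.
  have : (P * Q).[expi t] = (1 - (1 - P) ^+ K).[expi t] by rewrite PQ.
  rewrite hornerM !(hornerD, hornerN, horner_exp, hornerC) => h.
  have -> : (1 - P.[expi t]) ^+ K = 1 - P.[expi t] * Q.[expi t] by rewrite h; ring.
  ring.
rewrite ncM ncV mulrC ler_pdivrMr; last by lra.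
rewrite (le_trans (ncB _ _))// ncX ncM.
have h1 : nc (1 - P.[expi t]) ^+ K <= e * (1 - r) / 2.
  by apply: le_trans sK; rewrite lerXn2r ?nnegrE ?nc_ge0.
have h2 : nc (U t - P.[expi t]) * nc Q.[expi t] <= e * (1 - r) / 2.
  apply: (@le_trans _ _ (d * (1 - s)^-1)).
    by apply: ler_pM; rewrite ?nc_ge0 ?UP ?QM.
  rewrite ler_pdivrMr; last by lra.
  have : d <= e * (1 - r) * (1 - s) / 2 by rewrite ge_min lexx orbT.
  lra.
have : e * (1 - r) <= e * nc (U t) by rewrite ler_wpM2l// ltW.
lra.
Qed.

(** A function with range in a compact part of the right half-plane is moved by a small
    positive factor into a disc around 1 of radius less than 1. *)
Lemma polylimV_re U (a : R) : 0 < a -> (forall t, a <= re (U t)) ->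
  polylim U -> polylim (fun t => (U t)^-1).
Proof.
move=> a0 Ua aU; have [M M0 UM] := polylim_bounded aU.
pose s : R := a / M ^+ 2.
have M20 : 0 < M ^+ 2 by rewrite exprn_gt0.
have s0 : 0 < s by rewrite divr_gt0.
have sM : s * M ^+ 2 = a by rewrite /s divfK// gt_eqF.
have a1 : polylim (fun t => s%:C * U t).
  have := polylimM (polylim_poly (s%:C)%:P) aU.
  by under [X in polylim X]eq_fun do rewrite hornerC.
pose r := 1 - s * a / 2.
have h t : nc (1 - s%:C * U t) <= r.
  have aM : a <= M.
    by apply: le_trans (Ua t) _; apply: le_trans (re_le _) (UM t).
  have sa1 : s * a <= 1.
    rewrite /s mulrAC ler_pdivrMr// mul1r expr2.
    by apply: ler_pM => //; apply: ltW.
  have r0 : 0 <= r by rewrite /r; lra.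
  rewrite -(ler_pXn2r (ltn0Sn 1)) ?nnegrE ?nc_ge0// sqr_nc.
  rewrite !(reB, imB, reMr, imMr) /= sub0r.
  have : nc (U t) ^+ 2 <= M ^+ 2 by rewrite lerXn2r ?nnegrE ?nc_ge0 ?(ltW M0).
  rewrite sqr_nc; have := Ua t.
  move: (re (U t)) (im (U t)) => x y ax xyM.
  have h1 : s * (s * (x ^+ 2 + y ^+ 2)) <= s * a.
    by rewrite ler_wpM2l ?(ltW s0)// -sM ler_wpM2l ?(ltW s0).
  have h2 : s * a <= s * x by rewrite ler_wpM2l ?(ltW s0).
  have h3 : 0 <= (s * a) ^+ 2 by rewrite sqr_ge0.
  rewrite /r; nra.
have r1 : r < 1 by rewrite /r; have := mulr_gt0 s0 a0; lra.
have := polylimM (polylim_poly (s%:C)%:P) (polylimV_near1 r1 h a1).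
under [X in polylim X]eq_fun do rewrite hornerC.
congr polylim; apply/funext => t.
rewrite invfM mulrA mulfV ?mul1r// -nc_eq0 ncr gt_eqF// ger0_norm//; exact: ltW.
Qed.

(** The mean value property at the origin, in the form needed here. *)
Lemma cint_polylim_eq0 U k : polylim U -> ccont U -> (0 < k)%N ->
  cint (fun t => expi t ^+ k * U t) = 0.
Proof.
move=> aU cU k0; apply/eqP; rewrite -nc_eq0 eq_le nc_ge0 andbT.
have hP P : cint (fun t => expi t ^+ k * P.[expi t]) = 0.
  elim/poly_ind: P k k0 => [|P c IH] k k0.
    under [X in cint X]eq_fun do rewrite horner0 mulr0.
    by apply: complex_eq => /=; rewrite rint_cst mul0r.
  have -> : (fun t => expi t ^+ k * (P * 'X + c%:P).[expi t]) =
      (fun t => expi t ^+ k.+1 * P.[expi t] + c * expi t ^+ k).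
    by apply/funext => t; rewrite hornerD hornerMX hornerC exprS; ring.
  have cX n : ccont (fun t : R => expi t ^+ n) by apply: ccontX; exact: ccont_expi.
  rewrite cintD; first by rewrite IH// cintZ// cint_expiX// mulr0 addr0.
  - by apply: ccontM => //; exact: ccont_horner.
  - by apply: ccontM => //; exact: ccont_cst.
have cX : ccont (fun t : R => expi t ^+ k) by apply: ccontX; exact: ccont_expi.
apply/ler_addgt0Pr => e e0; rewrite add0r.
have p0 := @pi_gt0 R.
have [|P UP] := aU (e / (4 * pi)); first by rewrite divr_gt0//; lra.
have -> : cint (fun t => expi t ^+ k * U t) =
    cint (fun t => expi t ^+ k * (U t - P.[expi t])).
  rewrite -[RHS]addr0 -(hP P) -cintD.
  - by congr cint; apply/funext => t; ring.
  - by apply: ccontM => //; apply: ccontB => //; exact: ccont_horner.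
  - by apply: ccontM => //; exact: ccont_horner.
rewrite (le_trans (@nc_cint_le _ _ (e / (4 * pi)) _ _))//.
- by apply: ccontM => //; apply: ccontB => //; exact: ccont_horner.
- by move=> t; rewrite ncM ncX nc_expi expr1n mul1r.
- by rewrite mulrC divfK// gt_eqF//; lra.
Qed.

(** Only the constant term of [Q] survives, the product of the rest with [U] being a
    limit of polynomials without constant term. *)
Lemma cint_poly_polylim U Q : polylim U -> ccont U ->
  cint (fun t => Q.[expi t] * U t) = Q.[0] * cint U.
Proof.
move=> aU cU; elim/poly_ind: Q => [|Q c IH].
  under [X in cint X]eq_fun do rewrite horner0 mul0r.
  by rewrite horner0 mul0r; apply: complex_eq => /=; rewrite rint_cst mul0r.
have -> : (fun t => (Q * 'X + c%:P).[expi t] * U t) =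
    (fun t => expi t ^+ 1 * (Q.[expi t] * U t) + c * U t).
  by apply/funext => t; rewrite hornerD hornerMX hornerC expr1; ring.
have cQ := ccont_horner Q.
have cX : ccont (fun t : R => expi t ^+ 1) by apply: ccontX; exact: ccont_expi.
rewrite cintD; last 2 first.
- by apply: ccontM => //; apply: ccontM => //.
- by apply: ccontM => //; exact: ccont_cst.
rewrite cintZ// cint_polylim_eq0//; last 2 first.
- by apply: polylimM => //; exact: polylim_poly.
- exact: ccontM.
by rewrite hornerD hornerMX hornerC mulr0 !add0r.
Qed.

End Approximation.

(** * Weights with an explicit orthogonal polynomial *)

Section ExplicitWeight.
Context {R : realType}.
Implicit Types (f g p q : {poly R[i]}) (N : nat).

(** The polynomial equal to [z ^+ N * conj p] on the circle. *)
Definition recip N p : {poly R[i]} := \poly_(i < N.+1) (p`_(N - i))^*.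

Lemma horner_recip N p z : (size p <= N.+1)%N -> nc z = 1 ->
  (recip N p).[z] = z ^+ N * (p.[z])^*.
Proof.
move=> sp z1; rewrite horner_poly (horner_coef_wide _ sp) rmorph_sum mulr_sumr.
rewrite (reindex_inj rev_ord_inj) /=; apply: eq_bigr => i _.
have iN : (i <= N)%N by rewrite -ltnS.
rewrite !subSS subKn// rmorphM rmorphXn/= mulrCA; congr (_ * _).
have -> : z ^+ N = z ^+ (N - i) * z ^+ i by rewrite -exprD subnK.
by rewrite -mulrA -exprMn circle_mulJ// expr1n mulr1.
Qed.

Lemma coef_recip N p i : (i <= N)%N -> (recip N p)`_i = (p`_(N - i))^*.
Proof. by move=> iN; rewrite coef_poly ltnS iN. Qed.

Lemma cint1 : cint (fun _ : R => 1) = (2 * pi)%:C.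
Proof. by rewrite -[RHS]mul1r; apply: complex_eq => /=; rewrite rint_cst; ring. Qed.

Variables (N : nat) (f g : {poly R[i]}) (f0 e : R).
Hypotheses (sg : (size g <= N)%N) (sfg : (size (f * g)%R <= N)%N).
Hypotheses (e_gt0 : 0 < e) (f_re : forall t, e <= re f.[expi t]).
Hypotheses (f0_gt0 : 0 < f0) (f00 : f.[0] = f0%:C).
Hypotheses (g_neq0 : forall t, g.[expi t] != 0).
Hypothesis (gV : polylim (fun t => (g.[expi t])^-1)).

Let F t := f.[expi t].
Let G t := g.[expi t].

(** [denom], [weight] and [opoly] are the [S], [w] and [p] of the introduction. *)
Definition denom : {poly R[i]} :=
  2%:P * f * g + f * recip N g - recip N (f * g).

Definition weight (t : R) : R := re f.[expi t] / nc denom.[expi t] ^+ 2.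

Definition opoly : {poly R[i]} :=
  recip N (g + f0^-1%:C *: (f * g)) + (g - f0^-1%:C *: (f * g)).

Lemma denomE t : denom.[expi t] =
  2 * F t * G t + expi t ^+ N * (G t)^* * (F t - (F t)^*).
Proof.
rewrite /denom !(hornerD, hornerN, hornerM, hornerC) !horner_recip ?nc_expi//.
- rewrite hornerM conjcM /F /G; ring.
- exact: leqW.
- exact: leqW.
Qed.

Lemma nc_FBJ t : nc (F t - (F t)^*) = 2 * `|im (F t)|.
Proof.
have -> : F t - (F t)^* = Complex 0 (2 * im (F t)).
  by apply: complex_eq; rewrite ?(reB, imB, reJ, imJ) /=; ring.
by rewrite ncE /= expr0n add0r sqrtr_sqr normrM ger0_norm.
Qed.

Lemma denom_le t : nc denom.[expi t] <= 2 * nc (G t) * (nc (F t) + `|im (F t)|).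
Proof.
rewrite denomE (le_trans (ncD _ _))// !ncM ncX nc_expi expr1n ncJ nc_FBJ.
have -> : nc (2 : R[i]) = 2 by exact: (nc_natr 2).
lra.
Qed.

Lemma denom_ge t : 2 * nc (G t) * (nc (F t) - `|im (F t)|) <= nc denom.[expi t].
Proof.
rewrite denomE (le_trans _ (ncDl _ _))// !ncM ncX nc_expi expr1n ncJ nc_FBJ.
have -> : nc (2 : R[i]) = 2 by exact: (nc_natr 2).
lra.
Qed.

Lemma im_lt_nc t : `|im (F t)| < nc (F t).
Proof.
have F0 : 0 < re (F t) by apply: lt_le_trans (f_re t).
rewrite -(@ltr_pXn2r _ 2)// ?nnegrE ?nc_ge0// sqr_nc real_normK ?num_real//.
by rewrite ltrDr exprn_gt0.
Qed.

Lemma denom_neq0 t : denom.[expi t] != 0.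
Proof.
rewrite -nc_gt0 (lt_le_trans _ (denom_ge t))// !mulr_gt0// ?nc_gt0 ?g_neq0//.
by rewrite subr_gt0 im_lt_nc.
Qed.

Lemma weight_gt0 t : 0 < weight t.
Proof.
rewrite divr_gt0//; first exact: lt_le_trans (f_re t).
by rewrite exprn_gt0// nc_gt0 denom_neq0.
Qed.

Lemma continuous_weight : continuous weight.
Proof.
apply: continuousMr; first by have [] := ccont_horner f.
apply: continuousVr; first exact: continuous_nc2 (ccont_horner _).
by move=> t; rewrite expf_neq0// nc_eq0 denom_neq0.
Qed.

(** Both factors of [denom = 2 f g (1 + E)] are inverted by a Neumann series:
    [f] since [re f > 0], and [1 + E] since [|E| = |im f| / |f| < 1] on the circle. *)
Lemma polylim_denomV : polylim (fun t => (denom.[expi t])^-1).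
Proof.
have fV : polylim (fun t => (F t)^-1).
  exact: (polylimV_re e_gt0 f_re (polylim_poly f)).
have fgV := polylimM fV gV.
have F0 t : F t != 0.
  by rewrite -nc_gt0 (lt_le_trans e_gt0)// (le_trans (f_re t))// re_le.
have two0 : (2 : R[i]) != 0 by rewrite pnatr_eq0.
pose E t := (2^-1%:P * (f * recip N g - recip N (f * g))).[expi t] * ((F t)^-1 * (G t)^-1).
have EE t : E t = expi t ^+ N * (G t)^* * (F t - (F t)^*) * (2^-1 * ((F t)^-1 * (G t)^-1)).
  rewrite /E !(hornerD, hornerN, hornerM, hornerC) !horner_recip ?nc_expi//.
  - by rewrite hornerM conjcM -/(F t) -/(G t); ring.
  - exact: leqW.
  - exact: leqW.
have [M M0 FM] := poly_circle_bounded f.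
pose r : R := 1 - e ^+ 2 / (2 * M ^+ 2).
have M2 : 0 < 2 * M ^+ 2 by rewrite mulr_gt0// exprn_gt0.
have r1 : r < 1 by rewrite /r ltrBlDr ltrDl divr_gt0// exprn_gt0.
have aE : polylim E by apply: polylimM => //; exact: polylim_poly.
have hE t : nc (1 - (1 + E t)) <= r.
  have -> : 1 - (1 + E t) = - E t by ring.
  rewrite ncN EE !ncM !ncV ncX nc_expi expr1n ncJ nc_FBJ.
  have -> : nc (2 : R[i]) = 2 by exact: (nc_natr 2).
  have Gt : nc (G t) != 0 by rewrite nc_eq0 g_neq0.
  have Ft : nc (F t) != 0 by rewrite nc_eq0 F0.
  have Fp : 0 < nc (F t) by rewrite nc_gt0 F0.
  have -> : 1 * nc (G t) * (2 * `|im (F t)|) * (2^-1 * ((nc (F t))^-1 * (nc (G t))^-1))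
     = `|im (F t)| / nc (F t) by field; rewrite Gt Ft.
  rewrite ler_pdivrMr//.
  have h1 : e ^+ 2 <= re (F t) ^+ 2.
    have := f_re t; rewrite -/(F t) => h.
    have h' : 0 <= re (F t) by exact: le_trans (ltW e_gt0) (f_re t).
    by rewrite lerXn2r ?nnegrE ?(ltW e_gt0).
  have h2 := sqr_nc (F t).
  have h3 : nc (F t) ^+ 2 <= M ^+ 2 by rewrite lerXn2r ?nnegrE ?nc_ge0 ?(ltW M0)//; exact: FM.
  have h4 : `|im (F t)| ^+ 2 = im (F t) ^+ 2 by rewrite real_normK ?num_real.
  have h5 := norm_im_le (F t).
  have h6 : 0 <= `|im (F t)| by [].
  rewrite /r mulrBl mul1r lerBrDr -lerBrDl.
  rewrite mulrAC ler_pdivrMr//.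
  move: h1 h2 h3 h4 h5 h6 Fp; rewrite -/(F t).
  move: (nc (F t)) (re (F t)) (`|im (F t)|) => n x y h1 h2 h3 h4 h5 h6 n0.
  have h7 : e ^+ 2 <= (n - y) * (2 * n).
    have : (n - y) * (n + y) <= (n - y) * (2 * n) by rewrite ler_wpM2l ?subr_ge0//; lra.
    have -> : (n - y) * (n + y) = n ^+ 2 - y ^+ 2 by ring.
    rewrite h2 -h4; lra.
  have : (n - y) * (2 * n) * n <= (n - y) * (2 * M ^+ 2).
    rewrite -mulrA ler_wpM2l ?subr_ge0// -mulrA ler_wpM2l// -expr2; exact: h3.
  have : e ^+ 2 * n <= (n - y) * (2 * n) * n by rewrite ler_wpM2r// ltW.
  lra.
have aV := polylimV_near1 r1 hE.
have a1E : polylim (fun t => 1 + E t).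
  move=> d d0; have [P EP] := aE _ d0; exists (1 + P) => t.
  by rewrite hornerD hornerC opprD addrACA subrr add0r.
have := polylimM (polylim_poly 2^-1%:P) (polylimM fgV (aV a1E)).
congr polylim; apply/funext => t.
have E0 : 1 + E t != 0.
  apply/eqP => h; have := hE t; rewrite h subr0 nc1; lra.
rewrite hornerC -!invfM; congr (_^-1); rewrite mulrDr mulr1 EE denomE.
have Gt := g_neq0 t; rewrite -/(G t) in Gt.
have Ft := F0 t.
by rewrite -/(G t); field; rewrite ?Ft ?Gt ?two0.
Qed.

Lemma opolyE t : opoly.[expi t] =
  expi t ^+ N * (G t * (1 + f0^-1%:C * F t))^* + G t * (1 - f0^-1%:C * F t).
Proof.
rewrite /opoly hornerD horner_recip ?nc_expi//; last first.
  rewrite (leq_trans (size_polyD _ _))// geq_max leqW//=.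
  by rewrite (leq_trans (size_scale_leq _ _))// leqW.
rewrite !(hornerD, hornerN, hornerZ, hornerM) -/(F t) -/(G t).
by congr (_ * _^* + _); ring.
Qed.

Let S t := denom.[expi t].
Let c : R[i] := f0^-1%:C.

(** With [A = g + g#] and [B = f g - conj f g#] one has [S = f A + B],
    [S + z^N conj S = 2 A re f] and [conj f S - f z^N conj S = 2 B re f]; the polynomial
    is [p = z^N conj (A + c B)]. *)
Lemma opoly_weight t : opoly.[expi t] * (weight t)%:C =
  2^-1 * (expi t ^+ N * (1 + c * F t) / S t + (1 - c * (F t)^*) / (S t)^*).
Proof.
have two0 : (2 : R[i]) != 0 by rewrite pnatr_eq0.
have S0 : S t != 0 by exact: denom_neq0.
have SJ0 : (S t)^* != 0 by rewrite conjc_eq0.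
have -> : (weight t)%:C = 2^-1 * (F t + (F t)^*) / (S t * (S t)^*).
  rewrite /weight rmorphM fmorphV/= mulcJ; congr (_ / _).
  by rewrite addcJ -/(F t) mulKf.
rewrite opolyE.
have zz : expi t ^+ N * (expi t ^+ N)^* = 1.
  by rewrite conjcX -exprMn circle_mulJ ?nc_expi ?expr1n.
have SE : S t = 2 * F t * G t + expi t ^+ N * (G t)^* * (F t - (F t)^*).
  exact: denomE.
have SJE : (S t)^* = 2 * (F t)^* * (G t)^* + (expi t ^+ N)^* * G t * ((F t)^* - F t).
  have cc2 : (2 : R[i])^* = 2 by rewrite -[2]/(2%:R) conjc_nat.
  by rewrite SE conjcD !conjcM conjcB !conjcK cc2.
have -> : (G t * (1 + f0^-1%:C * F t))^* = (G t)^* * (1 + c * (F t)^*).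
  by rewrite conjcM conjcD conjcM conjc1 conjc_real.
rewrite -/c.
apply: (mulIf (mulf_neq0 S0 SJ0)).
rewrite [X in X * _ = _]mulrA divfK ?mulf_neq0//.
have alg (x y s sJ : R[i]) : s != 0 -> sJ != 0 ->
    2^-1 * (x / s + y / sJ) * (s * sJ) = 2^-1 * (x * sJ + y * s).
  by move=> s0 sJ0; field; rewrite s0 sJ0.
rewrite alg// mulrCA; congr (_ * _).
rewrite SJE SE.
move: zz; move: (expi t ^+ N) ((expi t ^+ N)^*) (F t) ((F t)^*) (G t) ((G t)^*) => z zJ a aJ b bJ zz.
have -> : z * (1 + c * a) * (2 * aJ * bJ + zJ * b * (aJ - a)) =
   z * (1 + c * a) * 2 * aJ * bJ + (z * zJ) * (1 + c * a) * b * (aJ - a) by ring.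
by rewrite zz; ring.
Qed.

Lemma ccont_denomV : ccont (fun t => (S t)^-1).
Proof. by apply: ccontV; [exact: ccont_horner|exact: denom_neq0]. Qed.

(** The integral of [1 / S] is [2 pi / S(0)], and [S(0) = 2 f(0) g(0)] because the
    reversed polynomials vanish at 0, [g] and [f g] having degree less than [N]. *)
Lemma cint_denomV : cint (fun t => (S t)^-1) = (pi / f0)%:C / g.[0].
Proof.
have h := cint_poly_polylim denom polylim_denomV ccont_denomV.
have two0 : (2 : R[i]) != 0 by rewrite pnatr_eq0.
have d0 : denom.[0] = 2 * f0%:C * g.[0].
  rewrite /denom !(hornerD, hornerN, hornerM, hornerC) f00.
  rewrite !horner_coef0 !coef_recip// !subn0.
  rewrite [g`_N]nth_default// [(f * g)`_N]nth_default//.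
  by rewrite conjc0 mulr0 subr0 addr0.
have h1 : cint (fun t => denom.[expi t] * (S t)^-1) = (2 * pi)%:C.
  under [X in cint X]eq_fun do rewrite mulfV ?denom_neq0//.
  exact: cint1.
rewrite h1 in h.
have g0 : g.[0] != 0.
  apply/eqP => g0; move/eqP: h; rewrite d0 g0 mulr0 mul0r; apply/negP.
  by rewrite -nc_eq0 ncr normr_eq0 gt_eqF// mulr_gt0 ?pi_gt0.
have f0n : f0%:C != 0 :> R[i] by rewrite -nc_eq0 ncr normr_eq0 gt_eqF.
have -> : (pi / f0)%:C / g.[0] = (2 * pi)%:C / denom.[0].
  rewrite d0 !rmorphM/= fmorphV/=.
  have -> : 2%:C = 2 :> R[i] by rewrite -[2 in LHS]/(2%:R) rmorph_nat.
  by move: (f0%:C) (pi%:C) (g.[0]) f0n g0 => x y z x0 z0; field; rewrite x0 z0.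
by rewrite h d0 mulrC mulKf// !mulf_neq0.
Qed.

Lemma g0_neq0 : g.[0] != 0.
Proof.
apply/eqP => g0; have := cint_poly_polylim denom polylim_denomV ccont_denomV.
have -> : denom.[0] = 0.
  rewrite /denom !(hornerD, hornerN, hornerM, hornerC) g0.
  rewrite !horner_coef0 !coef_recip// !subn0.
  rewrite [g`_N]nth_default// [(f * g)`_N]nth_default//.
  by rewrite conjc0 !mulr0 subr0 addr0.
under [X in cint X]eq_fun do rewrite mulfV ?denom_neq0//.
move/eqP; rewrite mul0r cint1; apply/negP.
by rewrite -nc_eq0 ncr normr_eq0 gt_eqF// mulr_gt0 ?pi_gt0.
Qed.

(** For [k < N] both terms of the identity integrate to [0] against [z^k]; for [k = N]
    only the constant term of [(1 + c f) / S] survives. *)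
Lemma opoly_moment k : (k <= N)%N ->
  cint (fun t => opoly.[expi t] * (expi t ^+ k)^* * (weight t)%:C) =
  (k == N)%:R * ((pi / f0)%:C / g.[0]).
Proof.
move=> kN; have two0 : (2 : R[i]) != 0 by rewrite pnatr_eq0.
have f0n : f0%:C != 0 :> R[i] by rewrite -nc_eq0 ncr normr_eq0 gt_eqF.
have SV := polylim_denomV; have cS := ccont_denomV.
have a1 : polylim (fun t => (1 + c *: f).[expi t] * (S t)^-1).
  by apply: polylimM => //; exact: polylim_poly.
have c1 : ccont (fun t => (1 + c *: f).[expi t] * (S t)^-1).
  by apply: ccontM => //; exact: ccont_horner.
have c2 : ccont (fun t => (1 - c *: f).[expi t] * (S t)^-1).
  by apply: ccontM => //; exact: ccont_horner.
have a2 : polylim (fun t => (1 - c *: f).[expi t] * (S t)^-1).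
  by apply: polylimM => //; exact: polylim_poly.
have cX n : ccont (fun t : R => expi t ^+ n) by apply: ccontX; exact: ccont_expi.
have -> : (fun t => opoly.[expi t] * (expi t ^+ k)^* * (weight t)%:C) =
  (fun t => 2^-1 * (expi t ^+ (N - k) * ((1 + c *: f).[expi t] * (S t)^-1)
     + (expi t ^+ k * ((1 - c *: f).[expi t] * (S t)^-1))^*)).
  apply/funext => t; rewrite mulrAC opoly_weight -!mulrA; congr (_ * _).
  have zz : expi t ^+ k * (expi t ^+ k)^* = 1.
    by rewrite conjcX -exprMn circle_mulJ ?nc_expi ?expr1n.
  rewrite mulrDl; congr (_ + _).
    have <- : expi t ^+ N * (expi t ^+ k)^* = expi t ^+ (N - k).
      by rewrite -{1}(subnK kN) exprD -mulrA zz mulr1.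
    rewrite !(hornerD, hornerZ, hornerC) -/(F t) -!mulrA; congr (_ * _).
    by rewrite [RHS]mulrC -!mulrA.
  rewrite !conjcM conjc_inv !(hornerD, hornerN, hornerZ, hornerC) -/(F t).
  by rewrite conjcB conjcM conjc1 conjc_real mulrC.
rewrite cintZ; last first.
  by apply: ccontD; [exact: ccontM|apply: ccontJ; exact: ccontM].
rewrite cintD; last 2 first.
- exact: ccontM.
- by apply: ccontJ; exact: ccontM.
rewrite cintJ; last exact: ccontM.
have -> : cint (fun t => expi t ^+ k * ((1 - c *: f).[expi t] * (S t)^-1)) = 0.
  have [->|k0] := posnP k; last by rewrite cint_polylim_eq0.
  under [X in cint X]eq_fun do rewrite expr0 mul1r.
  rewrite cint_poly_polylim// !(hornerD, hornerN, hornerZ, hornerC) f00.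
  by rewrite /c -rmorphM mulVf ?gt_eqF// subrr mul0r.
rewrite conjc0 addr0; have [->|kn] := eqVneq k N.
  under [X in cint X]eq_fun do rewrite subnn expr0 mul1r.
  rewrite cint_poly_polylim// !(hornerD, hornerZ, hornerC) f00 cint_denomV.
  by rewrite /c -rmorphM mulVf ?gt_eqF// mul1r -[1 + 1]/2 mulKf.
by rewrite cint_polylim_eq0 ?mulr0 ?mul0r// subn_gt0 ltn_neqAle kn.
Qed.

Lemma coef_opolyN : opoly`_N = (2 * g.[0])^*.
Proof.
rewrite /opoly !(coefD, coefN, coefZ) coef_recip// subnn !(coefD, coefZ).
rewrite [g`_N]nth_default// [(f * g)`_N]nth_default// mulr0 subr0 addr0.
rewrite -!horner_coef0 hornerM f00 mulrA -rmorphM mulVf ?gt_eqF// mul1r.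
by congr (_^*); ring.
Qed.

(** The leading coefficient is [2 conj g(0)], which is nonzero by [g0_neq0]. *)
Lemma size_opoly : size opoly = N.+1.
Proof.
apply/eqP; rewrite eqn_leq; apply/andP; split.
  rewrite (leq_trans (size_polyD _ _))// geq_max size_poly/=.
  rewrite (leq_trans (size_polyD _ _))// geq_max leqW//= size_polyN.
  by rewrite (leq_trans (size_scale_leq _ _))// leqW.
rewrite ltnNge; apply/negP => /leq_sizeP/(_ N (leqnn _)) /eqP.
by rewrite coef_opolyN conjc_eq0 mulf_eq0 pnatr_eq0/=; apply/negP; exact: g0_neq0.
Qed.

Lemma cint_opoly_weight q : (size q <= N.+1)%N ->
  cint (fun t => opoly.[expi t] * (q.[expi t])^* * (weight t)%:C) =
  (q`_N)^* * ((pi / f0)%:C / g.[0]).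
Proof.
move=> sq.
have cX n : ccont (fun t : R => expi t ^+ n) by apply: ccontX; exact: ccont_expi.
have cw : ccont (fun t => (weight t)%:C) by apply: ccont_r; exact: continuous_weight.
have -> : (fun t => opoly.[expi t] * (q.[expi t])^* * (weight t)%:C) =
  (fun t => \sum_(k < N.+1) (q`_k)^* *
     (opoly.[expi t] * (expi t ^+ k)^* * (weight t)%:C)).
  apply/funext => t; rewrite (horner_coef_wide _ sq) rmorph_sum mulr_sumr mulr_suml.
  by apply: eq_bigr => k _; rewrite rmorphM/=; ring.
have cc k : ccont (fun t => opoly.[expi t] * (expi t ^+ k)^* * (weight t)%:C).
  by apply: ccontM => //; apply: ccontM; [exact: ccont_horner|exact: ccontJ].
rewrite cint_sum; last by move=> k; apply: ccontM; [exact: ccont_cst|exact: cc].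
rewrite big_ord_recr /= big1 ?add0r => [|k _].
  by rewrite cintZ// opoly_moment// eqxx mul1r.
by rewrite cintZ// opoly_moment ?(ltnW (ltn_ord k))// ltn_eqF ?mul0r ?mulr0.
Qed.

(** By orthogonality only the leading coefficient of the second factor matters. *)
Lemma rint_opoly2 : rint (fun t => nc opoly.[expi t] ^+ 2 * weight t) = 2 * pi / f0.
Proof.
have := @cint_opoly_weight opoly; rewrite size_opoly leqnn coef_opolyN conjcK => /(_ isT) h.
have two0 : (2 : R[i]) != 0 by rewrite pnatr_eq0.
apply: (@complexI R); rewrite -cint_r.
under [X in cint X]eq_fun do rewrite rmorphM/= -mulcJ.
have -> : (2 * pi / f0)%:C = 2 * (pi / f0)%:C.
  by apply: complex_eq; rewrite ?(reM, imM) /=; ring.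
rewrite h.
move: g0_neq0 ((pi / f0)%:C); move: (g.[0]) => x x0 y; rewrite -mulrA; congr (_ * _).
by rewrite mulrC divfK.
Qed.

End ExplicitWeight.

(** * Fejer kernels *)

Section Fejer.
Context {R : realType}.
Implicit Types (z : R[i]) (m n i j k : nat).

Definition dirichlet n : {poly R[i]} := \sum_(j < n) 'X^j.

(** The analytic half of the Fejer kernel, normalized to take the value 1 at 1: the
    coefficient of [z^j] is [2 (m - j) / (m (m + 1))]. *)
Definition fejer m : {poly R[i]} :=
  (2 / (m%:R * m.+1%:R))%:C *: \sum_(i < m) dirichlet i.+1.

Lemma horner_dirichlet n z : (dirichlet n).[z] = \sum_(j < n) z ^+ j.
Proof. by rewrite horner_sum; apply: eq_bigr => i _; rewrite hornerXn. Qed.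

Lemma dirichletS n z : (dirichlet n.+1).[z] = (dirichlet n).[z] + z ^+ n.
Proof. by rewrite !horner_dirichlet big_ord_recr. Qed.

Lemma dirichlet_geo n z : (1 - z) * (dirichlet n).[z] = 1 - z ^+ n.
Proof.
elim: n => [|n IH]; first by rewrite horner_dirichlet big_ord0 expr0 mulr0 subrr.
by rewrite dirichletS mulrDr IH exprS; ring.
Qed.

Lemma nc_1subX z n : nc z = 1 -> nc (1 - z ^+ n) <= n%:R * nc (1 - z).
Proof.
move=> z1; rewrite -dirichlet_geo ncM mulrC ler_wpM2r ?nc_ge0//.
rewrite horner_dirichlet (le_trans (nc_sum _ _ _))//.
under eq_bigr do rewrite ncX z1 expr1n.
by rewrite sumr_const card_ord.
Qed.

Lemma dirichlet_near z n m : nc z = 1 -> (n <= m)%N ->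
  nc (n%:R - (dirichlet n).[z]) <= n%:R * (m%:R * nc (1 - z)).
Proof.
move=> z1 nm; rewrite horner_dirichlet.
have -> : n%:R - \sum_(j < n) z ^+ j = \sum_(j < n) (1 - z ^+ j).
  by rewrite sumrB sumr_const card_ord.
rewrite (le_trans (nc_sum _ _ _))//.
apply: (@le_trans _ _ (\sum_(j < n) m%:R * nc (1 - z))); last first.
  by rewrite sumr_const card_ord [leRHS]mulr_natl.
apply: ler_sum => j _; rewrite (le_trans (nc_1subX _ z1))//.
by rewrite ler_wpM2r ?nc_ge0// ler_nat (leq_trans (ltnW (ltn_ord j))).
Qed.

(** Near 1 all the terms of the Dirichlet kernel point in almost the same direction. *)
Lemma dirichlet_half z n : nc z = 1 -> n%:R * nc (1 - z) <= 2^-1 ->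
  n%:R / 2 <= nc (dirichlet n).[z].
Proof.
move=> z1 nz; have h := dirichlet_near z1 (leqnn n).
have := ncD (n%:R - (dirichlet n).[z]) (dirichlet n).[z].
rewrite subrK nc_natr.
have : n%:R * (n%:R * nc (1 - z)) <= n%:R * 2^-1 by rewrite ler_wpM2l.
lra.
Qed.

Lemma rint_dirichlet2 n : rint (fun t => nc (dirichlet n).[expi t] ^+ 2) = 2 * pi * n%:R.
Proof.
have cX k : ccont (fun t : R => expi t ^+ k) by apply: ccontX; exact: ccont_expi.
elim: n => [|n IH].
  under [X in rint X]eq_fun do rewrite horner_dirichlet big_ord0 nc0 expr0n.
  by rewrite rint_cst mul0r mulr0.
have cD : ccont (fun t : R => expi t ^+ n * ((dirichlet n).[expi t])^*).
  by apply: ccontM => //; apply: ccontJ; exact: ccont_horner.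
have -> : (fun t : R => nc (dirichlet n.+1).[expi t] ^+ 2) =
  (fun t => nc (dirichlet n).[expi t] ^+ 2 +
     (1 + 2 * re (expi t ^+ n * ((dirichlet n).[expi t])^*))).
  apply/funext => t; rewrite dirichletS !sqr_nc !reimE.
  have := sqr_nc (expi t ^+ n); rewrite ncX nc_expi expr1n expr1n => h.
  by rewrite [X in _ + (X + _)]h; ring.
have cre : continuous (fun t : R => re (expi t ^+ n * ((dirichlet n).[expi t])^*)).
  by have [] := cD.
rewrite rintD; last 2 first.
- by apply: continuous_nc2; exact: ccont_horner.
- by apply: continuousDr; [exact: continuous_cstr|exact: continuousMcr].
rewrite IH rintD; last 2 first.
- exact: continuous_cstr.
- exact: continuousMcr.
rewrite rint_cst rintZ//.
have : cint (fun t : R => expi t ^+ n * ((dirichlet n).[expi t])^*) = 0.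
  have -> : (fun t : R => expi t ^+ n * ((dirichlet n).[expi t])^*) =
      (fun t => \sum_(j < n) expi t ^+ (n - j)).
    apply/funext => t; rewrite horner_dirichlet rmorph_sum mulr_sumr.
    apply: eq_bigr => j _; rewrite rmorphXn/=.
    have -> : expi t ^+ n = expi t ^+ (n - j) * expi t ^+ j.
      by rewrite -exprD subnK// ltnW.
    rewrite -mulrA -exprMn.
    by rewrite circle_mulJ ?nc_expi// expr1n mulr1.
  rewrite cint_sum// big1// => j _.
  by rewrite cint_expiX// subn_gt0.
move=> /(congr1 (fun x => re x)) /= ->.
rewrite -natr1; ring.
Qed.

(** The real part of the Fejer kernel is nonnegative for this reason. *)
Lemma re_sum_dirichlet m z : nc z = 1 ->
  2 * re (\sum_(i < m) (dirichlet i.+1).[z]) = m%:R + nc (dirichlet m).[z] ^+ 2.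
Proof.
move=> z1; elim: m => [|m IH].
  by rewrite !big_ord0 horner_dirichlet big_ord0 nc0 expr0n /= mulr0 addr0.
rewrite big_ord_recr /= reD mulrDr IH.
have key : (dirichlet m).[z] * (z ^+ m)^* = ((dirichlet m.+1).[z] - 1)^*.
  rewrite !horner_dirichlet big_ord_recl expr0 addrAC subrr add0r mulr_suml rmorph_sum.
  rewrite (reindex_inj rev_ord_inj) /=; apply: eq_bigr => i _.
  rewrite /= /bump /= add1n rmorphXn/= rmorphXn/=.
  have -> : z^* ^+ m = z^* ^+ (m - i.+1) * z^* ^+ i.+1 by rewrite -exprD subnK.
  rewrite mulrA.
  have -> : z ^+ (m - i.+1) * z^* ^+ (m - i.+1) = 1.
    by rewrite -exprMn circle_mulJ// expr1n.
  by rewrite mul1r.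
have := congr1 (fun x => re x) key; rewrite reJ reB reM reJ imJ /= => h.
rewrite [in RHS]dirichletS sqr_nc sqr_nc reD imD.
have := sqr_nc (z ^+ m); rewrite ncX z1 expr1n expr1n.
rewrite -natr1.
move: h; rewrite dirichletS reD.
move: (re (dirichlet m).[z]) (im (dirichlet m).[z]) (re (z ^+ m)) (im (z ^+ m)).
move=> a b c d h h'; have -> : (a + c) ^+ 2 + (b + d) ^+ 2 =
  a ^+ 2 + b ^+ 2 + (c ^+ 2 + d ^+ 2) + 2 * (a * c - b * - d) by ring.
rewrite -h' h; ring.
Qed.

Lemma sum_ord_succ m : \sum_(i < m) i.+1%:R = m%:R * m.+1%:R / 2 :> R.
Proof.
elim: m => [|m IH]; first by rewrite big_ord0 mul0r mul0r.
by rewrite big_ord_recr /= IH -!natr1; field.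
Qed.

Lemma horner_fejer m z :
  (fejer m).[z] = (2 / (m%:R * m.+1%:R))%:C * \sum_(i < m) (dirichlet i.+1).[z].
Proof. by rewrite hornerZ horner_sum. Qed.

Section Bounds.
Variables (m : nat) (z : R[i]).
Hypotheses (m0 : (0 < m)%N) (z1 : nc z = 1).

Let mr : 0 < m%:R :> R. Proof. by rewrite ltr0n. Qed.
Let mSr : 0 < m.+1%:R :> R. Proof. by rewrite ltr0n. Qed.
Let cm : 0 <= 2 / (m%:R * m.+1%:R) :> R.
Proof. by rewrite divr_ge0// mulr_ge0// ltW. Qed.

Lemma re_fejer_ge0 : 0 <= re (fejer m).[z].
Proof.
rewrite horner_fejer reMr mulr_ge0//.
have := re_sum_dirichlet m z1; have := sqr_ge0 (nc (dirichlet m).[z]).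
by have := mr; lra.
Qed.

Lemma nc_fejer_le1 : nc (fejer m).[z] <= 1.
Proof.
rewrite horner_fejer ncMr//.
have h : nc (\sum_(i < m) (dirichlet i.+1).[z]) <= m%:R * m.+1%:R / 2.
  rewrite -sum_ord_succ (le_trans (nc_sum _ _ _))//; apply: ler_sum => i _.
  rewrite horner_dirichlet (le_trans (nc_sum _ _ _))//.
  under eq_bigr do rewrite ncX z1 expr1n.
  by rewrite sumr_const card_ord.
apply: le_trans (ler_wpM2l cm h) _.
by rewrite le_eqVlt; apply/orP; left; apply/eqP; field; rewrite ?gt_eqF.
Qed.

Lemma fejer_near1 : nc (1 - (fejer m).[z]) <= m%:R * nc (1 - z).
Proof.
have -> : 1 - (fejer m).[z] = (2 / (m%:R * m.+1%:R))%:C *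
    \sum_(i < m) (i.+1%:R - (dirichlet i.+1).[z]).
  rewrite horner_fejer sumrB mulrBr; congr (_ - _).
  have -> : \sum_(i < m) i.+1%:R = (\sum_(i < m) i.+1%:R : R)%:C.
    by rewrite rmorph_sum; apply: eq_bigr => i _; rewrite rmorph_nat.
  rewrite sum_ord_succ -rmorphM.
  have -> : 2 / (m%:R * m.+1%:R) * (m%:R * m.+1%:R / 2) = 1 :> R.
    by field; rewrite ?gt_eqF.
  by [].
rewrite ncMr//.
have h : nc (\sum_(i < m) (i.+1%:R - (dirichlet i.+1).[z])) <=
    m%:R * m.+1%:R / 2 * (m%:R * nc (1 - z)).
  rewrite -sum_ord_succ mulr_suml (le_trans (nc_sum _ _ _))//; apply: ler_sum => i _.
  by apply: dirichlet_near.
apply: le_trans (ler_wpM2l cm h) _.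
by rewrite le_eqVlt; apply/orP; left; apply/eqP; field; rewrite ?gt_eqF.
Qed.

(** Multiplication by [1 - z] telescopes each Dirichlet kernel to two terms. *)
Lemma fejer_far : m%:R * nc (1 - z) * nc (fejer m).[z] <= 4.
Proof.
rewrite horner_fejer ncMr//.
have h : nc (1 - z) * nc (\sum_(i < m) (dirichlet i.+1).[z]) <= m%:R * 2.
  rewrite -ncM mulr_sumr (le_trans (nc_sum _ _ _))//.
  apply: (@le_trans _ _ (\sum_(i < m) 2)); last by rewrite sumr_const card_ord mulr_natl.
  apply: ler_sum => i _; rewrite dirichlet_geo (le_trans (ncB _ _))//.
  by rewrite ncX z1 expr1n nc1.
have -> : m%:R * nc (1 - z) * (2 / (m%:R * m.+1%:R) *
   nc (\sum_(i < m) (dirichlet i.+1).[z])) =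
   2 / m.+1%:R * (nc (1 - z) * nc (\sum_(i < m) (dirichlet i.+1).[z])).
  by field; rewrite ?gt_eqF.
apply: (@le_trans _ _ (2 / m.+1%:R * (m%:R * 2))).
  by rewrite ler_wpM2l// divr_ge0// ltW.
rewrite mulrAC ler_pdivrMr// -natr1.
by have := mr; lra.
Qed.

End Bounds.

Lemma fejer_at1 m : (0 < m)%N -> (fejer m).[1] = 1.
Proof.
move=> m0; have := @fejer_near1 m 1 m0 (nc1 : nc (1 : R[i]) = 1).
rewrite subrr nc0 mulr0 => h; apply/eqP; rewrite eq_sym -subr_eq0 -nc_eq0.
by rewrite eq_le h nc_ge0.
Qed.

Lemma fejer_at0 m : (0 < m)%N -> (fejer m).[0] = (2 / m.+1%:R)%:C.
Proof.
move=> m0; rewrite horner_fejer.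
have -> : \sum_(i < m) (dirichlet i.+1).[0] = (m%:R : R)%:C.
  rewrite rmorph_nat; transitivity (\sum_(i < m) (1 : R[i])).
    apply: eq_bigr => i _; rewrite horner_dirichlet big_ord_recl big1 ?addr0//.
    by move=> j _; rewrite expr0n.
  by rewrite sumr_const card_ord.
rewrite -rmorphM; congr (_%:C).
have mr : 0 < m%:R :> R by rewrite ltr0n.
have mSr : 0 < m.+1%:R :> R by rewrite ltr0n.
by field; rewrite ?gt_eqF.
Qed.

Lemma size_fejer m : (size (fejer m) <= m)%N.
Proof.
rewrite (leq_trans (size_scale_leq _ _))//.
rewrite (leq_trans (size_sum _ _ _))//; apply/bigmax_leqP => i _.
rewrite (leq_trans (size_sum _ _ _))//; apply/bigmax_leqP => j _.
by rewrite size_polyXn (leq_trans (ltn_ord j)).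
Qed.

End Fejer.

(** * The lacunary sums *)

Section Lacunary.
Context {R : realType}.

(** The two lacunary sums as functions of the values [a k] of the Fejer kernels at a given
    point: the estimates use nothing else about the kernels. The first term of [lacF] and
    the last one of [lacG] are the values at the finest scale [2^(-10 K)], which plays the
    part of [1 / N]. *)
Definition lacF (K : nat) (a : nat -> R[i]) : R[i] :=
  ((2^-1 ^+ K) ^+ 10)%:C + \sum_(k < K.+1) ((2^-1 ^+ k) ^+ 12)%:C * (1 - a k).

Definition lacG (K : nat) (a : nat -> R[i]) : R[i] :=
  1 + \sum_(k < K.+1) ((2 ^+ k) ^+ 4)%:C * a k + ((2 ^+ K) ^+ 5)%:C * a K.

(** The value that [lacF] approaches when all the [a k] tend to 0. *)
Definition plateau (K : nat) : R :=
  (2^-1 ^+ K) ^+ 10 + \sum_(k < K.+1) (2^-1 ^+ k) ^+ 12.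

Local Notation u k := ((2^-1 : R) ^+ k).
Local Notation p k := ((2 : R) ^+ k).

Lemma half_gt0 k : 0 < u k. Proof. by rewrite exprn_gt0// invr_gt0. Qed.
Lemma half_ge0 k : 0 <= u k. Proof. exact/ltW/half_gt0. Qed.
Lemma half_le1 k : u k <= 1. Proof. by rewrite exprn_ile1 ?invr_ge0// invf_le1// ler1n. Qed.
Lemma two_gt0 k : 0 < p k. Proof. by rewrite exprn_gt0. Qed.
Lemma two_ge0 k : 0 <= p k. Proof. exact/ltW/two_gt0. Qed.
Lemma two_ge1 k : 1 <= p k. Proof. by rewrite exprn_ege1// ler1n. Qed.
Lemma twoK k : p k * u k = 1.
Proof. by rewrite -exprMn mulfV ?expr1n// pnatr_eq0. Qed.
Lemma twoXK k n : p k ^+ n * u k ^+ n = 1.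
Proof. by rewrite -exprMn twoK expr1n. Qed.
Lemma half_le j k : (j <= k)%N -> u k <= u j.
Proof. by move=> jk; rewrite ler_wiXn2l ?invr_ge0// invf_le1// ler1n. Qed.

Lemma half_Xle n k : (0 < n)%N -> u k ^+ n <= u k.
Proof.
case: n => // n _; rewrite exprS -[leRHS]mulr1 ler_wpM2l ?half_ge0//.
by rewrite exprn_ile1 ?half_le1// half_ge0.
Qed.

(** Subtracting [2 u^n] at the end of the range makes the bound inductive. *)
Lemma sum_half_tail a b n : (0 < n)%N -> \sum_(a <= k < b) u k ^+ n <= 2 * u a ^+ n.
Proof.
move=> n0; have H c m : \sum_(c <= k < c + m) u k ^+ n <= 2 * u c ^+ n - 2 * u (c + m) ^+ n.
  elim: m => [|m IH].
    rewrite addn0 big_geq//; have := exprn_gt0 n (half_gt0 c); lra.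
  rewrite addnS big_nat_recr ?leq_addr//=.
  have -> : u (c + m).+1 ^+ n = 2^-1 ^+ n * u (c + m) ^+ n by rewrite exprS exprMn.
  have : 2^-1 ^+ n * u (c + m) ^+ n <= 2^-1 * u (c + m) ^+ n.
    rewrite ler_wpM2r ?exprn_ge0 ?half_ge0//.
    by have := @half_Xle n 1 n0; rewrite expr1.
  by move: IH; set x := \sum_(_ <= _ < _) _; lra.
have [ab|ba] := leqP a b.
  rewrite -(subnKC ab) (le_trans (H _ _))// gerBl mulr_ge0// exprn_ge0// half_ge0.
by rewrite big_geq 1?ltnW// mulr_ge0// exprn_ge0// half_ge0.
Qed.

Lemma sum_half n K : (0 < n)%N -> \sum_(k < K) u k ^+ n <= 2.
Proof.
move=> n0; rewrite -(big_mkord xpredT (fun k => u k ^+ n)).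
by have := @sum_half_tail 0 K n n0; rewrite expr0 expr1n mulr1.
Qed.

Lemma sum_two n j : (0 < n)%N -> \sum_(k < j.+1) p k ^+ n <= 2 * p j ^+ n.
Proof.
move=> n0; elim: j => [|j IH].
  by rewrite big_ord_recr big_ord0 /= expr0 expr1n; lra.
rewrite big_ord_recr /=.
have -> : p j.+1 ^+ n = 2 ^+ n * p j ^+ n by rewrite exprS exprMn.
have : 2 * p j ^+ n <= 2 ^+ n * p j ^+ n.
  rewrite ler_wpM2r ?exprn_ge0 ?two_ge0//.
  by case: n n0 {IH} => // n _; rewrite exprS -[leLHS]mulr1 ler_wpM2l// two_ge1.
by move: IH; set x := \sum_(_ < _) _; lra.
Qed.

Lemma plateau_bounds K : 1 <= plateau K <= 3.
Proof.
have h1 : 0 <= u K ^+ 10 <= 1.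
  apply/andP; split; first exact/exprn_ge0/half_ge0.
  by apply: exprn_ile1; [exact: half_ge0|exact: half_le1].
have h2 := @sum_half 12 K.+1 isT.
have h3 : 1 <= \sum_(k < K.+1) u k ^+ 12.
  rewrite big_ord_recl expr0 expr1n lerDl; apply: sumr_ge0 => i _.
  exact/exprn_ge0/half_ge0.
rewrite /plateau; lra.
Qed.

(** In the application [y] is the distance to 1 multiplied by the order of the coarsest
    kernel. *)
Variables (K : nat) (y : R) (a : nat -> R[i]).
Hypotheses (y0 : 0 <= y) (a1 : forall k, nc (a k) <= 1).
Hypothesis (a_re : forall k, 0 <= re (a k)).
Hypothesis (a_near : forall k, nc (1 - a k) <= p k ^+ 10 * y).
Hypothesis (a_far : forall k, p k ^+ 10 * y * nc (a k) <= 4).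

Let F := lacF K a.
Let G := lacG K a.

Lemma re_lacF : re F = u K ^+ 10 + \sum_(k < K.+1) u k ^+ 12 * (1 - re (a k)).
Proof.
rewrite /F /lacF reD re_sum; congr (_ + _).
by apply: eq_bigr => k _; rewrite reMr reB.
Qed.

Lemma re_lacG : re G = 1 + \sum_(k < K.+1) p k ^+ 4 * re (a k) + p K ^+ 5 * re (a K).
Proof.
rewrite /G /lacG !reD re_sum reMr; congr (_ + _ + _).
by apply: eq_bigr => k _; rewrite reMr.
Qed.

Lemma re_a_le1 k : re (a k) <= 1. Proof. exact: le_trans (re_le _) (a1 k). Qed.

Lemma re_lacF_ge : u K ^+ 10 <= re F.
Proof.
rewrite re_lacF lerDl; apply: sumr_ge0 => k _.
by rewrite mulr_ge0 ?subr_ge0 ?re_a_le1// exprn_ge0// half_ge0.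
Qed.

(** One kernel that has already decayed gives the lower bound for the real part. *)
Lemma re_lacF_term k : (k <= K)%N -> 8 <= p k ^+ 10 * y ->
  u K ^+ 10 + 2^-1 * u k ^+ 12 <= re F.
Proof.
move=> kK yk; rewrite re_lacF lerD2l.
rewrite (bigD1 (Ordinal (kK : k < K.+1)%N))//= ler_wpDr//.
  apply: sumr_ge0 => i _.
  by rewrite mulr_ge0 ?subr_ge0 ?re_a_le1// exprn_ge0// half_ge0.
rewrite mulrC ler_wpM2l ?exprn_ge0 ?half_ge0//.
have := a_far k; have := re_le (a k).
have : 8 * nc (a k) <= p k ^+ 10 * y * nc (a k) by rewrite ler_wpM2r ?nc_ge0.
lra.
Qed.

Lemma re_lacG_ge1 : 1 <= re G.
Proof.
rewrite re_lacG -addrA lerDl addr_ge0//.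
  by apply: sumr_ge0 => k _; rewrite mulr_ge0// exprn_ge0// two_ge0.
by rewrite mulr_ge0// exprn_ge0// two_ge0.
Qed.

(** One kernel that is still close to 1 gives the lower bound for the real part. *)
Lemma re_lacG_term k : (k <= K)%N -> p k ^+ 10 * y <= 2^-1 -> 2^-1 * p k ^+ 4 <= re G.
Proof.
move=> kK yk; rewrite re_lacG.
rewrite (bigD1 (Ordinal (kK : k < K.+1)%N))//=.
have h1 : 0 <= \sum_(i < K.+1 | i != Ordinal (kK : k < K.+1)%N) p i ^+ 4 * re (a i).
  by apply: sumr_ge0 => i _; rewrite mulr_ge0// exprn_ge0// two_ge0.
have h2 : 0 <= p K ^+ 5 * re (a K) by rewrite mulr_ge0// exprn_ge0// two_ge0.
have h3 : p k ^+ 4 * 2^-1 <= p k ^+ 4 * re (a k).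
  rewrite ler_wpM2l ?exprn_ge0 ?two_ge0//.
  have := re_le (1 - a k); rewrite reB /=; have := a_near k; lra.
lra.
Qed.

Lemma nc_lacF_le : nc F <= u K ^+ 10 + 2 * y.
Proof.
rewrite (le_trans (ncD _ _))//.
rewrite ncr ger0_norm ?lerD2l ?exprn_ge0 ?half_ge0//.
rewrite (le_trans (nc_sum _ _ _))//.
apply: (@le_trans _ _ (\sum_(k < K.+1) u k ^+ 2 * y)).
  apply: ler_sum => k _; rewrite ncMr ?exprn_ge0 ?half_ge0//.
  have h : 0 <= u k ^+ 12 by rewrite exprn_ge0 ?half_ge0.
  apply: le_trans (ler_wpM2l h (a_near k)) _.
  have -> : u k ^+ 12 * (p k ^+ 10 * y) = (p k ^+ 10 * u k ^+ 10) * (u k ^+ 2 * y) by ring.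
  by rewrite twoXK mul1r.
by rewrite -mulr_suml ler_wpM2r// sum_half.
Qed.

Lemma nc_a_far k : 0 < y -> nc (a k) <= 4 / y * u k ^+ 10.
Proof.
move=> y1; rewrite mulrAC ler_pdivlMr//.
have h : 0 <= u k ^+ 10 by rewrite exprn_ge0 ?half_ge0.
have := ler_wpM2l h (a_far k).
have -> : u k ^+ 10 * (p k ^+ 10 * y * nc (a k)) =
  (p k ^+ 10 * u k ^+ 10) * (nc (a k) * y) by ring.
by rewrite twoXK mul1r [_ * 4]mulrC.
Qed.

Lemma nc_lacF_plateau : 0 < y -> nc (F - (plateau K)%:C) <= 8 / y.
Proof.
move=> y1; have -> : F - (plateau K)%:C = - \sum_(k < K.+1) (u k ^+ 12)%:C * a k.
  rewrite /F /lacF /plateau rmorphD/= rmorph_sum/= opprD addrACA subrr add0r.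
  by rewrite -sumrB -sumrN; apply: eq_bigr => k _; ring.
rewrite ncN (le_trans (nc_sum _ _ _))//.
apply: (@le_trans _ _ (\sum_(k < K.+1) 4 / y * u k ^+ 1)).
  apply: ler_sum => k _; rewrite ncMr ?exprn_ge0 ?half_ge0//.
  have h : 0 <= u k ^+ 12 by rewrite exprn_ge0 ?half_ge0.
  apply: le_trans (ler_wpM2l h (nc_a_far k y1)) _.
  rewrite mulrCA -exprD ler_wpM2l ?divr_ge0// expr1; exact: half_Xle.
rewrite -mulr_sumr.
have := @sum_half 1 K.+1 isT; set s := \sum_(_ < _) _ => h.
have -> : 8 / y = 4 / y * 2 by field; rewrite gt_eqF.
by rewrite ler_wpM2l// divr_ge0.
Qed.

Lemma nc_lacG_far : 0 < y -> nc (G - 1) <= 12 / y.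
Proof.
move=> y1; have y4 : 0 <= 4 / y by rewrite divr_ge0.
have -> : G - 1 = \sum_(k < K.+1) (p k ^+ 4)%:C * a k + (p K ^+ 5)%:C * a K.
  by rewrite /G /lacG; ring.
rewrite (le_trans (ncD _ _))//.
have h1 : nc (\sum_(k < K.+1) (p k ^+ 4)%:C * a k) <= 4 / y * 2.
  rewrite (le_trans (nc_sum _ _ _))//.
  apply: (@le_trans _ _ (\sum_(k < K.+1) 4 / y * u k ^+ 6)).
    apply: ler_sum => k _; rewrite ncMr ?exprn_ge0 ?two_ge0//.
    have h : 0 <= p k ^+ 4 by rewrite exprn_ge0 ?two_ge0.
    apply: le_trans (ler_wpM2l h (nc_a_far k y1)) _.
    have -> : p k ^+ 4 * (4 / y * u k ^+ 10) = (p k ^+ 4 * u k ^+ 4) * (4 / y * u k ^+ 6) by ring.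
    by rewrite twoXK mul1r.
  by rewrite -mulr_sumr ler_wpM2l// sum_half.
have h2 : nc ((p K ^+ 5)%:C * a K) <= 4 / y.
  rewrite ncMr ?exprn_ge0 ?two_ge0//.
  have h : 0 <= p K ^+ 5 by rewrite exprn_ge0 ?two_ge0.
  apply: le_trans (ler_wpM2l h (nc_a_far K y1)) _.
  have -> : p K ^+ 5 * (4 / y * u K ^+ 10) = (p K ^+ 5 * u K ^+ 5) * (4 / y * u K ^+ 5) by ring.
  rewrite twoXK mul1r -[leRHS]mulr1 ler_wpM2l//.
  by rewrite exprn_ile1 ?half_le1// half_ge0.
have -> : 12 / y = 4 / y * 3 by field; rewrite gt_eqF.
lra.
Qed.

(** The kernels up to scale [j] are bounded by 1 and those beyond it by their decay; both
    groups are geometric sums dominated by the terms near [j]. The second summand on the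
    right comes from the peak. *)
Lemma nc_lacG_le j : (j <= K)%N -> (j = K \/ 8 * u j.+1 ^+ 10 <= y) ->
  nc G <= 512 * (p j ^+ 4 + u K ^+ 5 * p j ^+ 10).
Proof.
move=> jK H.
have p1 : 1 <= p j ^+ 4 by rewrite exprn_ege1// two_ge1.
have h0 : nc G <= 1 + \sum_(k < K.+1) p k ^+ 4 * nc (a k) + p K ^+ 5 * nc (a K).
  rewrite (le_trans (ncD _ _))// ncMr ?exprn_ge0 ?two_ge0// lerD2r.
  rewrite (le_trans (ncD _ _))// nc1 lerD2l (le_trans (nc_sum _ _ _))//.
  by apply: ler_sum => k _; rewrite ncMr ?exprn_ge0 ?two_ge0.
have hlow n : \sum_(0 <= k < n.+1) p k ^+ 4 * nc (a k) <= 2 * p n ^+ 4.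
  rewrite big_mkord (le_trans _ (@sum_two 4 n isT))//; apply: ler_sum => k _.
  by rewrite -[leRHS]mulr1 ler_wpM2l// exprn_ge0// two_ge0.
rewrite -(big_mkord xpredT (fun k => p k ^+ 4 * nc (a k))) in h0.
have [jeK|jnK] := eqVneq j K.
  have h1 := hlow K; rewrite -jeK in h0 h1.
  have h2 : p j ^+ 5 * nc (a j) <= p j ^+ 5 * 1.
    by rewrite ler_wpM2l ?exprn_ge0 ?two_ge0.
  have h3 : p j ^+ 5 = u j ^+ 5 * p j ^+ 10.
    have -> : u j ^+ 5 * p j ^+ 10 = (p j ^+ 5 * u j ^+ 5) * p j ^+ 5 by ring.
    by rewrite twoXK mul1r.
  rewrite -jeK -h3; have := exprn_gt0 5 (two_gt0 j).
  by move: h0 h1; set s := \sum_(_ <= _ < _) _; lra.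
have {}H : 8 * u j.+1 ^+ 10 <= y by case: H => // H; rewrite H eqxx in jnK.
have y1 : 0 < y by apply: lt_le_trans H; rewrite mulr_gt0// exprn_gt0// half_gt0.
have jlK : (j < K)%N by rewrite ltn_neqAle jnK.
have hy : 4 / y <= 2^-1 * p j.+1 ^+ 10.
  rewrite ler_pdivrMr//.
  have hp : 0 <= 2^-1 * p j.+1 ^+ 10 by rewrite mulr_ge0 ?invr_ge0// exprn_ge0// two_ge0.
  apply: le_trans (ler_wpM2l hp H).
  have -> : 2^-1 * p j.+1 ^+ 10 * (8 * u j.+1 ^+ 10) = 4 * (p j.+1 ^+ 10 * u j.+1 ^+ 10) by field.
  by rewrite twoXK mulr1.
have ha k : nc (a k) <= 2^-1 * p j.+1 ^+ 10 * u k ^+ 10.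
  apply: le_trans (nc_a_far k y1) _.
  by rewrite ler_wpM2r// exprn_ge0// half_ge0.
have h1 := hlow j.
have h2 : \sum_(j.+1 <= k < K.+1) p k ^+ 4 * nc (a k) <= 16 * p j ^+ 4.
  apply: (@le_trans _ _ (\sum_(j.+1 <= k < K.+1) 2^-1 * p j.+1 ^+ 10 * u k ^+ 6)).
    apply: ler_sum => k _.
    have h : 0 <= p k ^+ 4 by rewrite exprn_ge0 ?two_ge0.
    apply: le_trans (ler_wpM2l h (ha k)) _.
    have -> : p k ^+ 4 * (2^-1 * p j.+1 ^+ 10 * u k ^+ 10) =
      (p k ^+ 4 * u k ^+ 4) * (2^-1 * p j.+1 ^+ 10 * u k ^+ 6) by ring.
    by rewrite twoXK mul1r.
  rewrite -mulr_sumr.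
  have hp : 0 <= 2^-1 * p j.+1 ^+ 10 by rewrite mulr_ge0 ?invr_ge0// exprn_ge0// two_ge0.
  apply: le_trans (ler_wpM2l hp (@sum_half_tail j.+1 K.+1 6 isT)) _.
  have -> : 2^-1 * p j.+1 ^+ 10 * (2 * u j.+1 ^+ 6) = (p j.+1 ^+ 6 * u j.+1 ^+ 6) * p j.+1 ^+ 4.
    by field.
  rewrite twoXK mul1r [p j.+1]exprS exprMn.
  have -> : (2 : R) ^+ 4 = 16 by ring.
  by [].
have h3 : p K ^+ 5 * nc (a K) <= 512 * (u K ^+ 5 * p j ^+ 10).
  have h : 0 <= p K ^+ 5 by rewrite exprn_ge0 ?two_ge0.
  apply: le_trans (ler_wpM2l h (ha K)) _.
  have -> : p K ^+ 5 * (2^-1 * p j.+1 ^+ 10 * u K ^+ 10) =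
      (p K ^+ 5 * u K ^+ 5) * (2^-1 * p j.+1 ^+ 10 * u K ^+ 5) by ring.
  rewrite twoXK mul1r [p j.+1]exprS exprMn.
  have -> : (2 : R) ^+ 10 = 1024 by ring.
  lra.
rewrite (@big_cat_nat _ _ _ j.+1)//= in h0.
by move: h0 h1 h2 h3; set s := \sum_(0 <= _ < _) _; set s2 := \sum_(j.+1 <= _ < _) _; lra.
Qed.

(** The scale of a point: the finest one at which it still counts as close to 1. *)
Lemma lac_scale : y < 8 -> exists j, [/\ (j <= K)%N, y < 8 * u j ^+ 10 &
  j = K \/ 8 * u j.+1 ^+ 10 <= y].
Proof.
move=> y8; elim: K => [|L [j [jL yj H]]].
  by exists 0%N; split => //; [rewrite expr0 expr1n mulr1|left].
have [yL|yL] := ltP y (8 * u L.+1 ^+ 10).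
  by exists L.+1; split => //; left.
exists j; split => //; first exact: leqW.
by case: H => [->|]; right.
Qed.

(** Large enough for both comparisons of [lacF] with [lacG] below. *)
Definition lac_const : R := 2 ^+ 60.

Lemma lac_const_ge n : (n <= 60)%N -> 2 ^+ n <= lac_const.
Proof. by move=> n60; rewrite /lac_const ler_weXn2l// ler1n. Qed.

Lemma lac_const_ge1024 : 1024 <= lac_const.
Proof. by have := @lac_const_ge 10 isT; have -> : (2 : R) ^+ 10 = 1024 by ring. Qed.

(** At scale [j], with [u = 2^-j] and [e = 2^-K], the product [|G| |F|] is of order
    [u^6 + e^5], while [re F] is at least of order [u^12 + e^10]. *)
Lemma lac_lower : nc G ^+ 2 * nc F ^+ 2 <= lac_const * re F.
Proof.
have C1024 := lac_const_ge1024; have [y8|y8] := ltP y 8; last first.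
  have y1 : 0 < y by lra.
  have := @re_lacF_term 0; rewrite !expr0 !expr1n mul1r mulr1 => /(_ isT y8) rF.
  have u0 := exprn_gt0 10 (half_gt0 K).
  have h8 : 8 / y <= 1 by rewrite ler_pdivrMr// mul1r.
  have h12 : 12 / y <= 2 by rewrite ler_pdivrMr//; lra.
  have F4 : nc F <= 4.
    have := ncD (F - (plateau K)%:C) (plateau K)%:C; rewrite subrK ncr.
    have := nc_lacF_plateau y1; have /andP[p1 p3] := plateau_bounds K.
    rewrite ger0_norm; lra.
  have G3 : nc G <= 3.
    have := ncD (G - 1) 1; rewrite subrK nc1; have := nc_lacG_far y1; lra.
  have : nc G ^+ 2 * nc F ^+ 2 <= 3 ^+ 2 * 4 ^+ 2.
    by apply: ler_pM; rewrite ?sqr_ge0// lerXn2r ?nnegrE ?nc_ge0.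
  have : 1024 * 2^-1 <= lac_const * re F by apply: ler_pM; lra.
  lra.
have [j [jK yj H]] := lac_scale y8.
have u0 := half_gt0 j; have e0 := half_gt0 K.
have F12 : nc F <= 17 * u j ^+ 10.
  have := nc_lacF_le.
  have : u K ^+ 10 <= u j ^+ 10 by rewrite lerXn2r ?nnegrE ?half_ge0// half_le.
  lra.
have G512 := nc_lacG_le jK H.
have rF : 2^-1 ^+ 14 * (u j ^+ 12 + u K ^+ 10) <= re F.
  have v1 : 0 < u j ^+ 12 by rewrite exprn_gt0.
  have v2 : 0 < u K ^+ 10 by rewrite exprn_gt0.
  have -> : (2^-1 : R) ^+ 14 = 16384^-1 by rewrite exprVn; congr (_^-1); ring.
  case: H => [jeK|H].
    have := re_lacF_ge; have : u j ^+ 12 <= u K ^+ 10.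
      by rewrite jeK ler_wiXn2l ?half_le1 ?half_ge0.
    lra.
  have [jeK|jnK] := eqVneq j K.
    have := re_lacF_ge; have : u j ^+ 12 <= u K ^+ 10.
      by rewrite jeK ler_wiXn2l ?half_le1 ?half_ge0.
    lra.
  have jlK : (j < K)%N by rewrite ltn_neqAle jnK.
  have := @re_lacF_term j.+1 jlK.
  have -> : u j.+1 ^+ 12 = 4096^-1 * u j ^+ 12.
    by rewrite [u j.+1]exprS exprMn; congr (_ * _); rewrite exprVn; congr (_^-1); ring.
  have h : 8 <= p j.+1 ^+ 10 * y.
    have hp : 0 <= p j.+1 ^+ 10 by rewrite exprn_ge0// two_ge0.
    have := ler_wpM2l hp H; rewrite mulrCA twoXK; lra.
  move=> /(_ h); lra.
have GF : nc G * nc F <= 2 ^+ 14 * (u j ^+ 6 + u K ^+ 5).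
  have GF512 : nc G * nc F <= 512 * (p j ^+ 4 + u K ^+ 5 * p j ^+ 10) * (17 * u j ^+ 10).
    by apply: ler_pM; rewrite ?nc_ge0.
  apply: le_trans GF512 _.
  have -> (m m' A A' B : R) : m * (A ^+ 4 + B * A ^+ 10) * (m' * A' ^+ 10) =
    m * m' * ((A ^+ 4 * A' ^+ 4) * A' ^+ 6 + B * (A ^+ 10 * A' ^+ 10)) by ring.
  rewrite !twoXK mul1r mulr1 ler_wpM2r ?addr_ge0 ?exprn_ge0 ?half_ge0//.
  have -> : (2 : R) ^+ 14 = 2 ^+ 9 * 2 ^+ 5 by rewrite -exprD.
  have -> : (2 : R) ^+ 9 = 512 by ring.
  have -> : (2 : R) ^+ 5 = 32 by ring.
  by lra.
have v1 : 0 <= u j ^+ 6 by rewrite exprn_ge0// half_ge0.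
have v2 : 0 <= u K ^+ 5 by rewrite exprn_ge0// half_ge0.
have e1 : u j ^+ 12 = (u j ^+ 6) ^+ 2 by move: (u j) => x; rewrite -exprM.
have e2 : u K ^+ 10 = (u K ^+ 5) ^+ 2 by move: (u K) => x; rewrite -exprM.
have {}rF : (u j ^+ 6) ^+ 2 + (u K ^+ 5) ^+ 2 <= 2 ^+ 14 * re F.
  have := ler_wpM2l (@two_ge0 14) rF; rewrite mulrA twoK mul1r e1 e2; exact.
move: rF v1 v2 GF; move: (u j ^+ 6) (u K ^+ 5) (re F) => A B r rF A0 B0 GF.
have {}GF : (nc G * nc F) ^+ 2 <= (2 ^+ 14 * (A + B)) ^+ 2.
  apply: lerXn2r => //; rewrite nnegrE ?mulr_ge0 ?nc_ge0 ?two_ge0//.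
  exact: addr_ge0.
rewrite -exprMn; apply: le_trans GF _.
have AB : (A + B) ^+ 2 <= 2 * (A ^+ 2 + B ^+ 2).
  have : 0 <= (A - B) ^+ 2 by rewrite sqr_ge0.
  have -> : (A - B) ^+ 2 = A ^+ 2 - 2 * A * B + B ^+ 2 by ring.
  have -> : (A + B) ^+ 2 = A ^+ 2 + 2 * A * B + B ^+ 2 by ring.
  lra.
have {}AB : (A + B) ^+ 2 <= 2 * (2 ^+ 14 * r).
  by apply: le_trans AB _; rewrite ler_wpM2l.
have r0 : 0 <= r.
  have : 0 <= 2 ^+ 14 * r by apply: le_trans rF; rewrite addr_ge0 ?sqr_ge0.
  by rewrite pmulr_rge0// two_gt0.
have := ler_wpM2l (exprn_ge0 2 (@two_ge0 14)) AB.
rewrite -exprMn => /le_trans; apply.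
have -> (x : R) : (x ^+ 14) ^+ 2 * (x * (x ^+ 14 * r)) = x ^+ 43 * r by ring.
by rewrite ler_wpM2r// lac_const_ge.
Qed.

(** At scale [j], with [u = 2^-j], the quotient [|F|^2 / (|G|^2 (re F)^3)] is of order
    [u^20 u^8 / u^36 = u^-8], which is one of the terms of the sum. The functions [c k]
    stand for indicators of arcs around 1. *)
Lemma lac_upper (c : nat -> R) : (forall k, 0 <= c k) ->
  (forall k, y < 8 * u k ^+ 10 -> 1 <= c k) ->
  nc F ^+ 2 <= lac_const * (nc G ^+ 2 * re F ^+ 3) * (1 + \sum_(k < K.+1) p k ^+ 8 * c k).
Proof.
move=> c0 c1.
have sum0 : 0 <= \sum_(k < K.+1) p k ^+ 8 * c k.
  by apply: sumr_ge0 => k _; rewrite mulr_ge0// exprn_ge0// two_ge0.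
have G1 : 1 <= nc G by apply: le_trans re_lacG_ge1 (re_le _).
have [y8|y8] := ltP y 8; last first.
  have y1 : 0 < y by lra.
  have := @re_lacF_term 0; rewrite !expr0 !expr1n mul1r mulr1 => /(_ isT y8) rF.
  have u0 := exprn_gt0 10 (half_gt0 K).
  have h8 : 8 / y <= 1 by rewrite ler_pdivrMr// mul1r.
  have F4 : nc F <= 4.
    have := ncD (F - (plateau K)%:C) (plateau K)%:C; rewrite subrK ncr.
    have := nc_lacF_plateau y1; have /andP[p1 p3] := plateau_bounds K.
    rewrite ger0_norm; lra.
  have h1 : nc F ^+ 2 <= 4 ^+ 2 by rewrite lerXn2r ?nnegrE ?nc_ge0.
  have h2 : 1 <= nc G ^+ 2 by rewrite exprn_ege1.
  have h3 : 2^-1 ^+ 3 <= re F ^+ 3 by rewrite lerXn2r ?nnegrE ?invr_ge0//; lra.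
  have h4 : 1 * 2^-1 ^+ 3 <= nc G ^+ 2 * re F ^+ 3.
    by apply: ler_pM => //; rewrite exprn_ge0// invr_ge0.
  apply: le_trans h1 _; rewrite -[leLHS]mulr1.
  apply: ler_pM; [by rewrite exprn_ge0|by []| |by rewrite lerDl].
  have e3 : (2^-1 : R) ^+ 3 = 8^-1 by rewrite exprVn; congr (_^-1); ring.
  have C1024 := lac_const_ge1024; rewrite mul1r e3 in h4.
  have : 1024 * 8^-1 <= lac_const * (nc G ^+ 2 * re F ^+ 3) by apply: ler_pM; lra.
  have -> : (4 : R) ^+ 2 = 16 by ring.
  lra.
have [j [jK yj H]] := lac_scale y8.
have u0 := half_gt0 j; have e0 := half_gt0 K.
have F12 : nc F <= 17 * u j ^+ 10.
  have := nc_lacF_le.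
  have : u K ^+ 10 <= u j ^+ 10 by rewrite lerXn2r ?nnegrE ?half_ge0// half_le.
  lra.
have v1 : 0 < u j ^+ 12 by rewrite exprn_gt0.
have rF : 2^-1 ^+ 13 * u j ^+ 12 <= re F.
  have v2 : 0 < u K ^+ 10 by rewrite exprn_gt0.
  have -> : (2^-1 : R) ^+ 13 = 8192^-1 by rewrite exprVn; congr (_^-1); ring.
  have [jeK|jnK] := eqVneq j K.
    have := re_lacF_ge; have : u j ^+ 12 <= u K ^+ 10.
      by rewrite jeK ler_wiXn2l ?half_le1 ?half_ge0.
    lra.
  have {}H : 8 * u j.+1 ^+ 10 <= y by case: H => // H; rewrite H eqxx in jnK.
  have jlK : (j < K)%N by rewrite ltn_neqAle jnK.
  have := @re_lacF_term j.+1 jlK.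
  have -> : u j.+1 ^+ 12 = 4096^-1 * u j ^+ 12.
    by rewrite [u j.+1]exprS exprMn; congr (_ * _); rewrite exprVn; congr (_^-1); ring.
  have h : 8 <= p j.+1 ^+ 10 * y.
    have hp : 0 <= p j.+1 ^+ 10 by rewrite exprn_ge0// two_ge0.
    have := ler_wpM2l hp H; rewrite mulrCA twoXK; lra.
  move=> /(_ h); lra.
have q0 := two_gt0 j.
have rG : 2^-1 ^+ 5 * p j ^+ 4 <= nc G.
  have -> : (2^-1 : R) ^+ 5 = 32^-1 by rewrite exprVn; congr (_^-1); ring.
  case: j {H F12 v1 rF u0} jK yj q0 => [|j] jK yj q0.
    by rewrite expr0 expr1n; lra.
  have := @re_lacG_term j (ltnW jK).
  have -> : p j.+1 ^+ 4 = 16 * p j ^+ 4.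
    by rewrite [p j.+1]exprS exprMn; congr (_ * _); ring.
  have h : p j ^+ 10 * y <= 2^-1.
    have hp : 0 <= p j ^+ 10 by rewrite exprn_ge0// two_ge0.
    have := ler_wpM2l hp (ltW yj); rewrite [u j.+1]exprS exprMn.
    have -> : p j ^+ 10 * (8 * (2^-1 ^+ 10 * u j ^+ 10)) = 8 * 2^-1 ^+ 10 * (p j ^+ 10 * u j ^+ 10) by ring.
    rewrite twoXK.
    have -> : (2^-1 : R) ^+ 10 = 1024^-1 by rewrite exprVn; congr (_^-1); ring.
    lra.
  move=> /(_ h); have := re_le G; lra.
have h1 : nc F ^+ 2 <= (17 * u j ^+ 10) ^+ 2.
  by rewrite lerXn2r ?nnegrE ?nc_ge0// mulr_ge0// exprn_ge0// ltW.
have h2 : (2^-1 ^+ 5 * p j ^+ 4) ^+ 2 <= nc G ^+ 2.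
  by rewrite lerXn2r ?nnegrE ?nc_ge0// mulr_ge0 ?exprn_ge0 ?invr_ge0// ltW.
have h3 : (2^-1 ^+ 13 * u j ^+ 12) ^+ 3 <= re F ^+ 3.
  have : 0 <= 2^-1 ^+ 13 * u j ^+ 12 by rewrite mulr_ge0 ?exprn_ge0 ?invr_ge0// ltW.
  by move=> h; rewrite lerXn2r ?nnegrE// (le_trans h).
have h4 : p j ^+ 8 <= 1 + \sum_(k < K.+1) p k ^+ 8 * c k.
  rewrite (bigD1 (Ordinal (jK : j < K.+1)%N))//=.
  have : 0 <= \sum_(i < K.+1 | i != Ordinal (jK : j < K.+1)%N) p i ^+ 8 * c i.
    by apply: sumr_ge0 => k _; rewrite mulr_ge0// exprn_ge0// two_ge0.
  have : p j ^+ 8 * 1 <= p j ^+ 8 * c j.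
    by rewrite ler_wpM2l ?exprn_ge0 ?(ltW q0)// c1.
  lra.
apply: le_trans h1 _.
apply: (@le_trans _ _ (lac_const * ((2^-1 ^+ 5 * p j ^+ 4) ^+ 2 * (2^-1 ^+ 13 * u j ^+ 12) ^+ 3) * p j ^+ 8)).
  have -> (c' h A B : R) : c' * ((h ^+ 5 * A ^+ 4) ^+ 2 * (h ^+ 13 * B ^+ 12) ^+ 3) * A ^+ 8 =
    (c' * h ^+ 49) * (A ^+ 16 * B ^+ 16) * B ^+ 20 by ring.
  have -> (c' x : R) : (c' * x ^+ 10) ^+ 2 = c' ^+ 2 * x ^+ 20 by ring.
  rewrite twoXK mulr1 ler_wpM2r ?exprn_ge0 ?(ltW u0)//.
  have -> : lac_const * 2^-1 ^+ 49 = 2 ^+ 11 * (p 49 * u 49).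
    by rewrite mulrA -exprD.
  rewrite twoK mulr1.
  have -> : (17 : R) ^+ 2 = 289 by ring.
  have -> : (2 : R) ^+ 11 = 2048 by ring.
  by lra.
have C0 : 0 <= lac_const by exact: two_ge0.
have w1 : 0 <= (2^-1 ^+ 5 * p j ^+ 4) ^+ 2.
  exact/exprn_ge0/(mulr_ge0 (half_ge0 5))/exprn_ge0/two_ge0.
have w2 : 0 <= (2^-1 ^+ 13 * u j ^+ 12) ^+ 3.
  exact/exprn_ge0/(mulr_ge0 (half_ge0 13))/exprn_ge0/half_ge0.
have w3 : 0 <= p j ^+ 8 by exact/exprn_ge0/two_ge0.
by apply: ler_pM => //; [exact/mulr_ge0/mulr_ge0|rewrite ler_wpM2l//; exact: ler_pM].
Qed.

End Lacunary.

(** * Orthonormal polynomials *)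

Section GramSchmidt.
Context {R : realType}.
Implicit Types (p q r : {poly R[i]}) (n : nat).
Variable ip : {poly R[i]} -> {poly R[i]} -> R[i].
Hypothesis ip_lin : forall (c : R[i]) (p q r : {poly R[i]}), ip (c *: p + q) r = c * ip p r + ip q r.
Hypothesis ip_sym : forall p q : {poly R[i]}, ip q p = (ip p q)^*.
Hypothesis ip_pos : forall p : {poly R[i]}, p != 0 -> exists2 s : R, 0 < s & ip p p = s%:C.

Lemma ip0l r : ip 0 r = 0.
Proof.
have := ip_lin (-1) 0 0 r; rewrite scaler0 addr0 => {1}->.
by rewrite mulN1r addNr.
Qed.

Lemma ipZl c p r : ip (c *: p) r = c * ip p r.
Proof. by rewrite -[c *: p]addr0 ip_lin ip0l addr0. Qed.

Lemma ipDl p q r : ip (p + q) r = ip p r + ip q r.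
Proof. by rewrite -[p]scale1r ip_lin mul1r scale1r. Qed.

Lemma ipZr c p r : ip p (c *: r) = c^* * ip p r.
Proof. by rewrite ip_sym ipZl rmorphM/= -ip_sym. Qed.

Lemma ipDr p q r : ip p (q + r) = ip p q + ip p r.
Proof. by rewrite ip_sym ipDl rmorphD/= -!ip_sym. Qed.

Lemma ip0r r : ip r 0 = 0. Proof. by rewrite ip_sym ip0l conjc0. Qed.

Lemma ip_suml (I : Type) (s : seq I) (F : I -> {poly R[i]}) r :
  ip (\sum_(i <- s) F i) r = \sum_(i <- s) ip (F i) r.
Proof. by elim/big_rec2: _ => [|i x y _ <-]; rewrite ?ip0l ?ipDl. Qed.

Definition orthogonal_to_lower n (p : {poly R[i]}) :=
  forall r : {poly R[i]}, (size r <= n)%N -> ip p r = 0.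

(** One polynomial of each degree below [n] is enough, by division of leading terms. *)
Lemma orthogonal_to_lowerP n (p : {poly R[i]}) (b : nat -> {poly R[i]}) :
  (forall k, (k < n)%N -> size (b k) = k.+1 /\ ip p (b k) = 0) -> orthogonal_to_lower n p.
Proof.
move=> hb r; move: {2}(size r) (leqnn (size r)) => m.
elim: m r => [|m IH] r rm rn.
  by move: rm; rewrite leqn0 size_poly_eq0 => /eqP ->; exact: ip0r.
have [rm'|] := leqP (size r) m; first exact: IH.
move=> mr; have {rm}sr : size r = m.+1 by apply/eqP; rewrite eqn_leq rm.
have mn : (m < n)%N by rewrite -sr.
have [sb pb] := hb m mn.
have lb : lead_coef (b m) != 0 by rewrite lead_coef_eq0 -size_poly_eq0 sb.
pose c := lead_coef r / lead_coef (b m).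
have h : (size (r - c *: b m)%R <= m)%N.
  apply/leq_sizeP => j mj; rewrite coefB coefZ.
  have [->|jm] := eqVneq j m.
    by rewrite /c !lead_coefE sr sb /= divfK ?subrr//; move: lb; rewrite lead_coefE sb.
  have mj' : (m < j)%N by rewrite ltn_neqAle eq_sym jm.
  by rewrite !nth_default ?sb ?sr// mulr0 subrr.
by rewrite -[r](subrK (c *: b m)) ipDr ipZr pb mulr0 addr0 IH// (leq_trans h)// ltnW.
Qed.

Lemma exists_monic_orthogonal n :
  exists p, [/\ size p = n.+1, lead_coef p = 1 & orthogonal_to_lower n p].
Proof.
elim/ltn_ind: n => n IH.
have /choice[b hb] : forall k, exists p : {poly R[i]}, (k < n)%N ->
    [/\ size p = k.+1, lead_coef p = 1 & orthogonal_to_lower k p].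
  move=> k; have [kn|nk] := ltnP k n; last by exists 0.
  by have [p hp] := IH k kn; exists p.
have bn0 k : (k < n)%N -> ip (b k) (b k) != 0.
  move=> kn; have [sb _ _] := hb k kn.
  have /ip_pos[s s0 ->] : b k != 0 by rewrite -size_poly_eq0 sb.
  by rewrite -nc_eq0 ncr normr_eq0 gt_eqF.
(* The projection of ['X^n] to the polynomials of lower degree. *)
pose q := \sum_(k < n) (ip 'X^n (b k) / ip (b k) (b k)) *: b k.
have sq : (size q <= n)%N.
  rewrite (leq_trans (size_sum _ _ _))//; apply/bigmax_leqP => k _.
  by rewrite (leq_trans (size_scale_leq _ _))//; have [-> _ _] := hb k (ltn_ord k).
have sX : size ('X^n : {poly R[i]}) = n.+1 by rewrite size_polyXn.
have sqX : (size (- q)%R < size ('X^n : {poly R[i]}))%N by rewrite size_polyN sX ltnS.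
exists ('X^n - q); split.
- by rewrite size_polyDl.
- by rewrite lead_coefDl// lead_coefXn.
apply: (@orthogonal_to_lowerP _ _ b) => k kn; have [sb lb ob] := hb k kn.
split => //; rewrite ipDl -scaleN1r ipZl mulN1r ip_suml.
rewrite (bigD1 (Ordinal kn))//= big1 => [|j jk].
  by rewrite addr0 ipZl divfK ?bn0// subrr.
have [sj _ oj] := hb j (ltn_ord j); rewrite ipZl.
suff -> : ip (b j) (b k) = 0 by rewrite mulr0.
have [jk'|kj|e] := ltngtP j k.
- by rewrite ip_sym ob ?conjc0// sj.
- by rewrite oj// sb.
- by move: jk; rewrite -val_eqE /= e eqxx.
Qed.

Lemma exists_orthonormal : exists phi : nat -> {poly R[i]},
  (forall n, size (phi n) = n.+1 /\ 0 < lead_coef (phi n)) /\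
  (forall n m, ip (phi n) (phi m) = (n == m)%:R) /\
  (forall n, orthogonal_to_lower n (phi n)).
Proof.
have [P hP] := choice exists_monic_orthogonal.
have hs n : exists s : R, 0 < s /\ ip (P n) (P n) = (s ^+ 2)%:C.
  have [sP _ _] := hP n.
  have /ip_pos[s s0 sE] : P n != 0 by rewrite -size_poly_eq0 sP.
  by exists (Num.sqrt s); rewrite sqrtr_gt0 sqr_sqrtr// ltW.
have [s {}hs] := choice hs.
have s0 n : (s n)%:C != 0 :> R[i].
  by have [h _] := hs n; rewrite -nc_eq0 ncr normr_eq0 gt_eqF.
have sc0 n : (s n)^-1%:C != 0 :> R[i] by rewrite fmorphV/= invr_eq0.
exists (fun n => (s n)^-1%:C *: P n).
have orth n : orthogonal_to_lower n ((s n)^-1%:C *: P n).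
  by move=> r rn; have [_ _ oP] := hP n; rewrite ipZl oP// mulr0.
split; [|split] => // [n|n m].
  have [sP lP _] := hP n; have [h _] := hs n.
  rewrite size_scale// lead_coefZ lP mulr1; split => //.
  by rewrite ltcR invr_gt0.
have [nm|mn|<-] := ltngtP n m.
- rewrite ip_sym orth ?conjc0//; have [sP _ _] := hP n.
  by rewrite size_scale// sP.
- by rewrite orth//; have [sP _ _] := hP m; rewrite size_scale// sP.
- have [h hE] := hs n; rewrite ipZl ipZr hE conjc_real -!rmorphM.
  have -> : (s n)^-1 * ((s n)^-1 * s n ^+ 2) = 1 by field; rewrite gt_eqF.
  by [].
Qed.

Lemma orthogonal_unique n p q : size p = n.+1 -> size q = n.+1 ->
  orthogonal_to_lower n p -> orthogonal_to_lower n q ->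
  exists c, p = c *: q.
Proof.
move=> sp sq op oq.
have lq : lead_coef q != 0 by rewrite lead_coef_eq0 -size_poly_eq0 sq.
pose c := lead_coef p / lead_coef q; exists c.
have h : (size (p - c *: q)%R <= n)%N.
  apply/leq_sizeP => j mj; rewrite coefB coefZ.
  have [->|jm] := eqVneq j n.
    by rewrite /c !lead_coefE sp sq /= divfK ?subrr//; move: lq; rewrite lead_coefE sq.
  have mj' : (n < j)%N by rewrite ltn_neqAle eq_sym jm.
  by rewrite !nth_default ?sp ?sq// mulr0 subrr.
have e r : (size r <= n)%N -> ip (p - c *: q) r = 0.
  by move=> rn; rewrite ipDl -scaleNr ipZl op// oq// mulr0 addr0.
apply/eqP; rewrite -subr_eq0; apply/negPn/negP => /ip_pos[s s0].
rewrite e// => /esym/eqP.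
by rewrite -nc_eq0 ncr normr_eq0 gt_eqF.
Qed.

End GramSchmidt.

Section WeightedInnerProduct.
Context {R : realType}.
Implicit Types (p q : {poly R[i]}).
Variables (v : R -> R) (b : R).
Hypotheses (cv : continuous v) (b0 : 0 < b) (vb : forall t, b <= v t).

Definition weighted_ip p q : R[i] := cint (fun t => p.[expi t] * (q.[expi t])^* * (v t)%:C).

Let ccont_weighted_ip p q : ccont (fun t => p.[expi t] * (q.[expi t])^* * (v t)%:C).
Proof.
apply: ccontM; last exact: ccont_r.
by apply: ccontM; [exact: ccont_horner|apply: ccontJ; exact: ccont_horner].
Qed.

Lemma weighted_ip_lin (c : R[i]) p q r : weighted_ip (c *: p + q) r = c * weighted_ip p r + weighted_ip q r.
Proof.
rewrite /weighted_ip -cintZ// -cintD//; first last.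
  by apply: ccontM; [exact: ccont_cst|exact: ccont_weighted_ip].
by congr cint; apply/funext => t; rewrite hornerD hornerZ; ring.
Qed.

Lemma weighted_ip_sym p q : weighted_ip q p = (weighted_ip p q)^*.
Proof.
rewrite /weighted_ip -cintJ//; congr cint; apply/funext => t.
by rewrite !conjcM conjcK conjc_real; ring.
Qed.

Lemma weighted_ip_self p : weighted_ip p p = (rint (fun t => nc p.[expi t] ^+ 2 * v t))%:C.
Proof.
by rewrite -cint_r; congr cint; apply/funext => t; rewrite mulcJ [RHS]rmorphM.
Qed.

Lemma cint_monomials (j k : nat) :
  cint (fun t : R => expi t ^+ j * (expi t ^+ k)^*) = ((2 * pi) * (j == k)%:R)%:C.
Proof.
have zz t n : expi t ^+ n * (expi t ^+ n)^* = 1 :> R[i].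
  by rewrite conjcX -exprMn circle_mulJ ?nc_expi ?expr1n.
have [jk|kj|<-] := ltngtP j k; rewrite ?mulr0 ?mulr1.
- have -> : (fun t : R => expi t ^+ j * (expi t ^+ k)^*) = (fun t => (expi t ^+ (k - j))^*).
    apply/funext => t; have -> : expi t ^+ k = expi t ^+ j * expi t ^+ (k - j).
      by rewrite -exprD subnKC// ltnW.
    by rewrite conjcM mulrA zz mul1r.
  rewrite cintJ ?cint_expiX ?subn_gt0// ?conjc0//.
  by apply: ccontX; exact: ccont_expi.
- have -> : (fun t : R => expi t ^+ j * (expi t ^+ k)^*) = (fun t => expi t ^+ (j - k)).
    apply/funext => t; have -> : expi t ^+ j = expi t ^+ (j - k) * expi t ^+ k.
      by rewrite -exprD subnK// ltnW.
    by rewrite -mulrA zz mulr1.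
  by rewrite cint_expiX ?subn_gt0.
- under [X in cint X]eq_fun do rewrite zz.
  by rewrite -[RHS]mul1r; apply: complex_eq => /=; rewrite rint_cst; ring.
Qed.

(** Parseval's identity. *)
Lemma rint_horner2 p :
  rint (fun t => nc p.[expi t] ^+ 2) = 2 * pi * \sum_(k < size p) nc p`_k ^+ 2.
Proof.
apply: (@complexI R); rewrite -cint_r.
have cX n : ccont (fun t : R => expi t ^+ n) by apply: ccontX; exact: ccont_expi.
have -> : (fun t : R => (nc p.[expi t] ^+ 2)%:C) =
  (fun t => \sum_(j < size p) \sum_(k < size p)
     (p`_j * (p`_k)^*) * (expi t ^+ j * (expi t ^+ k)^*)).
  apply/funext => t; rewrite -mulcJ horner_coef rmorph_sum mulr_suml.
  apply: eq_bigr => j _; rewrite mulr_sumr; apply: eq_bigr => k _.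
  by rewrite rmorphM/=; ring.
have cc (j k : nat) : ccont (fun t : R => expi t ^+ j * (expi t ^+ k)^*).
  by apply: ccontM => //; exact: ccontJ.
have cs (n j : nat) : ccont (fun t : R => \sum_(k < n) (p`_j * (p`_k)^*) * (expi t ^+ j * (expi t ^+ k)^*)).
  elim: n => [|n IH].
    by under [X in ccont X]eq_fun do rewrite big_ord0; exact: ccont_cst.
  under [X in ccont X]eq_fun do rewrite big_ord_recr /=.
  by apply: ccontD => //; apply: ccontM => //; exact: ccont_cst.
rewrite cint_sum//.
rewrite mulr_sumr rmorph_sum; apply: eq_bigr => j _.
rewrite cint_sum; last by move=> k; apply: ccontM => //; exact: ccont_cst.
rewrite (bigD1 j)//= big1 => [|k kj].
  rewrite cintZ// cint_monomials eqxx mulr1 addr0 mulcJ -rmorphM; congr (_%:C); ring.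
by rewrite cintZ// cint_monomials eq_sym val_eqE (negbTE kj) mulr0 mulr0.
Qed.

Lemma weighted_ip_pos p : p != 0 -> exists2 s : R, 0 < s & weighted_ip p p = s%:C.
Proof.
move=> p0; rewrite weighted_ip_self; eexists; last by [].
have cn : continuous (fun t => nc p.[expi t] ^+ 2).
  by apply: continuous_nc2; exact: ccont_horner.
apply: (@lt_le_trans _ _ (b * rint (fun t => nc p.[expi t] ^+ 2))).
  rewrite mulr_gt0// rint_horner2 !mulr_gt0// ?pi_gt0//.
  have sp : (0 < size p)%N by rewrite lt0n size_poly_eq0.
  have lt1 : ((size p).-1 < size p)%N by rewrite prednK.
  rewrite (bigD1 (Ordinal lt1))//= ltr_pwDl//.
    by rewrite exprn_gt0// nc_gt0 -lead_coefE lead_coef_eq0.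
  by apply: sumr_ge0 => k _; rewrite sqr_ge0.
rewrite -rintZ//; apply: ler_rint.
- exact: continuousMcr.
- exact: continuousMr.
- by move=> t; rewrite mulrC ler_wpM2l ?sqr_ge0.
Qed.

End WeightedInnerProduct.

(** * The measure with a given density *)

Section Density.
Context {R : realType}.
Notation leb := (@lebesgue_measure R).
Variable v : R -> R.
Hypotheses (cv : continuous v) (v_ge0 : forall t, 0 <= v t) (v1 : rint v = 1).

Definition circle_density : measurableTypeR R -> R := v \_ (circle R).

Definition circle_measure (A : set (measurableTypeR R)) : \bar R :=
  (\int[leb]_(t in A) (circle_density t)%:E)%E.

Lemma circle_density_ge0 t : 0 <= circle_density t.
Proof. by rewrite /circle_density patchE; case: ifP. Qed.

Lemma circle_density_integrable : integrable leb setT (EFin \o circle_density).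
Proof.
have := circle_integrable cv.
rewrite integrable_mkcond; last exact: measurable_circle.
by rewrite /circle_density restrict_EFin.
Qed.

Lemma measurable_circle_density : measurable_fun setT circle_density.
Proof.
have /measurable_int := circle_density_integrable.
by move=> /measurable_EFinP.
Qed.

Let circle_measure0 : circle_measure set0 = 0%E.
Proof. by rewrite /circle_measure integral_set0. Qed.

Let circle_measure_ge0 A : (0 <= circle_measure A)%E.
Proof. by apply: integral_ge0 => t _; rewrite lee_fin circle_density_ge0. Qed.

Let circle_measure_sigma_additive : semi_sigma_additive circle_measure.
Proof.
move=> /= A mA tA mUA.
rewrite /circle_measure/= integral_bigcup//=; last first.
  by apply: (integrableS _ _ (subsetT _)) => //; exact: circle_density_integrable.
apply: is_cvg_ereal_nneg_natsum_cond => n _ _.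
by apply: integral_ge0 => /= x ?; rewrite lee_fin circle_density_ge0.
Qed.

HB.instance Definition _ := isMeasure.Build _ _ _
  circle_measure circle_measure0 circle_measure_ge0 circle_measure_sigma_additive.

Let integral_circle_density : (\int[leb]_(t in circle R) (circle_density t)%:E = 1)%E.
Proof.
have h := circle_integrable cv.
rewrite -[RHS]/((1 : R)%:E) -v1 /rint /Rintegral fineK; last first.
  by apply: integrable_fin_num => //; exact: measurable_circle.
apply: eq_integral => t tc.
by rewrite /circle_density patchE tc.
Qed.

Let circle_measure_setT : circle_measure setT = 1%E.
Proof.
rewrite /circle_measure -integral_circle_density [RHS]integral_mkcond.
apply: eq_integral => t _; rewrite patchE /circle_density patchE.
by case: ifP.
Qed.

HB.instance Definition _ :=
  @Measure_isProbability.Build _ _ R circle_measure circle_measure_setT.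

Definition circle_prob : probability (measurableTypeR R) R := circle_measure.

Lemma circle_prob_circle : circle_prob (circle R) = 1%E.
Proof. exact: integral_circle_density. Qed.

Lemma circle_measure_dominates : circle_measure `<< leb.
Proof.
apply/null_content_dominatesP => A mA muA0; rewrite /circle_measure.
apply: null_set_integral => //.
apply: measurable_funTS; apply/measurable_EFinP; exact: measurable_circle_density.
Qed.

(** The density is a Radon-Nikodym derivative, and such derivatives are unique up to null
    sets. *)
Lemma circle_measure_integral (f : measurableTypeR R -> \bar R) (U : set (measurableTypeR R)) :
  measurable U -> integrable circle_measure U f ->
  (\int[circle_measure]_(x in U) f x =
   \int[leb]_(x in U) (f x * (circle_density x)%:E))%E.
Proof.
move=> mU finf; have mf := measurable_int _ finf.
have md : measurable_fun setT (EFin \o circle_density).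
  by apply/measurable_EFinP; exact: measurable_circle_density.
rewrite -(Radon_Nikodym_change_of_variables circle_measure_dominates)//=.
apply: ae_eq_integral => //.
- apply: emeasurable_funM => //; apply: (measurable_int leb).
  apply: (integrableS _ _ (@subsetT _ _)) => //=.
  by apply: Radon_Nikodym_integrable; exact: circle_measure_dominates.
- by apply: emeasurable_funM => //=; exact: measurable_funTS.
- apply: ae_eqe_mul2l => /=.
  rewrite Radon_NikodymE//=; first exact: circle_measure_dominates.
  move=> abmu.
  case: cid => /= h [h1 h2 h3].
  apply: integral_ae_eq => //=.
  + exact: integrableS h2.
  + exact: measurable_funTS.
  + by move=> E E01 mE; rewrite -h3.
Qed.

Lemma circle_prob_Rintegral (u : R -> R) M : continuous u -> (forall t, `|u t| <= M) ->
  Rintegral circle_prob (circle R) u = rint (fun t => u t * v t).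
Proof.
move=> cu uM; rewrite /Rintegral circle_measure_integral.
- congr fine; apply: eq_integral => t tc.
  by rewrite /circle_density patchE tc EFinM.
- exact: measurable_circle.
- apply: measurable_bounded_integrable.
  + exact: measurable_circle.
  + apply: (@le_lt_trans _ _ (circle_prob setT)).
      by apply: le_measure; rewrite ?inE//; exact: measurable_circle.
    by rewrite probability_setT ltry.
  + apply: measurable_funTS; exact: continuous_measurable_fun.
  + exists M; split; first by rewrite num_real.
    by move=> x Mx t _; apply: le_trans (uM t) (ltW Mx).
Qed.

Lemma circle_prob_steklov delta :
  (forall t, delta / (2 * pi) <= v t) -> steklov delta circle_prob.
Proof.
move=> vd; split; first exact: circle_prob_circle.
exists circle_density.
  split; [exact: measurable_circle_density|exact: circle_density_ge0|].
  exists (@mzero _ (measurableTypeR R) R).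
    by exists setT; split; [exact: measurableT|by []|by rewrite setCT measure0].
  by move=> A mA; rewrite /mzero adde0.
apply/nearW => t tc; rewrite /circle_density patchE mem_set//.
Qed.

End Density.

(** * The supremum norm *)

(** By continuity the inequality persists on an interval around the angle 0, which has
    positive measure. *)
Lemma circle_Linfty_gt {R : realType} (p : {poly R[i]}) (A : R) :
  A < nc p.[1] -> (A%:E < circle_Linfty p)%E.
Proof.
move=> Ap; rewrite /circle_Linfty unlock.
set mu := mrestr _ _.
have p0 := @pi_gt0 R.
have muE (B : set (measurableTypeR R)) : mu B = lebesgue_measure (B `&` circle R)%classic by [].
have muT : (0 < mu setT)%E by rewrite muE setTI lebesgue_circle lte_fin mulr_gt0.
rewrite muT ltNge; apply/negP => /ess_supP [B [mB B0 hB]].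
have cn : continuous (fun t : R => nc p.[expi t] ^+ 2).
  by apply: continuous_nc2; exact: ccont_horner.
have [d d0 hd] : exists2 d : R, 0 < d & forall t, `|t| < d -> A < nc p.[expi t].
  have [A0|A0] := ltP A 0.
    by exists 1 => // t _; apply: lt_le_trans A0 (nc_ge0 _).
  have := cn 0 => /cvgrPdist_lt /(_ (nc p.[1] ^+ 2 - A ^+ 2)) [].
    by rewrite subr_gt0 ltrXn2r// nnegrE nc_ge0.
  move=> d /= d0 hd; exists d => // t td.
  have := hd t; rewrite /ball_ /= sub0r normrN => /(_ td).
  rewrite expi0 => /(le_lt_trans (ler_norm _)).
  rewrite ltrBlDr addrC -ltrBlDr subKr => h.
  by rewrite -(@ltr_pXn2r _ 2)// nnegrE nc_ge0.
pose e := Num.min d pi.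
have e0 : 0 < e by rewrite lt_min d0.
have ed : e <= d by rewrite ge_min lexx.
have ep : e <= pi by rewrite ge_min lexx orbT.
pose I : set (measurableTypeR R) := `]- e, e[%classic.
have sub : (I `<=` B `&` circle R)%classic.
  move=> t; rewrite /I /= in_itv /= => /andP[t1 t2]; split; last first.
    by rewrite /circle /= in_itv /=; apply/andP; split; lra.
  apply: hB => /= h; move: h; apply/negP; rewrite -ltNge lte_fin.
  rewrite ger0_norm ?nc_ge0//; apply: hd; rewrite ltr_norml; lra.
have : (lebesgue_measure I <= mu B)%E.
  rewrite muE; apply: le_measure => //; rewrite inE.
    exact: measurable_itv.
  by apply: measurableI => //; exact: measurable_circle.
rewrite (B0 : mu B = 0%E) /I lebesgue_measure_itv /= lte_fin ifT; last by lra.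
rewrite -EFinD lee_fin; lra.
Qed.

(** * From a weight and an orthogonal polynomial to the Steklov supremum *)

(** After division by its total mass the weight is a density in the Steklov class, and [p]
    is a multiple of the orthonormal polynomial of degree [N] because both are orthogonal
    to the lower powers. *)
Lemma steklov_sup_gt {R : realType} (delta A : R) (N : nat) (w : R -> R) (p : {poly R[i]}) :
  0 < delta -> continuous w -> 0 < rint w ->
  (forall t, delta * rint w <= 2 * pi * w t) ->
  size p = N.+1 ->
  (forall k, (k < N)%N ->
    cint (fun t => p.[expi t] * (expi t ^+ k)^* * (w t)%:C) = 0) ->
  0 <= A ->
  A ^+ 2 * rint (fun t => nc p.[expi t] ^+ 2 * w t) < nc p.[1] ^+ 2 * rint w ->
  (A%:E < steklov_sup N delta)%E.
Proof.
move=> delta0 cw Z0 wd sp po A0 pA; have p0 := @pi_gt0 R.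
pose Z := rint w; pose v t := Z^-1 * w t.
have cv : continuous v by exact: continuousMcr.
have v1 : rint v = 1 by rewrite rintZ// mulVf// gt_eqF.
have vd t : delta / (2 * pi) <= v t.
  rewrite /v [leRHS]mulrC ler_pdivlMr// mulrAC ler_pdivrMr ?mulr_gt0//.
  by rewrite [leRHS]mulrC; exact: wd.
have b0 : 0 < delta / (2 * pi) by rewrite divr_gt0// mulr_gt0.
have v0 t : 0 <= v t by apply: le_trans (vd t); exact: ltW.
have [phi [phi1 [phi2 phi3]]] :=
  exists_orthonormal (weighted_ip_lin cv) (@weighted_ip_sym _ _ cv) (weighted_ip_pos cv b0 vd).
have onp : orthonormal_polys (circle_prob cv v0 v1) phi.
  split => // n m; rewrite -phi2.
  have [M1 M10 hM1] := poly_circle_bounded (phi n).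
  have [M2 M20 hM2] := poly_circle_bounded (phi m).
  have cU : ccont (fun t => (phi n).[expi t] * ((phi m).[expi t])^*).
    by apply: ccontM; [exact: ccont_horner|apply: ccontJ; exact: ccont_horner].
  have UM t : nc ((phi n).[expi t] * ((phi m).[expi t])^*) <= M1 * M2.
    by rewrite ncM ncJ; apply: ler_pM; rewrite ?nc_ge0.
  rewrite /weighted_ip /circle_integral /cint; apply: complex_eq => /=.
    rewrite (@circle_prob_Rintegral _ _ cv v0 v1 _ (M1 * M2)); last 2 first.
    - by have [] := cU.
    - by move=> t; apply: le_trans (norm_re_le _) (UM t).
    by congr rint; apply/funext => t; rewrite [in RHS]mulrC reMr mulrC.
  rewrite (@circle_prob_Rintegral _ _ cv v0 v1 _ (M1 * M2)); last 2 first.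
  - by have [] := cU.
  - by move=> t; apply: le_trans (norm_im_le _) (UM t).
  by congr rint; apply/funext => t; rewrite [in RHS]mulrC imMr mulrC.
have op : orthogonal_to_lower (weighted_ip v) N p.
  apply: (@orthogonal_to_lowerP _ _ (weighted_ip_lin cv) (@weighted_ip_sym _ _ cv) _ _ (fun k => 'X^k)) => k kN.
  split; first by rewrite size_polyXn.
  rewrite /weighted_ip; have := po k kN.
  have -> : (fun t => p.[expi t] * ('X^k).[expi t]^* * (v t)%:C) =
    (fun t => Z^-1%:C * (p.[expi t] * (expi t ^+ k)^* * (w t)%:C)).
    by apply/funext => t; rewrite hornerXn /v rmorphM/=; ring.
  rewrite cintZ => [->|]; first by rewrite mulr0.
  apply: ccontM; last exact: ccont_r.
  apply: ccontM; first exact: ccont_horner.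
  by apply: ccontJ; apply: ccontX; exact: ccont_expi.
have [sphi _] := phi1 N.
have [c pc] := orthogonal_unique (weighted_ip_lin cv) (weighted_ip_pos cv b0 vd)
  sp sphi op (phi3 N).
have hc : Z^-1 * rint (fun t => nc p.[expi t] ^+ 2 * w t) = nc c ^+ 2.
  have h : rint (fun t => nc (phi N).[expi t] ^+ 2 * v t) = 1.
    by apply: (@complexI R); rewrite -weighted_ip_self phi2 eqxx.
  rewrite -rintZ; last by apply: continuousMr => //; apply: continuous_nc2; exact: ccont_horner.
  rewrite -[RHS]mulr1 -h -rintZ; last first.
    by apply: continuousMr => //; apply: continuous_nc2; exact: ccont_horner.
  congr rint; apply/funext => t; rewrite pc hornerZ ncM exprMn /v; ring.
have Aphi : A < nc (phi N).[1].
  rewrite -(@ltr_pXn2r _ 2)// ?nnegrE ?nc_ge0//.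
  have c0 : 0 < nc c ^+ 2.
    rewrite exprn_gt0// nc_gt0; apply/eqP => c0.
    by move: sp; rewrite pc c0 scale0r size_poly0.
  rewrite -(ltr_pM2l c0) -(ltr_pM2r Z0) -[X in _ < X]/(_ * Z).
  have -> : nc c ^+ 2 * nc (phi N).[1] ^+ 2 * Z = nc p.[1] ^+ 2 * Z.
    by rewrite pc hornerZ ncM exprMn.
  rewrite -hc; apply: le_lt_trans pA; rewrite le_eqVlt; apply/orP; left; apply/eqP.
  by rewrite /Z; field; rewrite gt_eqF.
apply: lt_le_trans (circle_Linfty_gt Aphi) _.
apply: ereal_sup_ubound; exists (circle_prob cv v0 v1), phi; split => //.
exact: circle_prob_steklov.
Qed.

(** * A polynomial that is small near 1 *)

(** The function [1 - (1 - c0) V], where [V = s / (1 - rho z)] and [s = 1 - rho], has all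
    the properties with [eta = 0] except for the last one: [V] and [1 - V] have modulus at
    most 1 on the circle, and [V] is close to 1 near the point 1 and small away from it if
    [s] is small. Truncating the geometric series of [V] after [J] terms changes it by at
    most [rho^J]. *)
Lemma exists_dip {R : realType} (c0 eta tau : R) :
  0 < c0 -> c0 < 1 -> 0 < eta -> 0 < tau ->
  exists (h : {poly R[i]}) (kappa : R), 0 < kappa /\
   forall z, nc z = 1 ->
    [/\ nc h.[z] <= 1 + eta, c0 / 2 <= re h.[z],
        nc (1 - z) <= kappa -> nc h.[z] <= 3 * c0 &
        tau <= nc (1 - z) -> nc (1 - h.[z]) <= eta].
Proof.
move=> c00 c01 eta0 tau0.
pose s : R := Num.min 2^-1 (tau * eta / (2 + eta)).
have s0 : 0 < s.
  by rewrite lt_min invr_gt0 ltr0n /= divr_gt0// ?mulr_gt0//; lra.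
have s1 : s <= 2^-1 by rewrite ge_min lexx.
have s2 : s * (2 + eta) <= tau * eta.
  by rewrite -ler_pdivlMr ?ge_min ?lexx ?orbT//; lra.
pose rho : R := 1 - s.
have rho0 : 0 <= rho by rewrite /rho; lra.
have rho1 : rho < 1 by rewrite /rho; lra.
have [J hJ] : exists J, rho ^+ J <= Num.min eta (c0 / 2).
  apply: exists_expr_le => //; rewrite lt_min eta0/=; lra.
have Jeta : rho ^+ J <= eta by apply: le_trans hJ _; rewrite ge_min lexx.
have Jc0 : rho ^+ J <= c0 / 2 by apply: le_trans hJ _; rewrite ge_min lexx orbT.
have J1 : rho ^+ J <= 1 by lra.
have J0 : 0 <= rho ^+ J by rewrite exprn_ge0.
pose a : R := 1 - c0.
exists (1 - (a * s)%:C *: (dirichlet J \Po (rho%:C *: 'X))), (c0 * s).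
split => [|z z1]; first by rewrite mulr_gt0.
pose U := s%:C * (dirichlet J).[rho%:C * z].
have -> : (1 - (a * s)%:C *: (dirichlet J \Po (rho%:C *: 'X))).[z] = 1 - a%:C * U.
  by rewrite hornerD hornerN hornerC hornerZ horner_comp hornerZ hornerX /U [(a * s)%:C]rmorphM/= -mulrA.
pose V := s%:C / (1 - rho%:C * z).
have zr : nc (rho%:C * z) = rho by rewrite ncMr// z1 mulr1.
have den : s <= nc (1 - rho%:C * z).
  have := ncD (1 - rho%:C * z) (rho%:C * z); rewrite subrK nc1 zr /rho; lra.
have den0 : 1 - rho%:C * z != 0 by rewrite -nc_gt0; lra.
have V1 : nc V <= 1.
  by rewrite /V ncM ncV ncr ger0_norm ?(ltW s0)// ler_pdivrMr ?mul1r//; lra.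
have UV : U = V - V * (rho%:C * z) ^+ J.
  have hV : (1 - rho%:C * z) * V = s%:C by rewrite /V mulrC divfK.
  apply: (mulfI den0); rewrite /U mulrCA dirichlet_geo.
  have -> (x y r : R[i]) : x * (r - r * y) = x * r * (1 - y) by ring.
  by rewrite hV.
have UV' : nc (U - V) <= rho ^+ J.
  rewrite UV addrAC subrr add0r ncN ncM ncX zr.
  by rewrite -[leRHS]mul1r ler_wpM2r.
have oneV : 1 - V = rho%:C * (1 - z) / (1 - rho%:C * z).
  apply: (mulIf den0); rewrite divfK// mulrBl divfK// mul1r /rho.
  by rewrite rmorphB /= rmorph1; ring.
have V2 : nc (1 - V) <= 1.
  rewrite oneV ncM ncV ler_pdivrMr ?mul1r; last by lra.
  rewrite -(@ler_pXn2r _ 2)// ?nnegrE ?nc_ge0// !sqr_nc !(reB, imB, reMr, imMr) /=.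
  have := sqr_nc z; rewrite z1 expr1n => zz.
  have := re_le z; rewrite z1.
  move: zz; move: (re z) (im z) => x y zz x1.
  have e1 : (rho * (1 - x)) ^+ 2 + (rho * (0 - y)) ^+ 2 = rho ^+ 2 * (2 - 2 * x).
    have -> : 2 - 2 * x = 1 - 2 * x + 1 by ring.
    by rewrite [X in _ = _ * (_ + X)]zz; ring.
  have e2 : (1 - rho * x) ^+ 2 + (0 - rho * y) ^+ 2 = 1 - 2 * rho * x + rho ^+ 2.
    by rewrite -[X in _ = _ + X]mulr1 [X in _ = _ + _ * X]zz; ring.
  rewrite e1 e2.
  have : 0 <= (1 - rho) * (1 + rho - 2 * rho * x).
    rewrite mulr_ge0 ?subr_ge0//; first by lra.
    have : rho * x <= rho * 1 by rewrite ler_wpM2l.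
    lra.
  lra.
have a0 : 0 <= a by rewrite /a; lra.
have a1 : a <= 1 by rewrite /a; lra.
have hE : 1 - a%:C * U = c0%:C + (a%:C * (1 - V) - a%:C * (U - V)).
  rewrite /a rmorphB /= rmorph1; ring.
have aUV : a * nc (U - V) <= rho ^+ J.
  by rewrite -[leRHS]mul1r; apply: ler_pM; rewrite ?nc_ge0.
have hle : nc (1 - a%:C * U) <= c0 + a * nc (1 - V) + rho ^+ J.
  rewrite hE (le_trans (ncD _ _))// ncr ger0_norm ?(ltW c00)// -addrA lerD2l.
  by rewrite (le_trans (ncB _ _))// !ncMr// lerD2l.
split.
- have : a * nc (1 - V) <= a * 1 by rewrite ler_wpM2l.
  by rewrite /a; rewrite /a in hle; lra.
- rewrite reB reMr /=.
  have : re U <= 1 + rho ^+ J.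
    have := re_le U; have := ncD (U - V) V; rewrite subrK; lra.
  move=> h; have : a * re U <= a * (1 + rho ^+ J) by rewrite ler_wpM2l.
  have : a * rho ^+ J <= 1 * rho ^+ J by rewrite ler_wpM2r.
  by rewrite /a; lra.
- move=> zk; have : nc (1 - V) <= c0.
    rewrite oneV ncM ncV ler_pdivrMr; last by lra.
    rewrite ncMr//.
    have h1 : rho * nc (1 - z) <= 1 * nc (1 - z) by rewrite ler_wpM2r ?nc_ge0 ?ltW.
    have h2 : c0 * s <= c0 * nc (1 - rho%:C * z) by rewrite ler_wpM2l// ltW.
    lra.
  move=> h; have : a * nc (1 - V) <= 1 * c0 by apply: ler_pM; rewrite ?nc_ge0.
  lra.
- move=> zt; rewrite opprB addrCA subrr addr0 ncMr//.
  have U2 : nc U <= 2 * nc V.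
    have -> : U = V * (1 - (rho%:C * z) ^+ J) by rewrite UV; ring.
    rewrite ncM mulrC ler_wpM2r ?nc_ge0// (le_trans (ncB _ _))// nc1 ncX zr; lra.
  have den2 : tau - s <= nc (1 - rho%:C * z).
    have -> : 1 - rho%:C * z = (1 - z) + s%:C * z.
      by rewrite /rho rmorphB /= rmorph1; ring.
    have := ncDl (1 - z) (s%:C * z); rewrite [nc (s%:C * z)]ncMr ?(ltW s0)// z1; lra.
  have : 2 * nc V <= eta.
    rewrite /V ncM ncV ncr ger0_norm ?(ltW s0)// mulrA ler_pdivrMr; last by lra.
    have : eta * (tau - s) <= eta * nc (1 - rho%:C * z) by rewrite ler_wpM2l// ltW.
    lra.
  have : a * nc U <= 1 * nc U by rewrite ler_wpM2r ?nc_ge0.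
  lra.
Qed.

(** * Two-sided bounds for the weight *)

Section WeightBounds.
Context {R : realType}.
Variables (N : nat) (f g : {poly R[i]}) (e : R).
Hypotheses (sg : (size g <= N)%N) (sfg : (size (f * g)%R <= N)%N).
Hypotheses (e_gt0 : 0 < e) (f_re : forall t, e <= re f.[expi t]).
Hypotheses (g_neq0 : forall t, g.[expi t] != 0).
Variable t : R.

Let F := f.[expi t].
Let G := g.[expi t].
Let w := weight N f g t.

Let F0 : 0 < re F. Proof. exact: lt_le_trans (f_re t). Qed.
Let G0 : 0 < nc G. Proof. by rewrite nc_gt0 g_neq0. Qed.

Lemma weight_den : w * nc (denom N f g).[expi t] ^+ 2 = re F.
Proof.
rewrite /w /weight divfK// expf_neq0// nc_eq0.
exact: (denom_neq0 sg sfg e_gt0 f_re g_neq0).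
Qed.

Let w0 : 0 < w. Proof. exact: (weight_gt0 sg sfg e_gt0 f_re g_neq0). Qed.

Lemma weight_lower : re F <= w * (2 * nc G * (nc F + `|im F|)) ^+ 2.
Proof.
rewrite -weight_den ler_wpM2l ?(ltW w0)// lerXn2r ?nnegrE ?nc_ge0//.
  by rewrite !mulr_ge0 ?addr_ge0 ?nc_ge0.
exact: denom_le.
Qed.

Lemma weight_upper : w * (2 * nc G * (nc F - `|im F|)) ^+ 2 <= re F.
Proof.
rewrite -[leRHS]weight_den ler_wpM2l ?(ltW w0)// lerXn2r ?nnegrE ?nc_ge0//.
  by rewrite !mulr_ge0 ?subr_ge0 ?nc_ge0// norm_im_le.
exact: denom_ge.
Qed.

Lemma weight_lower_crude : re F <= 16 * w * (nc G ^+ 2 * nc F ^+ 2).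
Proof.
apply: le_trans weight_lower _.
have -> : 16 * w * (nc G ^+ 2 * nc F ^+ 2) = w * (2 * nc G * (nc F + nc F)) ^+ 2 by ring.
rewrite ler_wpM2l ?(ltW w0)// lerXn2r ?nnegrE ?mulr_ge0 ?addr_ge0 ?nc_ge0//.
by rewrite ler_wpM2l ?mulr_ge0 ?nc_ge0// lerD2l norm_im_le.
Qed.

(** Here [|f| - |im f| >= (re f)^2 / (2 |f|)]. *)
Lemma weight_upper_crude : w * (nc G ^+ 2 * re F ^+ 3) <= nc F ^+ 2.
Proof.
have n0 : 0 < nc F by apply: lt_le_trans F0 (re_le _).
have h : re F ^+ 2 <= 2 * (nc F - `|im F|) * nc F.
  have := sqr_nc F; have i1 := norm_im_le F.
  have -> : im F ^+ 2 = `|im F| ^+ 2 by rewrite real_normK ?num_real.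
  have := normr_ge0 (im F).
  move: i1; move: (nc F) (re F) (`|im F|) => n x y yn y0 E.
  have : (n - y) * (n + y) <= (n - y) * (2 * n) by rewrite ler_wpM2l ?subr_ge0//; lra.
  have -> : (n - y) * (n + y) = n ^+ 2 - y ^+ 2 by ring.
  lra.
have h2 : (nc G * re F ^+ 2) ^+ 2 <= (2 * nc G * (nc F - `|im F|)) ^+ 2 * nc F ^+ 2.
  have q0 : 0 <= nc G * re F ^+ 2 by rewrite mulr_ge0 ?nc_ge0 ?sqr_ge0.
  have q1 : nc G * re F ^+ 2 <= 2 * nc G * (nc F - `|im F|) * nc F.
    have -> : 2 * nc G * (nc F - `|im F|) * nc F = nc G * (2 * (nc F - `|im F|) * nc F) by ring.
    by rewrite ler_wpM2l ?nc_ge0.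
  by rewrite -exprMn; apply: lerXn2r => //; rewrite nnegrE//; exact: le_trans q1.
have h3 : w * (nc G * re F ^+ 2) ^+ 2 <= re F * nc F ^+ 2.
  apply: le_trans (ler_wpM2l (ltW w0) h2) _.
  by rewrite mulrA ler_wpM2r ?sqr_ge0// weight_upper.
rewrite -(ler_pM2l F0); apply: le_trans h3.
by rewrite le_eqVlt; apply/orP; left; apply/eqP; ring.
Qed.

End WeightBounds.

(** * The construction *)

Section Construction.
Context {R : realType}.

Definition scale (m k : nat) : nat := (m * 2 ^ (10 * k))%N.

(** The polynomials whose values on the circle are given by [lacF] and [lacG]. *)
Definition lacFp m K : {poly R[i]} := (((2^-1 : R) ^+ K) ^+ 10)%:C%:P +
  \sum_(k < K.+1) (((2^-1 : R) ^+ k) ^+ 12)%:C *: (1 - fejer (scale m k)).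

Definition lacGp m K : {poly R[i]} := 1 +
  \sum_(k < K.+1) (((2 : R) ^+ k) ^+ 4)%:C *: fejer (scale m k) +
  (((2 : R) ^+ K) ^+ 5)%:C *: fejer (scale m K).

Lemma horner_lacFp m K z :
  (lacFp m K).[z] = lacF K (fun k => (fejer (scale m k)).[z]).
Proof.
rewrite /lacFp /lacF hornerD hornerC horner_sum; congr (_ + _).
by apply: eq_bigr => k _; rewrite hornerZ hornerD hornerN hornerC.
Qed.

Lemma horner_lacGp m K z :
  (lacGp m K).[z] = lacG K (fun k => (fejer (scale m k)).[z]).
Proof.
rewrite /lacGp /lacG !hornerD hornerC hornerZ horner_sum; congr (_ + _ + _).
by apply: eq_bigr => k _; rewrite hornerZ.
Qed.

Lemma scale_gt0 m k : (0 < m)%N -> (0 < scale m k)%N.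
Proof. by move=> m0; rewrite muln_gt0 m0 expn_gt0. Qed.

Lemma scale_le m k K : (k <= K)%N -> (scale m k <= scale m K)%N.
Proof. by move=> kK; rewrite leq_mul2l leq_exp2l// leq_mul2l kK !orbT. Qed.

Lemma natr_scale m k : (scale m k)%:R = ((2 : R) ^+ k) ^+ 10 * m%:R.
Proof. by rewrite natrM natrX mulrC mulnC exprM. Qed.

Lemma size_lacFp m K : (0 < m)%N -> (size (lacFp m K) <= scale m K)%N.
Proof.
move=> m0; have c1 k : (1 <= scale m k)%N by rewrite scale_gt0.
rewrite (leq_trans (size_polyD _ _))// geq_max (leq_trans (size_polyC_leq1 _))//=.
rewrite (leq_trans (size_sum _ _ _))//; apply/bigmax_leqP => k _.
rewrite (leq_trans (size_scale_leq _ _))// (leq_trans (size_polyD _ _))//.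
rewrite geq_max size_polyN (leq_trans (size_polyC_leq1 _))//=.
by rewrite (leq_trans (size_fejer _))// scale_le// -ltnS.
Qed.

Lemma size_lacGp m K : (0 < m)%N -> (size (lacGp m K) <= scale m K)%N.
Proof.
move=> m0; have c1 k : (1 <= scale m k)%N by rewrite scale_gt0.
rewrite (leq_trans (size_polyD _ _))// geq_max.
rewrite [X in _ && X](leq_trans (size_scale_leq _ _)) ?size_fejer// andbT.
rewrite (leq_trans (size_polyD _ _))// geq_max (leq_trans (size_polyC_leq1 _))//=.
rewrite (leq_trans (size_sum _ _ _))//; apply/bigmax_leqP => k _.
rewrite (leq_trans (size_scale_leq _ _))//.
by rewrite (leq_trans (size_fejer _))// scale_le// -ltnS.
Qed.

Variables (h : {poly R[i]}) (c0 eta tau kappa : R) (M l K N : nat).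
Hypotheses (c0_gt0 : 0 < c0) (c0_small : 144 * c0 ^+ 2 * lac_const <= 1).
Hypotheses (eta_gt0 : 0 < eta) (eta_le : eta <= 40^-1).
Hypotheses (kappa_gt0 : 0 < kappa) (kappa_tau : kappa <= tau).
Hypothesis dip : forall z, nc z = 1 ->
    [/\ nc h.[z] <= 1 + eta, c0 / 2 <= re h.[z],
        nc (1 - z) <= kappa -> nc h.[z] <= 3 * c0 &
        tau <= nc (1 - z) -> nc (1 - h.[z]) <= eta].
Hypotheses (M_gt0 : (0 < M)%N) (Mtau : M%:R * tau <= 2^-1).
Hypotheses (l_gt0 : (0 < l)%N) (l_large : 12 / eta <= (16 * l)%:R * kappa).
Hypothesis N_large : (size h + (scale (16 * l) K + scale (16 * l) K) <= N)%N.

Let m := (16 * l)%N.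
Let f : {poly R[i]} := lacFp m K.
Let G : {poly R[i]} := lacGp m K.
Let g : {poly R[i]} := h * G.
Let P : R := plateau K.
Let w := weight N f g.

Let m0 : (0 < m)%N. Proof. by rewrite muln_gt0. Qed.

Let y (t : R) : R := m%:R * nc (1 - expi t).
Let a (t : R) (k : nat) : R[i] := (fejer (scale m k)).[expi t].

Let y_ge0 t : 0 <= y t. Proof. by rewrite mulr_ge0// nc_ge0. Qed.
Let a_le1 t k : nc (a t k) <= 1.
Proof. by apply: nc_fejer_le1; [exact: scale_gt0|exact: nc_expi]. Qed.
Let a_re t k : 0 <= re (a t k).
Proof. by apply: re_fejer_ge0; [exact: scale_gt0|exact: nc_expi]. Qed.
Let a_near t k : nc (1 - a t k) <= ((2 : R) ^+ k) ^+ 10 * y t.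
Proof.
rewrite /y mulrA -natr_scale.
by apply: fejer_near1; [exact: scale_gt0|exact: nc_expi].
Qed.
Let a_far t k : ((2 : R) ^+ k) ^+ 10 * y t * nc (a t k) <= 4.
Proof.
rewrite /y mulrA -natr_scale.
by apply: fejer_far; [exact: scale_gt0|exact: nc_expi].
Qed.

Let fE t : f.[expi t] = lacF K (a t). Proof. exact: horner_lacFp. Qed.
Let GE t : G.[expi t] = lacG K (a t). Proof. exact: horner_lacGp. Qed.

Let eps : R := ((2^-1 : R) ^+ K) ^+ 10.
Let eps_gt0 : 0 < eps. Proof. by rewrite exprn_gt0// half_gt0. Qed.

Let f_re t : eps <= re f.[expi t].
Proof. by rewrite fE; exact: re_lacF_ge. Qed.

Let G_re t : 1 <= re G.[expi t].
Proof. by rewrite GE; exact: re_lacG_ge1. Qed.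

Let h_re t : c0 / 2 <= re h.[expi t].
Proof. by have [] := dip (nc_expi t). Qed.

Let c2_gt0 : 0 < c0 / 2. Proof. by rewrite divr_gt0. Qed.

Let g_neq0 t : g.[expi t] != 0.
Proof.
rewrite /g hornerM mulf_neq0// -nc_gt0.
  exact: lt_le_trans c2_gt0 (le_trans (h_re t) (re_le _)).
exact: lt_le_trans ltr01 (le_trans (G_re t) (re_le _)).
Qed.

Let gV : polylim (fun t => (g.[expi t])^-1).
Proof.
have := polylimM (polylimV_re c2_gt0 h_re (polylim_poly h))
  (polylimV_re ltr01 G_re (polylim_poly G)).
by congr polylim; apply/funext => t; rewrite /g hornerM invfM.
Qed.

Let sg : (size g <= N)%N.
Proof.
rewrite (leq_trans (size_polyMleq _ _))// (leq_trans (leq_pred _))//.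
rewrite (leq_trans _ N_large)// leq_add2l (leq_trans (size_lacGp _ m0))//.
exact: leq_addl.
Qed.

Let sfg : (size (f * g)%R <= N)%N.
Proof.
rewrite (leq_trans (size_polyMleq _ _))// (leq_trans (leq_pred _))//.
apply: leq_trans N_large; rewrite addnCA leq_add ?size_lacFp//.
rewrite (leq_trans (size_polyMleq _ _))// (leq_trans (leq_pred _))//.
by rewrite leq_add2l size_lacGp.
Qed.

Definition lac_f0 : R := eps +
  \sum_(k < K.+1) ((2^-1 : R) ^+ k) ^+ 12 * (1 - 2 / (scale m k).+1%:R).

Let f00 : f.[0] = lac_f0%:C.
Proof.
rewrite horner_lacFp /lacF /lac_f0 rmorphD/= rmorph_sum/=; congr (_ + _).
apply: eq_bigr => k _; rewrite fejer_at0 ?scale_gt0// [RHS]rmorphM; congr (_ * _).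
by rewrite [RHS]rmorphB rmorph1.
Qed.

Let f0_ge : 2^-1 <= lac_f0.
Proof.
have fj k : 2 / (scale m k).+1%:R <= 2^-1 :> R.
  rewrite ler_pdivrMr// -ler_pdivrMl ?invr_gt0// invrK.
  have -> : (2 : R) * 2 = 4%:R by ring.
  rewrite ler_nat (leq_trans (_ : 4 <= m.+1)%N) ?ltnS ?leq_pmulr ?expn_gt0//.
  by rewrite /m; case: (l) l_gt0 => // n _; rewrite mulnS.
rewrite /lac_f0 big_ord_recl /= expr0 expr1n mul1r.
have : 0 <= \sum_(i < K) ((2^-1 : R) ^+ bump 0 i) ^+ 12 * (1 - 2 / (scale m (bump 0 i)).+1%:R).
  apply: sumr_ge0 => i _; rewrite mulr_ge0 ?exprn_ge0 ?half_ge0// subr_ge0.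
  by apply: le_trans (fj _) _; lra.
move: (fj 0%N) eps_gt0; move: (\sum_(i < K) _) (2 / _) (eps) => S q e0.
lra.
Qed.

Let f0_gt0 : 0 < lac_f0. Proof. by have := f0_ge; lra. Qed.

Let P_bounds : 1 <= P <= 3. Proof. exact: plateau_bounds. Qed.

(** Off the arc of radius [kappa] the rescaled distance [y t] is at least [12 / eta]. *)
Let far_from_1 t : kappa <= nc (1 - expi t) ->
  nc (f.[expi t] - P%:C) <= eta /\ nc (G.[expi t] - 1) <= eta.
Proof.
move=> kt; have yt : 12 / eta <= y t.
  by apply: le_trans l_large _; rewrite /y ler_wpM2l.
have y0 : 0 < y t by apply: lt_le_trans yt; rewrite divr_gt0.
have h12 : 12 / y t <= eta.
  by rewrite ler_pdivrMr// mulrC -ler_pdivrMr.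
split; last by rewrite GE; apply: le_trans h12; exact: nc_lacG_far.
rewrite fE; apply: (@le_trans _ _ (8 / y t)); first exact: nc_lacF_plateau.
by apply: le_trans h12; rewrite ler_wpM2r ?invr_ge0 ?(ltW y0)//; lra.
Qed.

Let w_gt0 t : 0 < w t.
Proof. exact: (weight_gt0 sg sfg eps_gt0 f_re g_neq0). Qed.

(** In the next two lemmas [r], [x], [i], [n] and [W] are [re f], [|f|], [|im f|], [|g|] and
    [w] at a point where [f] and [g] are close to [P] and 1. All the errors are factors
    [1 + O(eta)], collected by Bernoulli's inequality. *)
Let plateau_lower (x r i : R) : 0 <= i <= eta -> P - eta <= r -> 0 <= x ->
  x <= P + eta -> forall W n, 0 <= n <= (1 + eta) ^+ 2 -> 0 < W ->
  r <= W * (2 * n * (x + i)) ^+ 2 -> 1 - 14 * eta <= 4 * P * W.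
Proof.
have e_le := eta_le; have e_gt := eta_gt0; have c_gt := c0_gt0.
move=> /andP[i0 ie] hr x0 xP W n /andP[n0 hn] W0 hW; have /andP[P1 P3] := P_bounds.
pose b : R := 1 + 2 * eta.
have b1 : 1 <= b by rewrite /b; lra.
have xi : x + i <= P * b.
  have : eta <= P * eta by rewrite ler_peMl// ltW.
  rewrite /b; lra.
have nb : n <= b ^+ 2.
  apply: le_trans hn _; rewrite lerXn2r ?nnegrE//; rewrite /b; lra.
have h1 : 2 * n * (x + i) <= 2 * b ^+ 2 * (P * b).
  apply: ler_pM => //; [by rewrite mulr_ge0|by rewrite addr_ge0|].
  by rewrite ler_wpM2l.
have h2 : r <= W * (2 * b ^+ 2 * (P * b)) ^+ 2.
  apply: le_trans hW _; rewrite ler_wpM2l ?(ltW W0)// lerXn2r ?nnegrE//.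
    by rewrite !mulr_ge0// addr_ge0.
  by rewrite !mulr_ge0// ?exprn_ge0//; lra.
have h3 : P * (1 - eta) <= r.
  have : eta <= P * eta by rewrite ler_peMl// ltW.
  lra.
have h4 : 1 - eta <= 4 * P * W * b ^+ 6.
  have P0 : 0 < P by lra.
  rewrite -(ler_pM2l P0); apply: le_trans h3 _; apply: le_trans h2 _.
  by rewrite le_eqVlt; apply/orP; left; apply/eqP; ring.
have e0 : 0 <= 1 - 2 * eta by lra.
have h5 : b ^+ 6 * (1 - 2 * eta) ^+ 6 <= 1.
  rewrite -exprMn exprn_ile1//; first by rewrite mulr_ge0//; lra.
  rewrite /b; have : 0 <= eta ^+ 2 by rewrite sqr_ge0.
  have -> : (1 + 2 * eta) * (1 - 2 * eta) = 1 - 4 * eta ^+ 2 by ring.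
  lra.
have h6 : 1 - 12 * eta <= (1 - 2 * eta) ^+ 6.
  have sq : 1 - 4 * eta <= (1 - 2 * eta) ^+ 2.
    have : 0 <= eta ^+ 2 by rewrite sqr_ge0.
    lra.
  have : (1 - 4 * eta) ^+ 3 <= ((1 - 2 * eta) ^+ 2) ^+ 3.
    by rewrite lerXn2r ?nnegrE ?sqr_ge0//; lra.
  rewrite -exprM; apply: le_trans.
  have : 0 <= eta ^+ 2 * (48 - 64 * eta).
    by rewrite mulr_ge0 ?sqr_ge0//; lra.
  have -> : (1 - 4 * eta) ^+ 3 = 1 - 12 * eta + eta ^+ 2 * (48 - 64 * eta) by ring.
  lra.
have q0 : 0 <= 4 * P * W by rewrite !mulr_ge0// ?ltW//; lra.
have h7 : (1 - eta) * (1 - 2 * eta) ^+ 6 <= 4 * P * W.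
  apply: (@le_trans _ _ (4 * P * W * b ^+ 6 * (1 - 2 * eta) ^+ 6)).
    by rewrite ler_wpM2r ?exprn_ge0.
  by rewrite -mulrA -[leRHS]mulr1 ler_wpM2l.
have : (1 - eta) * (1 - 12 * eta) <= (1 - eta) * (1 - 2 * eta) ^+ 6.
  by rewrite ler_wpM2l//; lra.
have : 0 <= eta ^+ 2 by rewrite sqr_ge0.
lra.
Qed.

Let plateau_upper (x r i : R) : 0 <= i <= eta -> r <= P + eta ->
  P - eta <= x -> forall W n, (1 - eta) ^+ 2 <= n -> 0 < W ->
  W * (2 * n * (x - i)) ^+ 2 <= r -> 4 * P * W <= 1 + 20 * eta.
Proof.
have e_le := eta_le; have e_gt := eta_gt0; have c_gt := c0_gt0.
move=> /andP[i0 ie] hr xP W n hn W0 hW; have /andP[P1 P3] := P_bounds.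
have Pe : eta <= P * eta by rewrite ler_peMl// ltW.
pose b : R := 1 - 2 * eta.
have b0 : 0 <= b by rewrite /b; lra.
have xi : P * b <= x - i by rewrite /b; lra.
have nb : b ^+ 2 <= n.
  apply: le_trans hn; rewrite lerXn2r ?nnegrE//; rewrite /b; lra.
have h1 : 2 * b ^+ 2 * (P * b) <= 2 * n * (x - i).
  apply: ler_pM => //; [by rewrite mulr_ge0// exprn_ge0|by rewrite mulr_ge0//; lra|].
  by rewrite ler_wpM2l.
have h2 : W * (2 * b ^+ 2 * (P * b)) ^+ 2 <= r.
  apply: le_trans hW; rewrite ler_wpM2l ?(ltW W0)//.
  have h0 : 0 <= 2 * b ^+ 2 * (P * b) by rewrite !mulr_ge0// ?exprn_ge0//; lra.
  by rewrite lerXn2r ?nnegrE// (le_trans h0).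
have h4 : 4 * P * W * b ^+ 6 <= 1 + eta.
  have P0 : 0 < P by lra.
  rewrite -(ler_pM2l P0).
  have -> : P * (4 * P * W * b ^+ 6) = W * (2 * b ^+ 2 * (P * b)) ^+ 2 by ring.
  by apply: le_trans h2 _; apply: le_trans hr _; lra.
have h6 : 1 - 12 * eta <= b ^+ 6.
  have sq : 1 - 4 * eta <= b ^+ 2.
    have : 0 <= eta ^+ 2 by rewrite sqr_ge0.
    rewrite /b; lra.
  have : (1 - 4 * eta) ^+ 3 <= (b ^+ 2) ^+ 3.
    by rewrite lerXn2r ?nnegrE ?sqr_ge0//; lra.
  rewrite -exprM; apply: le_trans.
  have : 0 <= eta ^+ 2 * (48 - 64 * eta).
    by rewrite mulr_ge0 ?sqr_ge0//; lra.
  have -> : (1 - 4 * eta) ^+ 3 = 1 - 12 * eta + eta ^+ 2 * (48 - 64 * eta) by ring.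
  lra.
have q0 : 0 <= 4 * P * W by rewrite !mulr_ge0// ?ltW//; lra.
have h7 : 4 * P * W * (1 - 12 * eta) <= 1 + eta.
  by apply: le_trans h4; rewrite ler_wpM2l.
have e12 : 0 < 1 - 12 * eta by lra.
rewrite -(ler_pM2r e12); apply: le_trans h7 _.
have h240 : 0 <= 7 - 240 * eta by lra.
have : 0 <= eta * (7 - 240 * eta) by rewrite mulr_ge0 ?(ltW e_gt).
have -> : (1 + 20 * eta) * (1 - 12 * eta) = 1 + eta + eta * (7 - 240 * eta) by ring.
lra.
Qed.

(** On the arc of radius [kappa] the smallness of [h] beats the constant of [lac_lower] and
    makes [w] at least 1. *)
Lemma construction_lower t : 1 - 14 * eta <= 4 * P * w t.
Proof.
have e_le := eta_le; have e_gt := eta_gt0; have c_gt := c0_gt0.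
have [h1 h2 h3 _] := dip (nc_expi t).
have /andP[P1 P3] := P_bounds; have W0 := w_gt0 t.
have [tk|kt] := leP (nc (1 - expi t)) kappa.
  have {h3}h3 := h3 tk.
  have lo := weight_lower_crude sg sfg eps_gt0 f_re g_neq0 t.
  have lac := lac_lower K (y_ge0 t) (a_le1 t) (a_near t) (a_far t).
  rewrite -fE -GE in lac.
  have F0 : 0 < re f.[expi t] by apply: lt_le_trans (f_re t).
  have h4 : nc g.[expi t] ^+ 2 * nc f.[expi t] ^+ 2 <= 9 * c0 ^+ 2 * (lac_const * re f.[expi t]).
    have hh : nc h.[expi t] ^+ 2 <= 9 * c0 ^+ 2.
      have -> : 9 * c0 ^+ 2 = (3 * c0) ^+ 2 by ring.
      by rewrite lerXn2r ?nnegrE ?nc_ge0// mulr_ge0// ltW.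
    rewrite /g hornerM ncM exprMn -[leLHS]mulrA; apply: (ler_pM _ _ hh lac).
      exact: sqr_ge0.
    exact: mulr_ge0 (sqr_ge0 _) (sqr_ge0 _).
  have h5 : re f.[expi t] <= w t * re f.[expi t].
    apply: le_trans lo _.
    apply: (@le_trans _ _ (16 * w t * (9 * c0 ^+ 2 * (lac_const * re f.[expi t])))).
      by rewrite ler_wpM2l// mulr_ge0// ltW.
    have -> : 16 * w t * (9 * c0 ^+ 2 * (lac_const * re f.[expi t])) =
      (144 * c0 ^+ 2 * lac_const) * (w t * re f.[expi t]) by ring.
    by rewrite -[leRHS]mul1r ler_wpM2r// mulr_ge0// ltW.
  have w1 : 1 <= w t by rewrite -(ler_pM2r F0) mul1r.
  have : 1 <= P * w t by rewrite -[leLHS]mulr1; apply: ler_pM.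
  have := eta_gt0; lra.
have [Ff GG] := far_from_1 (ltW kt).
have lo := weight_lower sg sfg eps_gt0 f_re g_neq0 t.
apply: (plateau_lower _ _ (nc_ge0 f.[expi t]) _ _ W0 lo).
- rewrite normr_ge0 /=; apply: le_trans Ff.
  have := norm_im_le (f.[expi t] - P%:C); rewrite imB /= subr0; exact.
- have := norm_re_le (f.[expi t] - P%:C); rewrite reB /= => /le_trans/(_ Ff).
  by rewrite ler_norml; lra.
- have := ncD (f.[expi t] - P%:C) P%:C; rewrite subrK ncr ger0_norm; lra.
- rewrite nc_ge0 /= /g hornerM ncM expr2; apply: ler_pM; rewrite ?nc_ge0//.
  have := ncD (G.[expi t] - 1) 1; rewrite subrK nc1; lra.
Qed.

(** A smooth majorant of the indicator of the arc of radius [1 / (2 n)], with a known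
    integral. *)
Definition bump_near (n : nat) (t : R) : R := 4 / n%:R ^+ 2 * nc (dirichlet n).[expi t] ^+ 2.

Lemma bump_near_ge0 n t : 0 <= bump_near n t.
Proof. by rewrite mulr_ge0 ?sqr_ge0// divr_ge0// sqr_ge0. Qed.

Lemma bump_near_ge1 n t : (0 < n)%N -> n%:R * nc (1 - expi t) <= 2^-1 -> 1 <= bump_near n t.
Proof.
move=> n0 nt; have nr : 0 < n%:R :> R by rewrite ltr0n.
have := dirichlet_half (nc_expi t) nt; rewrite /bump_near => hd.
have : (n%:R / 2) ^+ 2 <= nc (dirichlet n).[expi t] ^+ 2.
  by rewrite lerXn2r ?nnegrE ?nc_ge0// divr_ge0// ltW.
rewrite mulrAC ler_pdivlMr ?exprn_gt0// mul1r.
have -> : (n%:R / 2) ^+ 2 = n%:R ^+ 2 / 4 :> R by field.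
lra.
Qed.

Lemma continuous_bump_near n : continuous (bump_near n).
Proof. by apply: continuousMcr; apply: continuous_nc2; exact: ccont_horner. Qed.

Lemma rint_bump_near n : (0 < n)%N -> rint (bump_near n) = 8 * pi / n%:R.
Proof.
move=> n0; have nr : n%:R != 0 :> R by rewrite pnatr_eq0 -lt0n.
rewrite rintZ; last by apply: continuous_nc2; exact: ccont_horner.
by rewrite rint_dirichlet2; field.
Qed.

(** A majorant of [w] on the arc of radius [tau] whose integral over the whole circle is
    small: the first term takes the place of the constant 1 of [lac_upper]. *)
Let excess (t : R) : R := 4 * lac_const / c0 ^+ 2 *
  (bump_near M t + \sum_(k < K.+1) ((2 : R) ^+ k) ^+ 8 * bump_near (scale l k) t).

Let excess_ge0 t : 0 <= excess t.
Proof.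
rewrite mulr_ge0 ?addr_ge0 ?bump_near_ge0//.
  by rewrite divr_ge0 ?sqr_ge0// mulr_ge0// two_ge0.
by apply: sumr_ge0 => k _; rewrite mulr_ge0 ?bump_near_ge0// exprn_ge0// two_ge0.
Qed.

Lemma construction_upper t : 4 * P * w t <= 1 + 20 * eta + 12 * excess t.
Proof.
have e_le := eta_le; have e_gt := eta_gt0; have c_gt := c0_gt0.
have [h1 h2 _ h4] := dip (nc_expi t).
have /andP[P1 P3] := P_bounds; have W0 := w_gt0 t; have e0 := excess_ge0 t.
have [tt|tt] := ltP (nc (1 - expi t)) tau.
  suff : w t <= excess t.
    move=> we; have : P * w t <= 3 * excess t by apply: ler_pM => //; [lra|exact: ltW].
    by have := eta_gt0; lra.
  have up := weight_upper_crude sg sfg eps_gt0 f_re g_neq0 t.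
  have c_ge0 k : 0 <= bump_near (scale l k) t by exact: bump_near_ge0.
  have c_ge1 k : y t < 8 * ((2^-1 : R) ^+ k) ^+ 10 -> 1 <= bump_near (scale l k) t.
    move=> yk; apply: bump_near_ge1; first exact: scale_gt0.
    rewrite natr_scale.
    have p0 : 0 < ((2 : R) ^+ k) ^+ 10 by rewrite exprn_gt0// two_gt0.
    have e8 : ((2 : R) ^+ k) ^+ 10 * (8 * ((2^-1 : R) ^+ k) ^+ 10) = 8.
      by rewrite mulrCA twoXK mulr1.
    have := ltW yk; rewrite -(ler_pM2l p0) e8 /y /m natrM; lra.
  have lac := lac_upper K (y_ge0 t) (a_le1 t) (a_re t) (a_near t) (a_far t) c_ge0 c_ge1.
  rewrite -fE -GE in lac.
  have b1 : 1 <= bump_near M t.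
    apply: bump_near_ge1 => //; apply: le_trans Mtau.
    by rewrite ler_wpM2l// ltW.
  set s := \sum_(k < K.+1) _ in lac.
  have s0 : 0 <= s.
    by apply: sumr_ge0 => k _; rewrite mulr_ge0 ?bump_near_ge0// exprn_ge0// two_ge0.
  have F0 : 0 < re f.[expi t] by apply: lt_le_trans (f_re t).
  have G0 : 0 < nc G.[expi t] by apply: lt_le_trans (le_trans (G_re t) (re_le _)).
  pose D := nc G.[expi t] ^+ 2 * re f.[expi t] ^+ 3.
  have D0 : 0 < D by rewrite mulr_gt0// exprn_gt0.
  have hh : (c0 / 2) ^+ 2 <= nc h.[expi t] ^+ 2.
    rewrite lerXn2r ?nnegrE ?nc_ge0//; first by lra.
    exact: le_trans h2 (re_le _).
  have C0 : 0 <= lac_const :> R by exact: two_ge0.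
  have h5 : w t * (c0 / 2) ^+ 2 * D <= lac_const * (bump_near M t + s) * D.
    apply: (@le_trans _ _ (w t * nc h.[expi t] ^+ 2 * D)).
      by rewrite ler_wpM2r ?(ltW D0)// ler_wpM2l// ltW.
    apply: (@le_trans _ _ (nc f.[expi t] ^+ 2)).
      have gE : nc g.[expi t] ^+ 2 = nc h.[expi t] ^+ 2 * nc G.[expi t] ^+ 2.
        by rewrite /g hornerM ncM exprMn.
      apply: le_trans up; rewrite gE /D -/(w t).
      by rewrite le_eqVlt; apply/orP; left; apply/eqP; ring.
    apply: le_trans lac _; rewrite -/D mulrAC ler_wpM2r ?(ltW D0)//.
    by rewrite ler_wpM2l// lerD2r.
  rewrite ler_pM2r// in h5.
  rewrite /excess -/s mulrAC ler_pdivlMr ?exprn_gt0//.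
  have e1 : (c0 / 2) ^+ 2 = c0 ^+ 2 / 4 by field.
  rewrite e1 in h5; lra.
have [Ff GG] := far_from_1 (le_trans kappa_tau tt).
have up := weight_upper sg sfg eps_gt0 f_re g_neq0 t.
have {h4}h4 := h4 tt.
suff : 4 * P * w t <= 1 + 20 * eta by lra.
apply: (plateau_upper _ _ _ _ W0 up).
- rewrite normr_ge0 /=; apply: le_trans Ff.
  have := norm_im_le (f.[expi t] - P%:C); rewrite imB /= subr0; exact.
- have := re_le (f.[expi t] - P%:C); rewrite reB /=; lra.
- have := ncD (P%:C - f.[expi t]) f.[expi t]; rewrite subrK ncr ger0_norm; last by lra.
  rewrite ncBC; lra.
- rewrite /g hornerM ncM expr2; apply: ler_pM; rewrite ?subr_ge0; try lra.
    by have := ncD (1 - h.[expi t]) h.[expi t]; rewrite subrK nc1; lra.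
  by have := ncD (1 - G.[expi t]) G.[expi t]; rewrite subrK nc1 ncBC; lra.
Qed.

Let continuous_excess : continuous excess.
Proof.
apply: continuousMcr; apply: continuousDr; first exact: continuous_bump_near.
apply: continuous_sumr => k; apply: continuousMcr; exact: continuous_bump_near.
Qed.

(** The bump at scale [k] has integral of order [2^(-10 k) / l] and weight [2^(8 k)]. *)
Let rint_excess : rint excess <= 4 * lac_const / c0 ^+ 2 * (8 * pi * (M%:R^-1 + 2 / l%:R)).
Proof.
have C0 : 0 <= 4 * lac_const / c0 ^+ 2 by rewrite divr_ge0 ?sqr_ge0// mulr_ge0// two_ge0.
have cs : continuous (fun t => \sum_(k < K.+1) ((2 : R) ^+ k) ^+ 8 * bump_near (scale l k) t).
  by apply: continuous_sumr => k; apply: continuousMcr; exact: continuous_bump_near.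
have cM := @continuous_bump_near M.
rewrite rintZ; last exact: continuousDr.
rewrite ler_wpM2l// rintD// rint_bump_near// rint_sum; last first.
  by move=> k; apply: continuousMcr; exact: continuous_bump_near.
rewrite [leRHS]mulrDr lerD2l.
have lr : 0 < l%:R :> R by rewrite ltr0n.
apply: (@le_trans _ _ (\sum_(k < K.+1) 8 * pi / l%:R * ((2^-1 : R) ^+ k) ^+ 2)).
  apply: ler_sum => k _; rewrite rintZ; last exact: continuous_bump_near.
  rewrite rint_bump_near ?scale_gt0// natr_scale.
  rewrite le_eqVlt; apply/orP; left; apply/eqP.
  rewrite exprVn; have := two_gt0 k (R := R); move: ((2 : R) ^+ k) => x x0.
  by field; rewrite !gt_eqF.
rewrite -mulr_sumr.
have p0 := @pi_gt0 R.
have k0 : 0 <= 8 * pi / l%:R :> R by rewrite divr_ge0 ?(ltW lr)// mulr_ge0// ltW.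
apply: le_trans (ler_wpM2l k0 (@sum_half R 2 K.+1 isT)) _.
by rewrite le_eqVlt; apply/orP; left; apply/eqP; ring.
Qed.

Let cw : continuous w.
Proof. exact: (continuous_weight sg sfg eps_gt0 f_re g_neq0). Qed.

(** Since [p] is built from [g], whose value at 1 contains the peak [2^(5 K)], the square of
    [p(1)] is at least of order [2^(10 K)]. *)
Lemma construction_sup (delta A : R) : 0 < delta ->
  4 * lac_const / c0 ^+ 2 * (8 * pi * (M%:R^-1 + 2 / l%:R)) <= pi * eta / 3 ->
  delta * (1 + 22 * eta) <= 1 - 14 * eta ->
  0 <= A -> 48 * A ^+ 2 < c0 ^+ 2 * ((2 : R) ^+ K) ^+ 10 ->
  (A%:E < steklov_sup N delta)%E.
Proof.
have e_le := eta_le; have e_gt := eta_gt0; have c_gt := c0_gt0.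
move=> delta0 exle hdelta A0 hA; have p0 := @pi_gt0 R.
have /andP[P1 P3] := P_bounds.
have P0 : 0 < P by lra.
have lo : (1 - 14 * eta) * (2 * pi) <= 4 * P * rint w.
  rewrite -rint_cst -rintZ//; apply: ler_rint.
  - exact: continuous_cstr.
  - exact: continuousMcr.
  - exact: construction_lower.
have hi : 4 * P * rint w <= (1 + 22 * eta) * (2 * pi).
  have : 4 * P * rint w <= (1 + 20 * eta) * (2 * pi) + 12 * rint excess.
    rewrite -rint_cst -!rintZ// -rintD.
    - apply: ler_rint; [exact: continuousMcr| |exact: construction_upper].
      by apply: continuousDr; [exact: continuous_cstr|exact: continuousMcr].
    - exact: continuous_cstr.
    - exact: continuousMcr.
  have := rint_excess; lra.
have Z0 : 0 < rint w.
  have : 0 < 4 * P * rint w by apply: lt_le_trans lo; rewrite !mulr_gt0//; lra.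
  by rewrite pmulr_rgt0// mulr_gt0.
pose p := opoly N f g lac_f0.
have sp : size p = N.+1.
  exact: (size_opoly sg sfg eps_gt0 f_re f0_gt0 f00 g_neq0 gV).
apply: (@steklov_sup_gt _ delta A N w p) => //.
- move=> t; rewrite -(ler_pM2l (_ : 0 < 4 * P)); last by rewrite mulr_gt0.
  have h1 := construction_lower t.
  have h2 : delta * (4 * P * rint w) <= delta * ((1 + 22 * eta) * (2 * pi)).
    by rewrite ler_wpM2l// ltW.
  have h3 : delta * (1 + 22 * eta) * (2 * pi) <= (1 - 14 * eta) * (2 * pi).
    by rewrite ler_wpM2r// mulr_ge0// ltW.
  have h4 : (1 - 14 * eta) * (2 * pi) <= 4 * P * w t * (2 * pi).
    by rewrite ler_wpM2r// mulr_ge0// ltW.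
  lra.
- move=> k kN.
  have := opoly_moment sg sfg eps_gt0 f_re f0_gt0 f00 g_neq0 gV (ltnW kN).
  by rewrite ltn_eqF// mul0r.
rewrite (rint_opoly2 sg sfg eps_gt0 f_re f0_gt0 f00 g_neq0 gV).
have p1 : c0 ^+ 2 * ((2 : R) ^+ K) ^+ 10 <= nc p.[1] ^+ 2.
  have hG1 : G.[1] = (1 + \sum_(k < K.+1) ((2 : R) ^+ k) ^+ 4 + ((2 : R) ^+ K) ^+ 5)%:C.
    rewrite horner_lacGp /lacG !rmorphD/= rmorph_sum/= fejer_at1 ?scale_gt0// mulr1.
    by congr (_ + _ + _); apply: eq_bigr => k _; rewrite fejer_at1 ?scale_gt0// mulr1.
  have hf1 : f.[1] = eps%:C.
    rewrite horner_lacFp /lacF big1 ?addr0// => k _.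
    by rewrite fejer_at1 ?scale_gt0// subrr mulr0.
  have rp : re p.[1] = 2 * re g.[1].
    have := opolyE lac_f0 sg sfg (0 : R); rewrite expi0 expr1n mul1r -/p => ->.
    rewrite hf1 -rmorphM !reimE /=; ring.
  have hG : ((2 : R) ^+ K) ^+ 5 <= re G.[1].
    have s0 : 0 <= \sum_(k < K.+1) ((2 : R) ^+ k) ^+ 4.
      by apply: sumr_ge0 => k _; exact/exprn_ge0/two_ge0.
    by rewrite hG1 /= lerDr addr_ge0.
  have hh : c0 / 2 <= re h.[1] by have [] := dip (nc1 : nc (1 : R[i]) = 1).
  have hg : c0 / 2 * ((2 : R) ^+ K) ^+ 5 <= re g.[1].
    have iG : im G.[1] = 0 by rewrite hG1.
    rewrite /g hornerM reM iG mulr0 subr0.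
    exact: (ler_pM (ltW c2_gt0) (exprn_ge0 5 (two_ge0 K)) hh hG).
  have h5 : c0 * ((2 : R) ^+ K) ^+ 5 <= nc p.[1].
    by apply: le_trans (re_le _); rewrite rp; lra.
  have -> : c0 ^+ 2 * ((2 : R) ^+ K) ^+ 10 = (c0 * ((2 : R) ^+ K) ^+ 5) ^+ 2.
    by move: ((2 : R) ^+ K) => x; ring.
  apply: lerXn2r => //; rewrite nnegrE ?nc_ge0//.
  exact: mulr_ge0 (ltW c0_gt0) (exprn_ge0 5 (two_ge0 K)).
have Zlow : pi / 12 <= rint w.
  have h7 : pi <= (1 - 14 * eta) * (2 * pi).
    rewrite mulrA -[leLHS]mul1r ler_wpM2r ?(ltW p0)//; lra.
  have : 4 * P * rint w <= 12 * rint w by rewrite ler_wpM2r ?(ltW Z0)//; lra.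
  lra.
have f0h : 2 * pi / lac_f0 <= 4 * pi.
  rewrite ler_pdivrMr//.
  have : 4 * pi * 2^-1 <= 4 * pi * lac_f0 by rewrite ler_wpM2l// mulr_ge0// ltW.
  lra.
apply: (@le_lt_trans _ _ (A ^+ 2 * (4 * pi))); first by rewrite ler_wpM2l// sqr_ge0.
apply: (@lt_le_trans _ _ (c0 ^+ 2 * ((2 : R) ^+ K) ^+ 10 * (pi / 12))).
  have : 48 * A ^+ 2 * (pi / 12) < c0 ^+ 2 * ((2 : R) ^+ K) ^+ 10 * (pi / 12).
    by rewrite ltr_pM2r// divr_gt0.
  lra.
apply: (ler_pM _ _ p1 Zlow); last by rewrite divr_ge0// ltW.
exact: mulr_ge0 (sqr_ge0 _) (exprn_ge0 10 (two_ge0 K)).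
Qed.

End Construction.

(** * The lower bound for the Steklov supremum *)

(** For Lebesgue measure the orthonormal polynomials are the powers of [z]; this settles
    the finitely many degrees too small for the construction. *)
Lemma steklov_sup_gt_lt1 {R : realType} (delta A : R) (N : nat) :
  0 < delta -> delta < 1 -> 0 <= A -> A ^+ 2 < 1 -> (A%:E < steklov_sup N delta)%E.
Proof.
move=> d0 d1 A0 A1; have p0 := @pi_gt0 R.
apply: (@steklov_sup_gt R delta A N (fun=> 1) 'X^N) => //.
- exact: continuous_cstr.
- by rewrite rint_cst mul1r mulr_gt0.
- move=> t; rewrite rint_cst mul1r mulr1 -[leRHS]mul1r ler_wpM2r ?ltW//.
  by rewrite mulr_gt0.
- by rewrite size_polyXn.
- move=> k kN.
  under [X in cint X]eq_fun do rewrite hornerXn mulr1.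
  by rewrite cint_monomials gtn_eqF// mulr0.
- under [X in rint X]eq_fun do rewrite hornerXn ncX nc_expi !expr1n mulr1.
  rewrite hornerXn expr1n nc1 expr1n mul1r rint_cst mul1r.
  by rewrite -[ltRHS]mul1r ltr_pM2r// mulr_gt0.
Qed.

Theorem theorem0p3 (R : realType) (delta : R) (hdelta : 0 < delta < 1) :
  exists C : R, 0 < C /\
    forall n : nat, ((C * Num.sqrt n%:R)%:E < steklov_sup n delta)%E.
Proof.
have /andP[d0 d1] := hdelta.
have p0 := @pi_gt0 R.
(* The relative deviation allowed for the weight off the arc, small enough to give
   [delta * (1 + 22 * eta) <= 1 - 14 * eta]. *)
pose eta : R := (1 - delta) / 40.
have eta0 : 0 < eta by rewrite divr_gt0// subr_gt0.
have eta_le : eta <= 40^-1 by rewrite /eta; lra.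
(* The depth of the dip: [16 * (3 * c0) ^+ 2 * lac_const = 1] brings the weight up to 1
   at the points where [|h| <= 3 * c0]. *)
pose c0 : R := (12 * 2 ^+ 30)^-1.
have c00 : 0 < c0 by rewrite invr_gt0 mulr_gt0// exprn_gt0.
have c0C : 144 * c0 ^+ 2 * lac_const = 1.
  rewrite /c0 /lac_const exprVn exprMn -exprM.
  have -> : (12 : R) ^+ 2 = 144 by ring.
  have := two_gt0 60 (R := R); rewrite -[(30 * 2)%N]/60%N.
  by move: (2 ^+ 60) => x x0; field; rewrite gt_eqF.
have c01 : c0 < 1.
  rewrite invf_lt1 ?mulr_gt0 ?exprn_gt0//.
  have := two_ge1 30 (R := R); lra.
(* The radius [tau] is chosen after [c0], so that the weight on the arc of radius [tau],
   which may be as large as a multiple of [1 / c0 ^+ 2], has a small integral. *)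
pose B : R := 32 * lac_const / c0 ^+ 2.
have B0 : 0 <= B by rewrite divr_ge0 ?sqr_ge0// mulr_ge0// exprn_ge0.
have Be0 : 0 <= 9 * B / eta by rewrite divr_ge0 ?(ltW eta0)// mulr_ge0.
pose M := (Num.bound (9 * B / eta)).+1.
have hM : 9 * B / eta < M%:R.
  by apply: lt_trans (archi_boundP Be0) _; rewrite ltr_nat.
have Mr : 0 < M%:R :> R by rewrite ltr0n.
pose tau : R := (2 * M%:R)^-1.
have tau0 : 0 < tau by rewrite invr_gt0 mulr_gt0.
have [h [kappa0 [k00 hdip]]] := exists_dip c00 c01 eta0 tau0.
pose kappa := Num.min kappa0 tau.
have kappa_gt0 : 0 < kappa by rewrite lt_min k00.
have ke0 : 0 <= 12 / (eta * kappa) by rewrite divr_ge0// mulr_ge0// ltW.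
(* The order [16 l] of the coarsest kernel is chosen last: [f] and [g / h] must have
   settled to their plateaus at distance [kappa] from 1. *)
pose l := (M + Num.bound (12 / (eta * kappa)))%N.
have lM : (M <= l)%N by rewrite leq_addr.
have l0 : (0 < l)%N by apply: leq_trans lM.
have lr : 0 < l%:R :> R by rewrite ltr0n.
have l_large : 12 / eta <= (16 * l)%:R * kappa.
  have h1 : 12 / (eta * kappa) <= l%:R.
    apply: le_trans (ltW (archi_boundP ke0)) _; rewrite ler_nat; exact: leq_addl.
  have h2 : 12 / eta <= l%:R * kappa.
    rewrite -ler_pdivrMr//; apply: le_trans h1.
    by rewrite le_eqVlt; apply/orP; left; apply/eqP; field; rewrite !gt_eqF.
  apply: le_trans h2 _; rewrite ler_wpM2r ?(ltW kappa_gt0)// ler_nat.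
  exact: leq_pmull.
have dip z : nc z = 1 ->
    [/\ nc h.[z] <= 1 + eta, c0 / 2 <= re h.[z],
        nc (1 - z) <= kappa -> nc h.[z] <= 3 * c0 &
        tau <= nc (1 - z) -> nc (1 - h.[z]) <= eta].
  move=> z1; have [h1 h2 h3 h4] := hdip z z1; split => // hz.
  by apply: h3; apply: le_trans hz _; rewrite ge_min lexx.
pose L := (size h + (16 * l + 16 * l))%N.
have L0 : (0 < L)%N by rewrite !addn_gt0 muln_gt0 l0 !orbT.
have Lr : 0 < L%:R :> R by rewrite ltr0n.
pose D : R := 96 * 2 ^+ 10 * L%:R.
have D0 : 0 < D by rewrite !mulr_gt0// two_gt0.
pose q : R := c0 ^+ 2 / D.
have q0 : 0 < q by rewrite divr_gt0// exprn_gt0.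
exists (Num.sqrt q); split => [|N]; first by rewrite sqrtr_gt0.
have A0 : 0 <= Num.sqrt q * Num.sqrt N%:R by rewrite mulr_ge0 ?sqrtr_ge0.
have A2 : (Num.sqrt q * Num.sqrt N%:R) ^+ 2 = q * N%:R.
  by rewrite exprMn !sqr_sqrtr// ltW.
have [NL|LN] := ltnP N L.
  apply: steklov_sup_gt_lt1 => //; rewrite A2.
  rewrite /q mulrAC ltr_pdivrMr// mul1r /D.
  have h1 : c0 ^+ 2 * N%:R <= 1 * L%:R.
    by apply: ler_pM; rewrite ?sqr_ge0// ?ler_nat 1?ltnW// exprn_ile1// ltW.
  have : 1 <= 2 ^+ 10 :> R by exact: two_ge1.
  move=> h2; have h3 := ler_wpM2r (ltW Lr) h2.
  move: h1 Lr h3; rewrite -[96 * _ * _]mulrA.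
  by move: (2 ^+ 10) (c0 ^+ 2 * N%:R) (L%:R); clear => x y z; lra.
(* The largest number of scales for which the degrees stay below [N]. *)
pose K := trunc_log (2 ^ 10) (N %/ L).
have NL0 : (0 < N %/ L)%N by rewrite divn_gt0.
have KN : (2 ^ (10 * K) <= N %/ L)%N.
  by rewrite expnM; apply: trunc_logP.
have NK : (N %/ L < 2 ^ (10 * K.+1))%N.
  by rewrite expnM; apply: trunc_log_ltn.
have N_large : (size h + (scale (16 * l) K + scale (16 * l) K) <= N)%N.
  apply: (@leq_trans (L * 2 ^ (10 * K))).
    by rewrite /L !mulnDl leq_add2r leq_pmulr// expn_gt0.
  by rewrite mulnC (leq_trans _ (leq_trunc_div N L))// leq_mul2r KN orbT.
have Nlt : N%:R < 2 ^+ 10 * (2 ^+ K) ^+ 10 * L%:R :> R.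
  have : (N < 2 ^ (10 * K.+1) * L)%N by rewrite -ltn_divLR.
  rewrite -(ltr_nat R) natrM natrX mulnC exprM [2 ^+ K.+1]exprS exprMn.
  by [].
apply: (@construction_sup R h c0 eta tau kappa M l K N) => //.
- by rewrite c0C.
- by rewrite ge_min lexx orbT.
- rewrite /tau invfM mulrCA mulfV ?gt_eqF// mulr1; exact: lexx.
- have h1 : M%:R^-1 + 2 / l%:R <= 3 / M%:R :> R.
    have : l%:R^-1 <= M%:R^-1 :> R by rewrite lef_pV2 ?posrE// ler_nat.
    by move: (l%:R^-1) (M%:R^-1); clear => x y xy; lra.
  have h2 : B * (3 / M%:R) <= eta / 3.
    rewrite mulrA ler_pdivrMr//.
    have : 9 * B <= eta * M%:R by rewrite [leRHS]mulrC -ler_pdivrMr// ltW.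
    by move: (B) (eta) (M%:R); clear => x y z xyz; lra.
  have -> : 4 * lac_const / c0 ^+ 2 * (8 * pi * (M%:R^-1 + 2 / l%:R)) =
    pi * (B * (M%:R^-1 + 2 / l%:R)) by rewrite /B; ring.
  have -> : pi * eta / 3 = pi * (eta / 3) by ring.
  rewrite ler_wpM2l ?(ltW p0)//; apply: le_trans h2.
  by rewrite ler_wpM2l.
- have : delta * (22 * eta) <= 1 * (22 * eta).
    by rewrite ler_wpM2r ?(ltW d1)// mulr_ge0// ltW.
  by rewrite /eta; move: d1; clear; lra.
- have t0 : 0 < 2 ^+ 10 :> R by exact: two_gt0.
  have -> : 48 * (Num.sqrt q * Num.sqrt N%:R) ^+ 2 = c0 ^+ 2 * (N%:R / (2 * 2 ^+ 10 * L%:R)).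
    rewrite A2 /q /D; move: (2 ^+ 10) t0 => t t0.
    by field; rewrite !gt_eqF.
  rewrite ltr_pM2l ?exprn_gt0// ltr_pdivrMr; last by rewrite !mulr_gt0.
  apply: lt_le_trans Nlt _.
  have : 0 <= 2 ^+ 10 * (2 ^+ K) ^+ 10 * L%:R :> R.
    by rewrite !mulr_ge0 ?exprn_ge0 ?two_ge0 ?(ltW Lr).
  by move: (2 ^+ 10) ((2 ^+ K) ^+ 10) (L%:R); clear => x y z; lra.
Qed.
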